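(* Let $J$ be a constant, invertible, skew-Hermitian $n\times n$ matrix, and let $q,w\in\mathcal D^{\prime0}((a,b))^{n\times n}$ with $q$ Hermitian and $w$ non-negative. Let $T_{\max}$ and $T_{\min}$ be the maximal and minimal relations in $L^2(w)\times L^2(w)$ associated with the equation $Ju'+qu=wf$ on $(a,b)$. Then $T_{\min}^*=T_{\max}$.
   Context: $(a,b)$ is an open interval of the real line (endpoints may be infinite). $\mathcal D^{\prime0}((a,b))$ is the space of distributions of order $0$ on $(a,b)$, i.e. distributional derivatives of complex-valued functions of locally bounded variation; on compact subintervals these are identified with complex measures. An $n\times n$ matrix $w$ with such entries is non-negative if it is a positive-semidefinite-matrix-valued measure (locally), and $q$ is Hermitian if $q=q^*$ (entrywise as measures). $L^2(w)$ is the Hilbert space of equivalence classes $[f]$ of ($w$-measurable) functions $f:(a,b)\to\mathbb C^n$ with $\|f\|^2=\int f^*wf<\infty$, where $f$ and $g$ are equivalent if $\|f-g\|=0$; the inner product is $\langle u,v\rangle=\int u^*wv$. (If $w=\tilde w\,\operatorname{tr}w$ with $\tilde w$ the Radon–Nikodym density with respect to the trace measure, then $\int u^*wv=\int u^*\tilde w v\,d\operatorname{tr}w$.) A function $u$ of locally bounded variation has left- and right-hand limits $u^-$ and $u^+$; it is balanced if $u=(u^++u^-)/2$ pointwise. A solution of $Ju'+qu=wf$ on an open interval is a balanced $\mathbb C^n$-valued function $u$ of locally bounded variation such that $Ju'+qu=wf$ as distributions (measures), $u'$ being the distributional derivative and $qu$, $wf$ the products of measures with functions. $T_{\max}$ is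 the set of all pairs $([u],[f])\in L^2(w)\times L^2(w)$ for which there are representatives $u\in[u]$ and $f\in[f]$ such that $u$ is balanced, of locally bounded variation, and $Ju'+qu=wf$ on $(a,b)$. $T_{\min}$ is the set of those elements of $T_{\max}$ for which the solution $u\in[u]$ may be chosen with compact support in $(a,b)$. The adjoint of a linear relation $S\subset L^2(w)\times L^2(w)$ is $S^*=\{(v,g)\in L^2(w)\times L^2(w):\ \langle g,u\rangle=\langle v,f\rangle \text{ for all }(u,f)\in S\}$. *)

(* Defs.v *)
From HB Require Import structures.
From mathcomp Require Import all_boot all_order all_algebra.
From mathcomp Require Import all_classical all_reals all_analysis.
From mathcomp Require Export complex.

Set Implicit Arguments.
Unset Strict Implicit.
Unset Printing Implicit Defensive.

Import Order.TTheory GRing.Theory Num.Theory.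
Import numFieldNormedType.Exports.

Local Open Scope classical_set_scope.
Local Open Scope ring_scope.
Local Open Scope complex_scope.
Local Open Scope sesquilinear_scope.

Local Notation Re := complex.Re.
Local Notation Im := complex.Im.

Section LocalMeasures.
Context {R : realType}.
Implicit Types (a b : \bar R) (A B C : set R).

Definition oint a b : set R := [set x | (a < x%:E)%E /\ (x%:E < b)%E].

(* Borel sets that are relatively compact in (a, b). *)
Definition rcborel a b : set (set R) :=
  [set B | measurable B /\
    exists K : set R, [/\ compact K, K `<=` oint a b & B `<=` K]].

(* m restricts to a finite signed measure on every compact subset of (a, b);
   the values of m outside rcborel a b are irrelevant. *)
Definition loc_sigma_additive a b (m : set R -> R) :=
  forall F : (set R)^nat, (forall k, measurable (F k)) -> trivIset setT F ->
    rcborel a b (\bigcup_k F k) ->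
    series (m \o F) @ \oo --> m (\bigcup_k F k).

Record loc_charge a b := LocCharge {
  lcharge :> set R -> R;
  lchargeP : loc_sigma_additive a b lcharge }.

(* The positive part in the Jordan decomposition of a local signed measure: a
   measure that is finite on rcborel a b and null outside (a, b). *)
Definition pos_part a b (m : loc_charge a b) A : \bar R :=
  ereal_sup [set (m B)%:E | B in [set B | rcborel a b B /\ B `<=` A]].

Section PosPartMeasure.
Context {a b : \bar R} (m : loc_charge a b).

Lemma measurable_rcborel B C : rcborel a b B -> measurable C ->
  C `<=` B -> rcborel a b C.
Proof.
move=> [_ [K [cK Kab BK]]] mC CB; split=> //; exists K; split=> //.
exact: (subset_trans CB).
Qed.

Lemma rcborel0 : rcborel a b set0.
Proof. by split=> //; exists set0; split=> //; exact: compact0. Qed.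

Lemma rcborelU B C : rcborel a b B -> rcborel a b C -> rcborel a b (B `|` C).
Proof.
move=> [mB [K [cK Kab BK]]] [mC [L [cL Lab CL]]].
split; first exact: measurableU.
exists (K `|` L); split; [exact: compactU|by rewrite subUset|exact: setUSS].
Qed.

Lemma lcharge0 : m set0 = 0.
Proof.
have h : series (m \o (fun=> set0)) @ \oo --> m set0.
  have := @lchargeP _ _ m (fun=> set0) (fun=> measurable0).
  rewrite bigcup0//; apply; last exact: rcborel0.
  by apply/trivIsetP => *; rewrite set0I.
have /cvg_series_cvg_0 : cvgn (series (m \o (fun=> set0))).
  by apply/cvg_ex; exists (m set0).
by move/(cvg_lim (@Rhausdorff R)); rewrite lim_cst//; exact: Rhausdorff.
Qed.

Lemma lcharge_setU B C : rcborel a b B -> rcborel a b C ->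
  B `&` C = set0 -> m (B `|` C) = m B + m C.
Proof.
move=> rB rC BC0; have m0 := lcharge0.
have mF : forall k, measurable (bigcup2 B C k).
  by move=> [|[|k]]; [exact: rB.1|exact: rC.1|exact: measurable0].
have tF : trivIset setT (bigcup2 B C) by rewrite -trivIset_bigcup2.
have rF : rcborel a b (\bigcup_k bigcup2 B C k).
  by rewrite bigcup2E; exact: rcborelU.
have := @lchargeP _ _ m _ mF tF rF; rewrite bigcup2E => h.
have {}h := cvg_lim (@Rhausdorff R) h; rewrite -h.
apply: (lim_near_cst (@Rhausdorff R)).
exists 2%N => // -[|[|n]]//= _.
by rewrite /series/= 2?big_nat_recl//= big1 ?addr0.
Qed.

Lemma le_pos_part A B : rcborel a b B -> B `<=` A ->
  ((m B)%:E <= pos_part m A)%E.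
Proof. by move=> rB BA; apply: ereal_sup_ubound; exists B. Qed.

Lemma pos_part_mono A B : A `<=` B -> (pos_part m A <= pos_part m B)%E.
Proof.
move=> AB; apply: ereal_sup_le => _ [C [rC CA] <-]; exists C => //.
by split=> //; exact: subset_trans AB.
Qed.

Let pos_part_ge0 A : (0 <= pos_part m A)%E.
Proof. by have := le_pos_part rcborel0 (@sub0set _ A); rewrite lcharge0. Qed.

Let pos_part0 : pos_part m set0 = 0%E.
Proof.
apply/eqP; rewrite eq_le; apply/andP; split.
  apply: ge_ereal_sup => _ /= [B [_ B0] <-].
  by move: B0; rewrite subset0 => ->; rewrite lcharge0.
exact: pos_part_ge0.
Qed.

Let pos_part_superadd A B : A `&` B = set0 ->
  (pos_part m A + pos_part m B <= pos_part m (A `|` B))%E.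
Proof.
move=> AB0; have [->|Mfin] := eqVneq (pos_part m (A `|` B)) +oo%E.
  by rewrite leey.
have MM : pos_part m (A `|` B) \is a fin_num.
  by rewrite ge0_fin_numE// lt_neqAle Mfin leey.
have AM : pos_part m A \is a fin_num.
  rewrite ge0_fin_numE//; apply: (@le_lt_trans _ _ (pos_part m (A `|` B))).
    exact: pos_part_mono.
  by rewrite lt_neqAle Mfin leey.
rewrite addeC -leeBrDr//.
apply: ge_ereal_sup => _ [C [rC CB] <-].
rewrite leeBrDr// addeC -leeBrDr//.
apply: ge_ereal_sup => _ [D [rD DA] <-].
rewrite leeBrDr// -EFinD -lcharge_setU//; last first.
  by apply/seteqP; split=> // x [Dx Cx]; rewrite -AB0; split; auto.
by apply: le_pos_part; [exact: rcborelU|exact: setUSS].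
Qed.

Let pos_part_sigma_additive : semi_sigma_additive (pos_part m).
Proof.
move=> F mF tF mUF; set M := pos_part m (\bigcup_n F n).
have cF : cvgn (fun n => (\sum_(0 <= i < n) pos_part m (F i))%E).
  exact: is_cvg_ereal_nneg_natsum.
suff <- : (\sum_(0 <= i <oo) pos_part m (F i))%E = M by [].
apply/eqP; rewrite eq_le; apply/andP; split.
  apply: lime_le => //; apply: nearW => n.
  apply: (@le_trans _ _ (pos_part m (\big[setU/set0]_(i < n) F i))); last first.
    by apply: pos_part_mono; exact: bigsetU_bigcup.
  rewrite big_mkord; elim: n => [|n ih]; first by rewrite !big_ord0 pos_part0.
  rewrite !big_ord_recr/=; apply: le_trans (pos_part_superadd _).
    by rewrite leeD2r.
  apply/seteqP; split=> // x []; rewrite -bigcup_mkord => -[k /= kn Fkx] Fnx.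
  suff : k = n by move=> kE; rewrite kE ltnn in kn.
  by apply: (tF _ _ I I); exists x.
apply: ge_ereal_sup => _ [B [rB BF] <-].
have BE : \bigcup_k (B `&` F k) = B.
  by rewrite -setI_bigcupr; apply/setIidPl.
have mBF k : measurable (B `&` F k) by apply: measurableI => //; exact: rB.1.
have h : series (m \o (fun k => B `&` F k)) @ \oo --> m B.
  rewrite -[in X in _ --> X]BE; apply: lchargeP => //.
  - exact: trivIset_setIl.
  - by rewrite BE.
have /cvg_lim <- // : (EFin \o series (m \o (fun k => B `&` F k))) @ \oo -->
    (m B)%:E by apply: cvg_EFin h => //; exact: nearW.
apply: lee_lim => //.
  by apply/cvg_ex; exists (m B)%:E; apply: cvg_EFin h => //; exact: nearW.
apply: nearW => n; rewrite /series/= -sumEFin; apply: lee_sum => k _.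
apply: le_pos_part; last exact: subIsetr.
by apply: (measurable_rcborel rB) => //; exact: subIsetl.
Qed.

HB.instance Definition _ := isMeasure.Build _ _ _ (pos_part m)
  pos_part0 pos_part_ge0 pos_part_sigma_additive.

End PosPartMeasure.

Lemma loc_sigma_additive_opp a b (m : loc_charge a b) :
  loc_sigma_additive a b (fun B => - m B).
Proof.
move=> F mF tF rF.
have -> : series ((fun B => - m B) \o F) = - series (m \o F).
  by apply/funext => k; rewrite /series/= sumrN.
by apply: cvgN; exact: lchargeP.
Qed.

Definition lcharge_opp a b (m : loc_charge a b) :=
  LocCharge (@loc_sigma_additive_opp _ _ m).

Lemma loc_sigma_additive_sum a b n (m : 'I_n -> loc_charge a b) :
  loc_sigma_additive a b (fun B => \sum_i m i B).
Proof.
move=> F mF tF rF.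
have -> : series ((fun B => \sum_i m i B) \o F) =
    fun k => \sum_i series (m i \o F) k.
  by apply/funext => k; rewrite /series/= exchange_big.
by apply: cvg_big => [|i _]; [exact: add_continuous|exact: lchargeP].
Qed.

Definition lcharge_sum a b n (m : 'I_n -> loc_charge a b) :=
  LocCharge (@loc_sigma_additive_sum _ _ _ m).

Definition Rint_charge a b (m : loc_charge a b) (f : R -> R) : R :=
  \int[pos_part m]_(x in oint a b) f x -
  \int[pos_part (lcharge_opp m)]_(x in oint a b) f x.

Definition Cintegral d (T : measurableType d) (mu : {measure set T -> \bar R})
    (A : set T) (f : T -> R[i]) : R[i] :=
  (\int[mu]_(x in A) Re (f x)) +i* (\int[mu]_(x in A) Im (f x)).

(* A distribution of order 0 on (a, b), identified with the set function that
   is a complex measure on each compact subset of (a, b). *)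
Record dist0 a b := Dist0 {
  dist0_val :> set R -> R[i];
  dist0_ReP : loc_sigma_additive a b (fun B => Re (dist0_val B));
  dist0_ImP : loc_sigma_additive a b (fun B => Im (dist0_val B)) }.

Definition Re_charge a b (d : dist0 a b) := LocCharge (@dist0_ReP _ _ d).
Definition Im_charge a b (d : dist0 a b) := LocCharge (@dist0_ImP _ _ d).

Definition dist0_int a b (d : dist0 a b) (f : R -> R[i]) : R[i] :=
  (Rint_charge (Re_charge d) (fun x => Re (f x)) -
   Rint_charge (Im_charge d) (fun x => Im (f x))) +i*
  (Rint_charge (Re_charge d) (fun x => Im (f x)) +
   Rint_charge (Im_charge d) (fun x => Re (f x))).

End LocalMeasures.

Section Equation.
Context {R : realType} {a b : \bar R} {n : nat}.
Local Notation C := R[i].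
Local Notation I := (oint a b).
(* All functions below matter only through their values on (a, b). *)
Local Notation vfun := (R -> 'cV[C]_n).
Implicit Types (J : 'M[C]_n) (q w : 'M[dist0 a b]_n) (u v f g : vfun).

Definition dist0_hermitian q :=
  forall i j B, rcborel a b B -> q i j B = (q j i B)^*.

Definition dist0_nonneg w :=
  forall B, rcborel a b B -> forall z : 'cV[C]_n,
    0 <= (z^t* *m (\matrix_(i, j) w i j B) *m z) 0 0.

(* For non-negative w the diagonal entries are non-negative on rcborel a b, so
   that the positive part of their sum is tr w. *)
Definition trace_measure w : {measure set R -> \bar R} :=
  pos_part (lcharge_sum (fun i => Re_charge (w i i))).

Definition is_density w (wt : R -> 'M[C]_n) := forall i j,
  [/\ measurable_fun I (fun x => Re (wt x i j)),
      measurable_fun I (fun x => Im (wt x i j)) &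
      forall B, rcborel a b B ->
        [/\ (trace_measure w).-integrable B (fun x => (Re (wt x i j))%:E),
            (trace_measure w).-integrable B (fun x => (Im (wt x i j))%:E) &
            w i j B = Cintegral (trace_measure w) B (fun x => wt x i j)]].

(* The density of w with respect to tr w exists, by the Radon-Nikodym theorem,
   and is unique almost everywhere, when w is non-negative. *)
Definition density w : R -> 'M[C]_n := xget (fun=> 0) [set wt | is_density w wt].

Definition inner w u v : C :=
  Cintegral (trace_measure w) I
    (fun x => ((u x)^t* *m density w x *m v x) 0 0).

(* The squared norm of f, possibly infinite; the integrand is real almost everywhere. *)
Definition sqnorm w f : \bar R :=
  (\int[trace_measure w]_(x in I)
    (Re (((f x)^t* *m density w x *m f x) 0 0))%:E)%E.

Definition vmeasurable f := forall i,
  measurable_fun I (fun x => Re (f x i 0)) /\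
  measurable_fun I (fun x => Im (f x i 0)).

Definition L2fun w : set vfun :=
  [set f | vmeasurable f /\ (sqnorm w f < +oo)%E].

Definition L2class w f : set vfun :=
  [set g | L2fun w g /\ sqnorm w (fun x => f x - g x) = 0%E].

Definition L2 w := {U : set vfun | exists2 f, L2fun w f & U = L2class w f}.

Definition L2_repr w (U : L2 w) : vfun := s2val (cid2 (svalP U)).

Definition L2_inner w (U V : L2 w) : C := inner w (L2_repr U) (L2_repr V).

Definition adjoint w (S : set (L2 w * L2 w)) : set (L2 w * L2 w) :=
  [set VG | forall UF, S UF -> L2_inner VG.2 UF.1 = L2_inner VG.1 UF.2].

Definition compact_support (V : zmodType) (h : R -> V) :=
  exists K : set R, [/\ compact K, K `<=` I &
    forall x, I x -> ~ K x -> h x = 0].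

(* Real-valued test functions suffice, since distributions are C-linear. *)
Definition test_fun (phi : R -> R) :=
  (forall k x, I x -> derivable (derive1n k phi) x 1) /\ compact_support phi.

Definition loc_bv (g : R -> R) :=
  forall c d : R, `[c, d] `<=` I -> bounded_variation c d g.

Definition balanced (g : R -> R) := forall t, I t ->
  g t = (lim (g x @[x --> t^'+]) + lim (g x @[x --> t^'-])) / 2.

Definition balanced_loc_bv u := forall i,
  [/\ loc_bv (fun x => Re (u x i 0)), balanced (fun x => Re (u x i 0)),
      loc_bv (fun x => Im (u x i 0)) & balanced (fun x => Im (u x i 0))].

Definition ddistr u (phi : R -> R) : 'cV[C]_n :=
  \col_i - Cintegral (@lebesgue_measure R) I (fun x => (derive1 phi x)%:C * u x i 0).

Definition qdistr q u (phi : R -> R) : 'cV[C]_n :=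
  \col_i \sum_j dist0_int (q i j) (fun x => (phi x)%:C * u x j 0).

(* For f in L2fun w the function density w * f is locally integrable with
   respect to tr w, whereas a single component of f need not be integrable with
   respect to an entry of w. *)
Definition wdistr w f (phi : R -> R) : 'cV[C]_n :=
  \col_i Cintegral (trace_measure w) I
    (fun x => (phi x)%:C * (density w x *m f x) i 0).

Definition solution J q w f u := balanced_loc_bv u /\
  forall phi, test_fun phi ->
    J *m ddistr u phi + qdistr q u phi = wdistr w f phi.

Definition Tmax J q w : set (L2 w * L2 w) :=
  [set UF | exists u f, [/\ sval UF.1 u, sval UF.2 f & solution J q w f u]].

Definition Tmin J q w : set (L2 w * L2 w) :=
  [set UF | exists u f, [/\ sval UF.1 u, sval UF.2 f, solution J q w f u &
    compact_support u]].

End Equation.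

Arguments solution {R a b n} J q w f u.
Arguments L2fun {R a b n} w _.
Arguments L2class {R a b n} w f _.
Arguments Tmax {R a b n} J q w _.
Arguments Tmin {R a b n} J q w _.

(* Main.v *)
Require Import Defs.
From HB Require Import structures.
From mathcomp Require Import all_boot all_order all_algebra.
From mathcomp Require Import all_classical all_reals all_analysis.
From mathcomp Require finmap.
From mathcomp Require Import measurable_realfun ring lra.
Set Implicit Arguments.
Unset Strict Implicit.
Unset Printing Implicit Defensive.
Import Order.TTheory GRing.Theory Num.Theory.
Import numFieldNormedType.Exports.
Import HBNNSimple.
Local Open Scope classical_set_scope.
Local Open Scope ring_scope.

(** Green's formula settles one inclusion: if J u' + q u = w f and J v' + q v = w g, and if u
has compact support, then the integrals of v^* w f and g^* w u agree ([Green_symmetric]), so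
that every element of Tmax is orthogonal to Tmin.

Conversely let (v, g) be orthogonal to Tmin. Since q and w are measures, an initial value
problem for the equation may have no solution: at an atom of q the jump relation can be
singular. So one cannot subtract from v a solution of J y' + q y = w g, as one would do for
regular coefficients. The values of the wanted solution are instead produced by duality. A cut
of the line is a point together with one of its sides; a function of bounded variation has one
value, its one-sided limit, at each cut. Admit as test functions also functions u that solve
J u' + q u = w psi up to finitely many jumps at cuts, and put
l = (integral of g^* w u) - (integral of v^* w psi). By orthogonality l = 0 if there are no
jumps; hence l depends only on the jumps, linearly, and by Zorn's lemma it extends to a linear
form on all jump functions ([linear_graph_extension]). This form is a sum of terms z^T J r over
the jumps r ([cut_values_exist]), and its coefficients z are the one-sided limits of the
solution that is looked for.

To see this, cut the interval into pieces on which boundary value problems with prescribed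
means can be solved by a Neumann series ([short_solution]): one point, whatever its mass, and
punctured one-sided neighbourhoods of small mass ([short_near]). Testing on one piece, and
comparing with Green's formula for the solution with right-hand side g whose mean is that of z,
shows that z is a primitive of J^-1 (w g - q y), where y is the mean of the two values of z at
a point, and that w (y - v) = 0 almost everywhere ([local_identity], [short_piece]). The pieces
fit together ([local_to_global]), so y is a representative of v that solves the equation with g
([solution_of_orthogonal]).

The rest translates between the two settings. All coefficients get densities with respect to
one measure ([common_densities_exist]): a local charge is a finite charge on compact sets, so
the theorems of Hahn and Radon-Nikodym apply there. Vectors of C^n are written in 2n real
coordinates. Finally, a balanced function of locally bounded variation has the distributional
derivative h lam if and only if it is the mean of the one-sided values of a primitive of h lam
([cut_primitive_weak], [weak_derivative_cut_primitive]); this turns the distributional equation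
into the equation on cuts ([solution_cut], [solution_of_cut]). *)

(** * Integrals of real-valued functions *)

Section RealIntegrals.
Context d (T : measurableType d) (R : realType).
Variable mu : {measure set T -> \bar R}.
Implicit Types (f g : T -> R) (D : set T).

Definition rintegrable D f := mu.-integrable D (EFin \o f).

Lemma rintegrable_measurable D f : rintegrable D f -> measurable_fun D f.
Proof. by move=> /measurable_int /measurable_EFinP. Qed.

Lemma EFin_Rintegral D f : measurable D -> rintegrable D f ->
  (\int[mu]_(x in D) f x)%:E = (\int[mu]_(x in D) (f x)%:E)%E.
Proof. by move=> mD hf; rewrite fineK//; exact: integrable_fin_num. Qed.

Lemma rintegrable0 D : measurable D -> rintegrable D (cst 0).
Proof. by move=> mD; exact: integrable0. Qed.

Lemma rintegrableD D f g : measurable D -> rintegrable D f -> rintegrable D g ->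
  rintegrable D (fun x => f x + g x).
Proof. by move=> mD hf hg; apply: eq_integrable (integrableD mD hf hg). Qed.

Lemma rintegrableB D f g : measurable D -> rintegrable D f -> rintegrable D g ->
  rintegrable D (fun x => f x - g x).
Proof. by move=> mD hf hg; apply: eq_integrable (integrableB mD hf hg). Qed.

Lemma rintegrableZ D r f : measurable D -> rintegrable D f ->
  rintegrable D (fun x => r * f x).
Proof. by move=> mD hf; apply: eq_integrable (integrableZl mD r hf). Qed.

Lemma rintegrableN D f : measurable D -> rintegrable D f ->
  rintegrable D (fun x => - f x).
Proof. by move=> mD hf; have := rintegrableZ (-1) mD hf; under eq_fun do rewrite mulN1r. Qed.

Lemma rintegrable_sum D (I : Type) (s : seq I) (f : I -> T -> R) : measurable D ->
  (forall i, rintegrable D (f i)) -> rintegrable D (fun x => \sum_(i <- s) f i x).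
Proof.
move=> mD hf; have := @integrable_sum _ _ _ mu D mD I s xpredT (fun i => EFin \o f i) (fun i _ => hf i).
by apply: (eq_integrable mD) => x _; rewrite /= sumEFin.
Qed.

Lemma Rintegral_sum D (I : Type) (s : seq I) (f : I -> T -> R) : measurable D ->
  (forall i, rintegrable D (f i)) ->
  \int[mu]_(x in D) (\sum_(i <- s) f i x) = \sum_(i <- s) \int[mu]_(x in D) f i x.
Proof.
move=> mD hf; elim: s => [|i s ih].
  by rewrite big_nil; under eq_Rintegral do rewrite big_nil; rewrite Rintegral_cst// mul0r.
rewrite big_cons -ih -RintegralD//; [|exact: hf|exact: rintegrable_sum].
by apply: eq_Rintegral => x _; rewrite big_cons.
Qed.

Lemma RintegralN D f : measurable D -> rintegrable D f ->
  \int[mu]_(x in D) (- f x) = - \int[mu]_(x in D) f x.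
Proof.
move=> mD hf; rewrite -mulN1r -RintegralZl//.
by apply: eq_Rintegral => x _; rewrite mulN1r.
Qed.

Lemma eq_rintegrable D f g : measurable D -> {in D, f =1 g} ->
  rintegrable D f -> rintegrable D g.
Proof. by move=> mD fg; apply: (eq_integrable mD) => x Dx /=; rewrite fg. Qed.

Lemma le_rintegrable D f g : measurable D -> measurable_fun D f ->
  (forall x, D x -> `|f x| <= g x) -> rintegrable D g -> rintegrable D f.
Proof.
move=> mD mf fg; apply: le_integrable => //; first exact/measurable_EFinP.
by move=> x Dx /=; rewrite lee_fin (le_trans (fg x Dx))// ler_norm.
Qed.

Lemma rintegrable_norm D f : measurable D -> rintegrable D f ->
  rintegrable D (fun x => `|f x|).
Proof. by move=> mD; exact: integrable_norm. Qed.

Lemma rintegrableS D E f : measurable D -> measurable E -> E `<=` D ->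
  rintegrable D f -> rintegrable E f.
Proof. exact: integrableS. Qed.

Lemma rintegrable_restrict D E f : measurable D -> measurable E ->
  rintegrable (E `&` D) f <-> rintegrable E (f \_ D).
Proof.
move=> mD mE; rewrite /rintegrable -restrict_EFin.
exact: integrable_restrict.
Qed.

Lemma rintegrable_mkcond D f : measurable D ->
  rintegrable D f <-> rintegrable setT (f \_ D).
Proof. by move=> mD; rewrite -rintegrable_restrict// setTI. Qed.

(** A bounded measurable factor preserves integrability. *)
Lemma rintegrable_bndl D f g (M : R) : measurable D -> measurable_fun D f ->
  (forall x, D x -> `|f x| <= M) -> rintegrable D g ->
  rintegrable D (fun x => f x * g x).
Proof.
move=> mD mf fM hg; apply: (@le_rintegrable _ _ (fun x => M * `|g x|)) => //.
- by apply: measurable_funM => //; exact: rintegrable_measurable.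
- by move=> x Dx; rewrite normrM ler_wpM2r// fM.
- exact/rintegrableZ/rintegrable_norm.
Qed.

Lemma le_norm_Rintegral D f g : measurable D -> measurable_fun D f ->
  (forall x, D x -> `|f x| <= g x) -> rintegrable D g ->
  `|\int[mu]_(x in D) f x| <= \int[mu]_(x in D) g x.
Proof.
move=> mD mf fg hg; have hf := le_rintegrable mD mf fg hg.
apply: (le_trans (le_normr_Rintegral mD hf)).
by apply: le_Rintegral => //; exact: rintegrable_norm.
Qed.

Lemma Rintegral_restrict_ge0 D E f : measurable D -> measurable E -> E `<=` D ->
  rintegrable D f -> (forall x, D x -> 0 <= f x) ->
  \int[mu]_(x in E) f x <= \int[mu]_(x in D) f x.
Proof.
move=> mD mE ED hf f0; rewrite -(setIidr ED) Rintegral_mkcondr.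
apply: le_Rintegral => //.
  by apply/rintegrable_restrict => //; apply: rintegrableS hf => //; exact: measurableI.
by move=> x Dx; rewrite patchE; case: ifP => // _; exact: f0.
Qed.

Lemma ae_eq_Rintegral D f g : measurable D -> measurable_fun D f -> measurable_fun D g ->
  {ae mu, forall x, D x -> f x = g x} ->
  \int[mu]_(x in D) f x = \int[mu]_(x in D) g x.
Proof.
move=> mD mf mg fg; congr fine; apply: ae_eq_integral => //.
- exact/measurable_EFinP.
- exact/measurable_EFinP.
- by rewrite /ae_eq; apply: (filterS _ fg) => x h Dx /=; rewrite h.
Qed.

Lemma ae_rintegrable D f g : measurable D -> measurable_fun D f -> measurable_fun D g ->
  {ae mu, forall x, D x -> f x = g x} -> rintegrable D f -> rintegrable D g.
Proof.
move=> mD mf mg fg /integrableP[_ hf]; apply/integrableP; split.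
  exact/measurable_EFinP.
rewrite (@ge0_ae_eq_integral _ _ _ mu D _ (abse \o (EFin \o f)))//.
- by apply/measurableT_comp => //; exact/measurable_EFinP.
- by apply/measurableT_comp => //; exact/measurable_EFinP.
- by move=> x _; exact: abse_ge0.
- by apply: (filterS _ fg) => x h Dx /=; rewrite h.
Qed.

Lemma Rintegral_eq0_ae D f : measurable D -> rintegrable D f ->
  (forall x, D x -> 0 <= f x) -> \int[mu]_(x in D) f x = 0 ->
  {ae mu, forall x, D x -> f x = 0}.
Proof.
move=> mD hf f0 fi.
have : (\int[mu]_(x in D) `|(EFin \o f) x| = 0)%E.
  rewrite -[RHS]/(0%:E) -fi EFin_Rintegral//; apply: eq_integral => x /set_mem Dx /=.
  by rewrite ger0_norm// f0.
move/(ae_eq_integral_abs mu mD (proj2 (measurable_EFinP _ _) (rintegrable_measurable hf))).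
by apply: filterS => x h /h [].
Qed.

(** Dominated convergence for sets decreasing to the empty set. *)
Lemma Rintegral_decreasing_cvg0 (F : (set T)^nat) f :
  (forall n, measurable (F n)) -> (forall n, F n.+1 `<=` F n) ->
  \bigcap_n F n = set0 -> rintegrable (F 0%N) f ->
  (fun n => \int[mu]_(x in F n) f x) @ \oo --> (0 : R).
Proof.
move=> mF dF F0 hf.
have dF' n m : (n <= m)%N -> F m `<=` F n.
  elim: m => [|m ih]; first by rewrite leqn0 => /eqP->.
  by rewrite leq_eqVlt => /predU1P[->//|]; rewrite ltnS => /ih; exact: subset_trans (dF m).
have mf := rintegrable_measurable hf.
have h1 n : measurable_fun (F 0%N) (EFin \o (f \_ (F n))).
  apply/measurable_EFinP/measurable_restrict => //.
  by apply: measurable_funS mf => //; apply: subIsetl.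
have h2 : {ae mu, forall x, F 0%N x -> (EFin \o f \_ (F n)) x @[n --> \oo] --> 0%E}.
  apply: nearW => x Fx.
  have [n Fn] : exists n, ~ F n x.
    apply: contrapT => /forallNP h.
    have : (\bigcap_n F n) x by move=> n _; apply: contrapT; exact: h.
    by rewrite F0.
  apply: cvg_near_cst; exists n => // m /= nm.
  by rewrite patchE ifF//; apply/negbTE/negP; rewrite inE => /(dF' _ _ nm).
have h3 : {ae mu, forall x n, F 0%N x -> (`|(EFin \o f \_ (F n)) x| <= (`|f x|)%:E)%E}.
  apply: nearW => x n Fx /=; rewrite lee_fin patchE; case: ifP => //= _.
  by rewrite normr0.
have [_ _] := dominated_convergence (mF 0%N) h1 (measurable_cst _) h2
  (rintegrable_norm (mF 0%N) hf) h3.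
rewrite integral_cst// mul0e => /fine_cvg.
apply: cvg_trans; apply: near_eq_cvg; apply: nearW => n /=.
rewrite -[LHS]/(\int[mu]_(x in F 0%N) (f \_ (F n)) x)%R.
by rewrite -Rintegral_mkcondr setIidr//; exact: dF'.
Qed.

End RealIntegrals.
Arguments rintegrable {d T R} mu D f.

(** * Fredholm equations with bounded kernels *)

Section BoundedKernels.
Context d1 d2 (X : measurableType d1) (Y : measurableType d2) (R : realType).
Variable m1 : {sigma_finite_measure set X -> \bar R}.
Variables (k : X * Y -> R) (M : R).
Hypotheses (mk : measurable_fun setT k) (kM : forall p, `|k p| <= M).

Let mkx y : measurable_fun setT (fun x => k (x, y)).
Proof. exact: measurableT_comp. Qed.

Let mky x : measurable_fun setT (fun y => k (x, y)).
Proof. exact: measurableT_comp. Qed.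

Lemma kernel_rintegrable f y : rintegrable m1 setT f ->
  rintegrable m1 setT (fun x => k (x, y) * f x).
Proof. by move=> hf; apply: (rintegrable_bndl (M := M)). Qed.

Lemma kernel_integral_le f y : rintegrable m1 setT f ->
  `|\int[m1]_x (k (x, y) * f x)| <= M * \int[m1]_x `|f x|.
Proof.
move=> hf; rewrite -RintegralZl//; last exact: rintegrable_norm.
apply: le_norm_Rintegral => //.
- by apply: measurable_funM => //; exact: rintegrable_measurable hf.
- by move=> x _; rewrite normrM ler_wpM2r.
- exact/rintegrableZ/rintegrable_norm.
Qed.

(** The parameter integral is a partial integral over a product; the zero measure on the
parameter space makes the product function integrable whatever that space is. *)
Lemma kernel_integral_measurable f : rintegrable m1 setT f ->
  measurable_fun setT (fun y => \int[m1]_x (k (x, y) * f x)).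
Proof.
move=> hf; pose F : X * Y -> \bar R := fun p => (k p * f p.1)%:E.
have mF : measurable_fun setT F.
  apply/measurable_EFinP/measurable_funM => //.
  by apply: (measurableT_comp (rintegrable_measurable hf)).
have iF : (m1 \x (mzero : {sigma_finite_measure set Y -> \bar R}))%E.-integrable setT F.
  apply/integrable12ltyP => //.
  by under eq_integral do rewrite integral_measure_zero; rewrite integral0.
exact: (measurableT_comp (fine_measurable measurableT) (measurable_fubini_G iF)).
Qed.

(** Boundedness of the kernel gives integrability on the product. *)
Lemma kernel_Fubini (m2 : {sigma_finite_measure set Y -> \bar R}) f g :
  rintegrable m1 setT f -> rintegrable m2 setT g ->
  \int[m2]_y (g y * \int[m1]_x (k (x, y) * f x)) =
  \int[m1]_x (f x * \int[m2]_y (k (x, y) * g y)).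
Proof.
move=> hf hg; pose F : X * Y -> \bar R := fun p => (k p * f p.1 * g p.2)%:E.
have mf := rintegrable_measurable hf; have mg := rintegrable_measurable hg.
have mF : measurable_fun setT F.
  apply/measurable_EFinP/measurable_funM.
    by apply: measurable_funM => //; exact: (measurableT_comp mf).
  exact: (measurableT_comp mg).
have ig x : rintegrable m2 setT (fun y => k (x, y) * g y).
  by apply: (rintegrable_bndl (M := M)).
have hg' := rintegrable_norm measurableT hg.
have M0 (p : X * Y) : 0 <= M by exact: le_trans (kM p).
have iF : (m1 \x m2)%E.-integrable setT F.
  apply/integrable12ltyP => //.
  have iG : rintegrable m1 setT (fun x => (M * \int[m2]_y `|g y|) * `|f x|).
    exact/rintegrableZ/rintegrable_norm.
  apply: (@le_lt_trans _ _ (\int[m1]_x ((M * \int[m2]_y `|g y|) * `|f x|)%:E)%E);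
    last by rewrite -EFin_Rintegral// ltry.
  apply: ge0_le_integral => //.
  - by move=> x _; exact: integral_ge0.
  - have mF' : measurable_fun setT (abse \o F) by exact: measurableT_comp.
    have F0 p : (0 <= (abse \o F) p)%E by exact: abse_ge0.
    exact: (@measurable_fun_fubini_tonelli_F _ _ _ _ _ m2 _ mF' F0).
  - by apply/measurable_EFinP; exact: rintegrable_measurable iG.
  - move=> x _; have -> : M * \int[m2]_y `|g y| * `|f x| = \int[m2]_y (M * `|f x| * `|g y|).
      by rewrite RintegralZl//; ring.
    rewrite EFin_Rintegral//; last exact: rintegrableZ.
    apply: ge0_le_integral => //.
    + apply: measurableT_comp => //; apply/measurable_EFinP; rewrite /=.
      by apply: measurable_funM => //; apply: measurable_funM.
    + apply/measurable_EFinP/measurable_funM => //; exact: measurableT_comp.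
    + by move=> y _; rewrite /F /= lee_fin !normrM !ler_wpM2r.
transitivity (fine (\int[m2]_y \int[m1]_x F (x, y))%E).
  congr fine; apply: eq_integral => y _.
  rewrite -RintegralZl//; last exact: kernel_rintegrable.
  rewrite EFin_Rintegral//; last exact/rintegrableZ/kernel_rintegrable.
  by apply: eq_integral => x _; congr EFin; rewrite /=; ring.
rewrite -Fubini//; congr fine; apply: eq_integral => x _.
rewrite -RintegralZl//; last exact: ig.
rewrite EFin_Rintegral//; last exact/rintegrableZ.
by apply: eq_integral => y _; congr EFin; rewrite /=; ring.
Qed.
End BoundedKernels.

(** The explicit rate is needed to pass to the limit inside the fixed point equation, uniformly
in the space variable. *)
Lemma geometric_cauchy_limit (R : realType) (x : R^nat) (C : R) :
  (forall n, `|x n.+1 - x n| <= C / 2 ^+ n.+1) ->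
  exists l : R, forall n, `|l - x n| <= C / 2 ^+ n.
Proof.
move=> xC.
have half n : C / 2 ^+ n = C / 2 ^+ n.+1 *+ 2.
  by rewrite exprS invfM -mulr_natr; field; rewrite expf_neq0.
pose a n := x n + C / 2 ^+ n; pose b n := x n - C / 2 ^+ n.
have ha : {homo a : m n / (m <= n)%N >-> n <= m}.
  apply/nonincreasing_seqP => n; have /ler_normlP[_ h2] := xC n.
  by rewrite /a (half n) mulr2n; lra.
have hb : {homo b : m n / (m <= n)%N >-> m <= n}.
  apply/nondecreasing_seqP => n; have /ler_normlP[h1 _] := xC n.
  by rewrite /b (half n) mulr2n; lra.
have C0 n : 0 <= C / 2 ^+ n.
  have := xC 0%N; have := normr_ge0 (x 1%N - x 0%N) => h1 h2.
  have : 0 <= C / 2 ^+ 1 by exact: le_trans h2.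
  by rewrite expr1 => h; rewrite divr_ge0// ?exprn_ge0//; lra.
have ab m n : b m <= a n.
  have [mn|nm] := leqP m n.
    by apply: (le_trans (hb _ _ mn)); have := C0 n; rewrite /a /b; lra.
  by apply: (le_trans _ (ha _ _ (ltnW nm))); have := C0 m; rewrite /a /b; lra.
exists (sup (range b)) => n; rewrite ler_distl.
have hs : has_sup (range b).
  by split; [exists (b 0%N), 0%N|exists (a 0%N) => _ [m _ <-]; exact: ab].
apply/andP; split; first by apply: ub_le_sup; [exact: hs.2|exists n].
by apply: ge_sup; [exact: hs.1|move=> _ [m _ <-]; exact: ab].
Qed.

Section NeumannSeries.
Context d (X : measurableType d) (R : realType) (K : finType).
Variable mu : {sigma_finite_measure set X -> \bar R}.
Variables (k : X * X -> R) (B : K -> K -> X -> R).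
Hypotheses (mk : measurable_fun setT k) (k1 : forall p, `|k p| <= 1).
Hypothesis iB : forall i j, rintegrable mu setT (B i j).
Hypothesis small :
  forall y, \sum_i \sum_j \int[mu]_x `|k (x, y) * B i j x| <= 2^-1.

Let bounded_meas (C : R) (u : K -> X -> R) :=
  forall i, measurable_fun setT (u i) /\ forall x, `|u i x| <= C.

Let T (u : K -> X -> R) i y := \int[mu]_x (k (x, y) * \sum_j B i j x * u j x).

Let iBu C u i j : bounded_meas C u -> rintegrable mu setT (fun x => B i j x * u j x).
Proof.
move=> hu; have := rintegrable_bndl measurableT (hu j).1 (fun x _ => (hu j).2 x) (iB i j).
by apply: eq_rintegrable => // x _; rewrite mulrC.
Qed.

Let iBsum C u i : bounded_meas C u -> rintegrable mu setT (fun x => \sum_j B i j x * u j x).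
Proof. by move=> hu; apply: rintegrable_sum => // j; exact: iBu hu. Qed.

Let ikB i j y : rintegrable mu setT (fun x => k (x, y) * B i j x).
Proof. exact: kernel_rintegrable mk k1 _ _ (iB i j). Qed.

Let T_bounded C u : bounded_meas C u -> bounded_meas (C / 2) (T u).
Proof.
move=> hu i; split.
  exact: (kernel_integral_measurable mk (iBsum i hu)).
move=> y; have C0 : 0 <= C by apply: le_trans ((hu i).2 y).
have -> : T u i y = \sum_j \int[mu]_x (u j x * (k (x, y) * B i j x)).
  rewrite /T -Rintegral_sum//; last first.
    by move=> j; apply: (rintegrable_bndl _ (hu j).1 (fun x _ => (hu j).2 x)).
  by apply: eq_Rintegral => x _; rewrite mulr_sumr; apply: eq_bigr => j _; ring.
apply: (le_trans (ler_norm_sum _ _ _)).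
apply: (@le_trans _ _ (\sum_j C * \int[mu]_x `|k (x, y) * B i j x|)).
  apply: ler_sum => j _; rewrite -RintegralZl//; last first.
    by apply: rintegrable_norm.
  apply: le_norm_Rintegral => //.
  - apply: measurable_funM; first exact: (hu j).1.
    exact: rintegrable_measurable (ikB i j y).
  - by move=> x _; rewrite normrM ler_wpM2r// (hu j).2.
  - by apply: rintegrableZ => //; exact: rintegrable_norm.
rewrite -mulr_sumr ler_wpM2l//; apply: le_trans (small y).
rewrite [leRHS](bigD1 i)//= lerDl; apply: sumr_ge0 => i' _.
by apply: sumr_ge0 => j _; apply: Rintegral_ge0.
Qed.

Let T_sub C1 C2 u w i y : bounded_meas C1 u -> bounded_meas C2 w ->
  T u i y - T w i y = T (fun j x => u j x - w j x) i y.
Proof.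
move=> hu hw; rewrite /T -RintegralB//.
- by apply: eq_Rintegral => x _; rewrite -mulrBr -sumrB; congr (_ * _);
    apply: eq_bigr => j _; rewrite mulrBr.
- exact: kernel_rintegrable mk k1 _ _ (iBsum i hu).
- exact: kernel_rintegrable mk k1 _ _ (iBsum i hw).
Qed.

(** Banach fixed point argument for a Fredholm equation of the second kind whose operator has
norm at most 1/2 on bounded functions. *)
Lemma Neumann_series (F : K -> X -> R) (C : R) :
  (forall i, measurable_fun setT (F i)) -> (forall i x, `|F i x| <= C) ->
  exists u : K -> X -> R, [/\ forall i, measurable_fun setT (u i),
    exists C', forall i x, `|u i x| <= C' &
    forall i y, u i y = F i y + \int[mu]_x (k (x, y) * \sum_j B i j x * u j x)].
Proof.
move=> mF FC.
pose S u i y := F i y + T u i y.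
pose un n := iter n S (fun i y => F i y).
have bF : bounded_meas C F by move=> i; split.
have bS D u : bounded_meas D u -> bounded_meas (C + D / 2) (S u).
  move=> hu i; have [h1 h2] := T_bounded hu i.
  split; first exact: measurable_funD.
  by move=> x; apply: (le_trans (ler_normD _ _)); apply: lerD.
have bun n : exists D, bounded_meas D (un n).
  elim: n => [|n [D hD]]; first by exists C.
  by exists (C + D / 2); exact: bS hD.
have step n i y : `|un n.+1 i y - un n i y| <= C / 2 ^+ n.+1.
  have: bounded_meas (C / 2 ^+ n.+1) (fun i y => un n.+1 i y - un n i y); last by move/(_ i) => [].
  elim: n => [|n ih].
    have := T_bounded bF; rewrite expr1; congr bounded_meas.
    by apply/funext => j; apply/funext => x; rewrite /un/= /S; ring.
  have [D1 h1] := bun n.+1; have [D2 h2] := bun n.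
  have := T_bounded ih.
  have -> : C / 2 ^+ n.+1 / 2 = C / 2 ^+ n.+2 by rewrite -mulrA -invfM -exprSr.
  congr bounded_meas; apply/funext => j; apply/funext => x.
  by rewrite -(T_sub _ _ h1 h2) /= /S; ring.
have /choice[u0 hu0] : forall p : K * X, exists l, forall n, `|l - un n p.1 p.2| <= C / 2 ^+ n.
  by move=> p; apply: geometric_cauchy_limit => n; exact: step.
pose u i x := u0 (i, x).
have hu i x n : `|u i x - un n i x| <= C / 2 ^+ n := hu0 (i, x) n.
have cvg0 : (fun n => C / 2 ^+ n) @ \oo --> (0 : R).
  rewrite -(mulr0 C); apply: cvgMr; under eq_fun do rewrite -exprVn.
  by apply: cvg_expr; rewrite gtr0_norm; lra.
have mu_ i : measurable_fun setT (u i).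
  apply: (@measurable_fun_cvg _ _ _ setT (fun n => un n i)).
    by move=> n; have [D /(_ i)[]] := bun n.
  move=> x _; apply/cvgrPdist_le => e e0.
  have /cvgrPdist_le/(_ _ e0)[N _ hN] := cvg0; exists N => // n /= /hN.
  rewrite sub0r normrN => h; apply: le_trans h; apply: (le_trans (hu i x n)).
  exact: ler_norm.
have bu : bounded_meas (C + C) u.
  move=> i; split=> // x; have := hu i x 0%N; rewrite expr0 divr1 /un/= => h.
  by rewrite -(subrK (F i x) (u i x)); apply: (le_trans (ler_normD _ _)); apply: lerD.
exists u; split => //; first by exists (C + C) => i x; exact: (bu i).2.
move=> i y; apply/eqP; rewrite -subr_eq0 -normr_eq0 -[_ == 0]/(_ == _) eq_le normr_ge0 andbT.
rewrite -/(T u i y) -/(S u i y).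
have hn n : `|u i y - S u i y| <= C / 2 ^+ n.
  have [D hD] := bun n.
  have bd : bounded_meas (C / 2 ^+ n) (fun i y => u i y - un n i y).
    move=> j; split; last by move=> x; exact: hu.
    by apply: measurable_funB => //; exact: (hD j).1.
  have := (T_bounded bd i).2 y; rewrite -(T_sub _ _ bu hD) => h1.
  have h2 := hu i y n.+1.
  have -> : u i y - S u i y = (u i y - un n.+1 i y) - (T u i y - T (un n) i y).
    by rewrite /= /S; ring.
  apply: (le_trans (ler_normB _ _)); apply: (le_trans (lerD h2 h1)).
  have -> : C / 2 ^+ n.+1 = C / 2 ^+ n / 2 by rewrite exprSr invfM mulrA.
  by lra.
have /cvgrPdist_le h := cvg0.
apply/ler_addgt0Pr => e e0; have [N _ /(_ N (leqnn _))] := h _ e0.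
rewrite /= sub0r normrN add0r; apply: le_trans; apply: (le_trans (hn N)); exact: ler_norm.
Qed.

End NeumannSeries.

(** * Linear graphs and local properties of intervals *)

Section LinearExtension.
Context (F : fieldType) (V : lmodType F).

(** The graph of a linear form defined on a subspace, given as a relation: single-valuedness is
its triviality over 0. *)
Definition linear_graph (G : set (V * F)) :=
  [/\ G (0, 0),
      forall c p q, G p -> G q -> G (c *: p.1 + q.1, c * p.2 + q.2) &
      forall l, G (0, l) -> l = 0].

(** A maximal linear graph is total: over a vector u outside its domain the value 0 can be added
freely. The empty set is added to the family because Zorn is applied to all chains, the empty
one included. *)
Lemma linear_graph_extension (G : set (V * F)) : linear_graph G ->
  exists phi : V -> F, (forall c u v, phi (c *: u + v) = c * phi u + phi v) /\
    forall u l, G (u, l) -> phi u = l.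
Proof.
move=> hG.
have [A [[GA [A0 Alin Afun]] Amax]] : exists A, (G `<=` A /\ linear_graph A) /\
    forall B, A `<` B -> ~ (G `<=` B /\ linear_graph B).
  have [|A [PA maxA]] := @Zorn_bigcup (V * F)%type
      [set A | A = set0 \/ (G `<=` A /\ linear_graph A)].
    move=> C CP totC.
    have [hne|hno] := pselect (exists2 X, C X & X !=set0); last first.
      left; apply/seteqP; split=> // p [X CX Xp].
      by exfalso; apply: hno; exists X => //; exists p.
    have CP' X : C X -> X !=set0 -> G `<=` X /\ linear_graph X.
      by move=> CX X0; case: (CP _ CX) => // XE; move: X0; rewrite XE => -[].
    case: hne => X0 CX0 X0ne; have [GX0 [X00 _ _]] := CP' _ CX0 X0ne.
    right; split; first by move=> p Gp; exists X0 => //; exact: GX0.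
    split; first by exists X0.
    - move=> c p q [X CX Xp] [Y CY Yq].
      have [XY|YX] := totC _ _ CX CY.
      + have [_ [_ h _]] := CP' _ CY (ex_intro _ _ Yq).
        by exists Y => //; apply: h => //; exact: XY.
      + have [_ [_ h _]] := CP' _ CX (ex_intro _ _ Xp).
        by exists X => //; apply: h => //; exact: YX.
    - move=> l [X CX Xl]; have [_ [_ _ h]] := CP' _ CX (ex_intro _ _ Xl).
      exact: h.
  have A0 : A !=set0.
    apply: contrapT => /nonemptyPn AE; apply: (maxA G); last by right; split.
    rewrite properEneq AE; split; last exact: sub0set.
    by apply/eqP => E; have [h _ _] := hG; move: h; rewrite -E.
  exists A; split.
    by case: PA => // AE; move: A0; rewrite AE => -[].
  by move=> B /maxA hB hP; apply: hB; right.
have Auniq u l l' : A (u, l) -> A (u, l') -> l = l'.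
  move=> h h'; apply/eqP; rewrite -subr_eq0; apply/eqP/Afun.
  by have /= := Alin (-1) _ _ h' h; rewrite scaleN1r addNr mulN1r addrC.
have Atot u : exists l, A (u, l).
  apply: contrapT => hu.
  pose B := [set p : V * F | exists c q, A q /\ p = (c *: u + q.1, q.2)].
  apply: (Amax B).
    split.
      by move=> p Ap; exists 0, p; rewrite scale0r add0r; split => //; case: (p).
    move=> BA; apply: hu; exists 0; apply: BA; exists 1, (0, 0).
    by rewrite scale1r addr0.
  split.
    move=> p /GA Ap; exists 0, p; rewrite scale0r add0r; split => //; by case: (p).
  split.
  - by exists 0, (0, 0); rewrite scale0r addr0.
  - move=> c _ _ [c1 [q1 [Aq1 ->]]] [c2 [q2 [Aq2 ->]]] /=.
    exists (c * c1 + c2), (c *: q1.1 + q2.1, c * q1.2 + q2.2); split; first exact: Alin.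
    congr pair; rewrite scalerDr scalerA scalerDl /=.
    by rewrite addrACA.
  - move=> l [c [q [Aq []]]] /esym E ->.
    have [c0|c0] := eqVneq c 0.
      by apply: Afun; move: E Aq; rewrite c0 scale0r add0r => <-; case: (q).
    exfalso; apply: hu; exists (- c^-1 * q.2).
    have := Alin (- c^-1) _ _ Aq A0; rewrite /= !addr0.
    suff -> : - c^-1 *: q.1 = u by [].
    have -> : q.1 = - (c *: u) by apply/eqP; rewrite -addr_eq0 addrC E.
    by rewrite scalerN scaleNr opprK scalerA mulVf// scale1r.
have [phi hphi] := choice Atot.
exists phi; split; last by move=> u l /GA; exact: Auniq.
by move=> c u v; apply: Auniq (hphi _) _; exact: (Alin c (u, _) (v, _)).
Qed.

End LinearExtension.

(** A transitive property of pairs that holds near every point of an interval holds for all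
pairs: the supremum of the points that are reached cannot be smaller than t. *)
Lemma local_to_global (R : realType) (I : set R) (P : R -> R -> Prop) :
  (forall x y z, I x -> I z -> x <= y <= z -> I y) ->
  (forall s t u, s <= t -> t <= u -> P s t -> P t u -> P s u) ->
  (forall x, I x -> exists2 e, 0 < e &
    forall s t, I s -> I t -> x - e < s -> s <= x -> x <= t -> t < x + e -> P s t) ->
  forall s t, I s -> I t -> s <= t -> P s t.
Proof.
move=> conv trans loc s t Is It st.
pose S := [set y | s <= y <= t /\ P s y].
have Ss : S s.
  split; first by rewrite lexx.
  by have [e e0] := loc _ Is; apply => //; lra.
have hS : has_sup S by split; [exists s|exists t => y [/andP[]]].
set c := sup S.
have sc : s <= c by apply: ub_le_sup => //; exact: hS.2.
have ct : c <= t by apply: ge_sup; [exact: hS.1|move=> y [/andP[]]].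
have Ic : I c by apply: (conv s c t) => //; rewrite sc.
have [e e0 he] := loc _ Ic.
have [y [/andP[sy yt] Psy] cy] := sup_adherent e0 hS.
have yc : y <= c by apply: ub_le_sup; [exact: hS.2|split => //; rewrite sy].
pose c' := Num.min t (c + e / 2).
have cc' : c <= c' by rewrite le_min ct; lra.
have c't : c' <= t by rewrite ge_min lexx.
have Psc' : P s c'.
  apply: (trans s y c') => //; first exact: le_trans cc'.
  apply: he => //; last by rewrite gt_min; apply/orP; right; lra.
  - by apply: (conv s y t) => //; rewrite sy.
  - by apply: (conv s c' t) => //; rewrite c't andbT (le_trans sc).
have c'c : c' <= c.
  by apply: ub_le_sup; [exact: hS.2|split => //; rewrite (le_trans sc)].
suff <- : c' = t by [].
rewrite /c' min_l// leNgt; apply/negP => h.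
by move: c'c; rewrite /c' (min_r (ltW h)); lra.
Qed.

(** * Cuts of the line and the scalar Green formula *)

Section Cuts.
Context (R : realType).
Implicit Types (x y : R) (e c d : itv_bound R).

(** The indicator function of the points to the right of the cut e; the jump profile at e. *)
Definition cut_step e y : R := ((e <= BLeft y)%O)%:R.

(** Half of the sign of y - x, with value 0 for x = y. Integrating against this kernel produces
the balanced primitive of a measure with vanishing sum of end values. *)
Definition half_sign x y : R := (cut_step (BLeft x) y + cut_step (BRight x) y) / 2 - 2^-1.

Lemma half_signC x y : half_sign y x = - half_sign x y.
Proof.
rewrite /half_sign /cut_step !bnd_simp; case: (ltgtP x y) => _ /=; lra.
Qed.

Lemma half_signxx x : half_sign x x = 0.
Proof. by have := half_signC x x; lra. Qed.

Lemma cut_step_measurable e : measurable_fun setT (cut_step e).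
Proof.
have -> : cut_step e = \1_[set` Interval e +oo%O].
  apply/funext => y; rewrite indicE /cut_step; congr (_%:R); congr nat_of_bool.
  have -> : (y \in [set` Interval e +oo%O]) = (y \in Interval e +oo%O).
    by apply/idP/idP => [/set_mem//|h]; exact/mem_set.
  by rewrite itv_boundlr bnd_simp andbT.
exact: measurable_indic.
Qed.

Lemma cut_step_norm e y : `|cut_step e y| <= 1.
Proof. by rewrite /cut_step; case: (e <= _)%O; rewrite ger0_norm. Qed.

Lemma half_sign_norm x y : `|half_sign x y| <= 2^-1.
Proof.
by rewrite /half_sign /cut_step; case: (BLeft x <= _)%O; case: (BRight x <= _)%O => /=;
  rewrite ler_norml; lra.
Qed.

Lemma half_sign_measurable : measurable_fun setT (fun p : R * R => half_sign p.1 p.2).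
Proof.
have mb (f : R * R -> bool) : measurable_fun setT f ->
    measurable_fun setT (fun p => (f p)%:R : R).
  move=> mf; have -> : (fun p => (f p)%:R : R) = (fun p => if f p then 1 else 0).
    by apply/funext => p; case: (f p).
  exact: measurable_fun_ifT.
apply: measurable_funB => //; apply: measurable_funM => //.
rewrite /cut_step; apply: measurable_funD.
- by apply: (mb (fun p => (BLeft p.1 <= BLeft p.2)%O)); apply: measurable_fun_ler.
- by apply: (mb (fun p => (BRight p.1 <= BLeft p.2)%O)); apply: measurable_fun_ltr.
Qed.

Lemma half_sign_measurable_l y : measurable_fun setT (fun x => half_sign x y).
Proof.
have h (k : R * R -> R) : measurable_fun setT k -> measurable_fun setT (fun x => k (x, y)).
  by move=> mk; exact: measurableT_comp.
exact: (h _ half_sign_measurable).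
Qed.

(** Cuts are totally ordered, and no cut lies strictly between the two cuts at y. *)
Lemma cut_lr e y : (e <= BLeft y)%O = ~~ (BRight y <= e)%O.
Proof. by rewrite -ltBRight_leBLeft -ltNge. Qed.

Variable lam : {sigma_finite_measure set R -> \bar R}.

Lemma half_sign_rintegrable f y : rintegrable lam setT f ->
  rintegrable lam setT (fun x => half_sign x y * f x).
Proof.
by apply: (kernel_rintegrable half_sign_measurable (fun p => half_sign_norm p.1 p.2)).
Qed.

Lemma half_sign_integral_measurable f : rintegrable lam setT f ->
  measurable_fun setT (fun y => \int[lam]_x (half_sign x y * f x)).
Proof. exact: (kernel_integral_measurable half_sign_measurable). Qed.

Lemma cut_step_rintegrable f e : rintegrable lam setT f ->
  rintegrable lam setT (fun x => cut_step e x * f x).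
Proof.
exact: (rintegrable_bndl _ (cut_step_measurable e) (fun x _ => cut_step_norm e x)).
Qed.

Lemma half_sign_integral_rintegrable h k : rintegrable lam setT h ->
  rintegrable lam setT k ->
  rintegrable lam setT (fun x => k x * \int[lam]_z (half_sign z x * h z)).
Proof.
move=> hh hk.
have := rintegrable_bndl measurableT (half_sign_integral_measurable hh)
  (fun y _ => kernel_integral_le half_sign_measurable (fun p => half_sign_norm p.1 p.2) y hh) hk.
by apply: eq_rintegrable => // x _; rewrite mulrC.
Qed.

Lemma half_sign_Fubini f g : rintegrable lam setT f -> rintegrable lam setT g ->
  \int[lam]_y (g y * \int[lam]_x (half_sign x y * f x)) =
  - \int[lam]_x (f x * \int[lam]_y (half_sign y x * g y)).
Proof.
move=> hf hg.
rewrite (kernel_Fubini half_sign_measurable (fun p => half_sign_norm p.1 p.2) hf hg).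
rewrite -RintegralN//; last exact: half_sign_integral_rintegrable.
apply: eq_Rintegral => x _; rewrite -mulrN; congr (_ * _).
rewrite -RintegralN//; last exact: half_sign_rintegrable.
by apply: eq_Rintegral => y _; rewrite (half_signC y x) mulNr.
Qed.

(** Scalar Green formula. The double integrals cancel because the kernel is antisymmetric; this
is where the symmetric treatment of the atoms, that is balancedness, enters. The function u may
jump by r at the cut e. *)
Lemma scalar_Green (D : set R) (f g u v : R -> R) (m eta r : R) (e : itv_bound R) :
  measurable D ->
  rintegrable lam setT f -> rintegrable lam setT g ->
  (forall x, ~ D x -> f x = 0) -> (forall x, ~ D x -> g x = 0) ->
  (forall y, D y -> v y = m + \int[lam]_x (half_sign x y * f x)) ->
  (forall y, D y -> u y = eta + (cut_step e y - 2^-1) * r +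
     \int[lam]_x (half_sign x y * g x)) ->
  rintegrable lam setT (fun x => v x * g x + f x * u x) /\
  \int[lam]_x (v x * g x + f x * u x) =
  m * \int[lam]_x g x + eta * \int[lam]_x f x +
  r * \int[lam]_x ((cut_step e x - 2^-1) * f x).
Proof.
move=> mD hf hg f0 g0 hv hu.
pose Sf y := \int[lam]_x (half_sign x y * f x).
pose Sg y := \int[lam]_x (half_sign x y * g x).
have E x : v x * g x + f x * u x =
   (m * g x + g x * Sf x) + ((eta * f x + r * ((cut_step e x - 2^-1) * f x)) + f x * Sg x).
  have [Dx|Dx] := pselect (D x).
    by rewrite (hv x Dx) (hu x Dx) /Sf /Sg; ring.
  by rewrite (f0 x Dx) (g0 x Dx); ring.
under [X in rintegrable _ _ X]eq_fun do rewrite E.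
under eq_Rintegral do rewrite E.
have h1 := rintegrableZ m measurableT hg.
have h2 := half_sign_integral_rintegrable hf hg.
have h3 := rintegrableZ eta measurableT hf.
have h4 : rintegrable lam setT (fun x => (cut_step e x - 2^-1) * f x).
  have := rintegrableB measurableT (cut_step_rintegrable e hf) (rintegrableZ 2^-1 measurableT hf).
  by apply: eq_rintegrable => // x _; rewrite mulrBl.
have h5 := rintegrableZ r measurableT h4.
have h6 := half_sign_integral_rintegrable hg hf.
have h12 := rintegrableD measurableT h1 h2.
have h36 := rintegrableD measurableT (rintegrableD measurableT h3 h5) h6.
split; first exact: rintegrableD.
rewrite (RintegralD measurableT h12 h36) (RintegralD measurableT h1 h2).
rewrite (RintegralD measurableT (rintegrableD measurableT h3 h5) h6) (RintegralD measurableT h3 h5).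
rewrite !RintegralZl// /Sf /Sg (half_sign_Fubini hf hg).
ring.
Qed.

Definition cut_mean (z : itv_bound R -> R) y := (z (BLeft y) + z (BRight y)) / 2.

Lemma cut_step_shift_rintegrable f e : rintegrable lam setT f ->
  rintegrable lam setT (fun x => (cut_step e x - 2^-1) * f x).
Proof.
move=> hf; have := rintegrableB measurableT (cut_step_rintegrable e hf)
  (rintegrableZ 2^-1 measurableT hf).
by apply: eq_rintegrable => // x _; rewrite [RHS]mulrBl.
Qed.

(** A function whose one-sided values are given by integrals of the centred step is represented
by the half sign kernel. *)
Lemma cut_mean_half_sign (z : itv_bound R -> R) m f y : rintegrable lam setT f ->
  (forall b, z (BSide b y) = m - \int[lam]_x ((cut_step (BSide b y) x - 2^-1) * f x)) ->
  cut_mean z y = m + \int[lam]_x (half_sign x y * f x).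
Proof.
move=> hf hz; rewrite /cut_mean !hz.
have -> : \int[lam]_x (half_sign x y * f x) = - 2^-1 *
   (\int[lam]_x ((cut_step (BLeft y) x - 2^-1) * f x) +
    \int[lam]_x ((cut_step (BRight y) x - 2^-1) * f x)).
  rewrite -RintegralD//; [|exact: cut_step_shift_rintegrable..].
  rewrite -RintegralZl//; last by apply: rintegrableD => //; exact: cut_step_shift_rintegrable.
  by apply: eq_Rintegral => x _; rewrite half_signC /half_sign; field.
by field.
Qed.

Definition cut_in (I : set R) c := if c is BSide _ x then I x else False.

(** The cut function z is a primitive on I of the measure with density h; the cuts c and d decide
whether the atoms at the end points count. *)
Definition cut_primitive (I : set R) (h : R -> R) (z : itv_bound R -> R) :=
  forall c d, cut_in I c -> cut_in I d -> (c <= d)%O ->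
    z d - z c = \int[lam]_(x in [set` Interval c d]) h x.

Lemma natSinv_small (e0 r : R) : 0 < e0 -> 0 < r -> exists n, e0 * n.+1%:R^-1 < r.
Proof.
move=> e0_gt0 r0; have r1 : 0 < r / e0 by rewrite divr_gt0.
have [N _ /(_ N (leqnn _)) hN] := near_infty_natSinv_lt (PosNum r1).
by exists N; rewrite mulrC -ltr_pdivlMr.
Qed.

Lemma natSinv_itv n : 0 < (n.+1%:R^-1 : R) <= 1.
Proof. by rewrite invr_gt0 ltr0n /= invf_le1 ?ler1n ?ltr0n. Qed.

Lemma natSinv_le n : (n.+2%:R^-1 : R) <= n.+1%:R^-1.
Proof. by rewrite lef_pV2 ?posrE ?ltr0n// ler_nat. Qed.

(** The mass of ]x, x + r] tends to 0 with r, by continuity from above. *)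
Lemma small_right (h : R -> R) (x e0 eps : R) : 0 < e0 -> 0 < eps ->
  rintegrable lam `]x, x + e0] h ->
  exists r : R, [/\ 0 < r, r <= e0 & \int[lam]_(y in `]x, x + r]) `|h y| <= eps].
Proof.
move=> e0_gt0 eps0 hi; pose F n : set R := `]x, x + e0 * n.+1%:R^-1]%classic.
have mF n : measurable (F n) by exact: measurable_itv.
have dF n : F n.+1 `<=` F n.
  move=> y; rewrite /F /= !in_itv /= => /andP[-> /le_trans]; apply.
  by rewrite lerD2l ler_wpM2l ?natSinv_le// ltW.
have F0 : \bigcap_n F n = set0.
  apply/seteqP; split => // y hy.
  have xy : x < y by have := hy 0%N Logic.I; rewrite /F /= in_itv /= => /andP[].
  have yx : 0 < y - x by rewrite subr_gt0.
  have [n hn] := natSinv_small e0_gt0 yx.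
  have := hy n Logic.I; rewrite /F /= in_itv /= => /andP[_].
  by rewrite -lerBlDl => /(lt_le_trans hn); rewrite ltxx.
have iF : rintegrable lam (F 0%N) (fun y => `|h y|).
  by rewrite /F invr1 mulr1; exact: rintegrable_norm.
have /cvgrPdist_le/(_ _ eps0)[N _ /(_ N (leqnn _))] := Rintegral_decreasing_cvg0 mF dF F0 iF.
rewrite sub0r normrN => hN; exists (e0 * N.+1%:R^-1); have /andP[h1 h2] := natSinv_itv N.
split; [by rewrite mulr_gt0|by rewrite -[leRHS]mulr1 ler_wpM2l// ltW|].
exact: le_trans (ler_norm _) hN.
Qed.

Lemma small_left (h : R -> R) (x e0 eps : R) : 0 < e0 -> 0 < eps ->
  rintegrable lam `[x - e0, x[ h ->
  exists r : R, [/\ 0 < r, r <= e0 & \int[lam]_(y in `[x - r, x[) `|h y| <= eps].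
Proof.
move=> e0_gt0 eps0 hi; pose F n : set R := `[x - e0 * n.+1%:R^-1, x[%classic.
have mF n : measurable (F n) by exact: measurable_itv.
have dF n : F n.+1 `<=` F n.
  move=> y; rewrite /F /= !in_itv /= => /andP[h1 ->]; rewrite andbT; apply: le_trans h1.
  by rewrite lerD2l lerN2 ler_wpM2l ?natSinv_le// ltW.
have F0 : \bigcap_n F n = set0.
  apply/seteqP; split => // y hy.
  have xy : y < x by have := hy 0%N Logic.I; rewrite /F /= in_itv /= => /andP[].
  have yx : 0 < x - y by rewrite subr_gt0.
  have [n hn] := natSinv_small e0_gt0 yx.
  have := hy n Logic.I; rewrite /F /= in_itv /= => /andP[+ _].
  by rewrite lerBlDr -lerBlDl => /(lt_le_trans hn); rewrite ltxx.
have iF : rintegrable lam (F 0%N) (fun y => `|h y|).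
  by rewrite /F invr1 mulr1; exact: rintegrable_norm.
have /cvgrPdist_le/(_ _ eps0)[N _ /(_ N (leqnn _))] := Rintegral_decreasing_cvg0 mF dF F0 iF.
rewrite sub0r normrN => hN; exists (e0 * N.+1%:R^-1); have /andP[h1 h2] := natSinv_itv N.
split; [by rewrite mulr_gt0|by rewrite -[leRHS]mulr1 ler_wpM2l// ltW|].
exact: le_trans (ler_norm _) hN.
Qed.

End Cuts.

(** * Pointwise algebra of the system *)

Section FormalSystem.
Context (R : realType) (K : finType) (X : Type).
Variables (J Ji : K -> K -> R) (Q W : K -> K -> X -> R).
Implicit Types (u v f g : K -> X -> R).

Definition weighted f k x := \sum_l W k l x * f l x.

(** The real form of the inner product of f and g at the point x. *)
Definition wpair f g x := \sum_k f k x * weighted g k x.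

Definition potential u k x := \sum_l Q k l x * u l x.

(** The density of the derivative of a solution of J u' + Q u = W f. *)
Definition slope u f k x := \sum_l Ji k l * (weighted f l x - potential u l x).

Hypothesis Wsym : forall k l x, W k l x = W l k x.
Hypothesis Wpsd : forall x (a : K -> R), 0 <= \sum_k a k * \sum_l W k l x * a l.

Lemma weightedD c f g k x :
  weighted (fun l y => c * f l y + g l y) k x = c * weighted f k x + weighted g k x.
Proof.
rewrite /weighted mulr_sumr -big_split; apply: eq_bigr => l _ /=; ring.
Qed.

Lemma weightedB f g k x :
  weighted (fun l y => f l y - g l y) k x = weighted f k x - weighted g k x.
Proof. by rewrite /weighted -sumrB; apply: eq_bigr => l _ /=; ring. Qed.

Lemma wpairDr c f g h x :
  wpair h (fun l y => c * f l y + g l y) x = c * wpair h f x + wpair h g x.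
Proof.
rewrite /wpair mulr_sumr -big_split; apply: eq_bigr => l _ /=.
by rewrite weightedD; ring.
Qed.

Lemma wpairC f g x : wpair f g x = wpair g f x.
Proof.
rewrite /wpair /weighted.
under eq_bigr do rewrite mulr_sumr.
under [RHS]eq_bigr do rewrite mulr_sumr.
rewrite exchange_big /=; apply: eq_bigr => k _; apply: eq_bigr => l _.
by rewrite (Wsym l k); ring.
Qed.

Lemma wpairDl c f g h x :
  wpair (fun l y => c * f l y + g l y) h x = c * wpair f h x + wpair g h x.
Proof. by rewrite wpairC wpairDr !(wpairC h). Qed.

Lemma wpair_ge0 f x : 0 <= wpair f f x.
Proof. exact: Wpsd x (fun k => f k x). Qed.

Lemma wpair_quad c f g x :
  0 <= c ^+ 2 * wpair f f x + 2 * c * wpair f g x + wpair g g x.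
Proof.
have := wpair_ge0 (fun k y => c * f k y + g k y) x.
by rewrite wpairDl !wpairDr (wpairC g f); congr (_ <= _); ring.
Qed.

Lemma wpair_le f g x : `|wpair f g x| <= (wpair f f x + wpair g g x) / 2.
Proof.
have h1 := wpair_quad 1 f g x; have h2 := wpair_quad (-1) f g x.
by rewrite ler_norml; apply/andP; split; lra.
Qed.

Lemma wpair_delta l g x : wpair (fun k _ => (k == l)%:R) g x = weighted g l x.
Proof.
rewrite /wpair (bigD1 l)//= eqxx mul1r big1 ?addr0// => k /negbTE ->.
by rewrite mul0r.
Qed.

Lemma weighted_delta l x : weighted (fun k _ => (k == l)%:R) l x = W l l x.
Proof.
rewrite /weighted (bigD1 l)//= eqxx mulr1 big1 ?addr0// => k /negbTE ->.
by rewrite mulr0.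
Qed.

(** Cauchy-Schwarz in the form of the inequality of means. Unlike a component of g, a component of
W g is controlled by the form of g and the diagonal of W. *)
Lemma weighted_le g l x : `|weighted g l x| <= (W l l x + wpair g g x) / 2.
Proof.
rewrite -wpair_delta; apply: (le_trans (wpair_le _ _ _)).
by rewrite wpair_delta weighted_delta.
Qed.

(** A vector of vanishing length lies in the kernel of a positive semidefinite matrix. *)
Lemma weighted_eq0 g x : wpair g g x = 0 -> forall l, weighted g l x = 0.
Proof.
move=> g0 l; set c := weighted g l x.
have h t : 0 <= t ^+ 2 * W l l x + 2 * t * c.
  have := wpair_quad t (fun k _ => (k == l)%:R) g x.
  by rewrite !wpair_delta weighted_delta g0 addr0.
have W0 : 0 <= W l l x.
  by have := wpair_ge0 (fun k _ => (k == l)%:R) x; rewrite wpair_delta weighted_delta.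
pose s := (W l l x + 1)^-1.
have sW : s * (W l l x + 1) = 1 by rewrite mulVf//; apply: lt0r_neq0; lra.
have s0 : 0 < s by rewrite invr_gt0; lra.
have := h (- (c * s)).
have -> : (- (c * s)) ^+ 2 * W l l x + 2 * - (c * s) * c =
   - (c ^+ 2 * (s * (1 + s))).
  transitivity (c ^+ 2 * s * (s * (W l l x + 1) - s - 2)); first ring.
  by rewrite sW; ring.
rewrite oppr_ge0 => h1; apply/eqP; rewrite -sqrf_eq0 eq_le sqr_ge0 andbT.
by move: h1; rewrite pmulr_lle0// mulr_gt0//; lra.
Qed.

Hypothesis Qsym : forall k l x, Q k l x = Q l k x.
Hypothesis Jskew : forall k l, J k l = - J l k.
Hypothesis JJi : forall k m, \sum_l J k l * Ji l m = (k == m)%:R.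

Lemma J_slope u f k x : \sum_l J k l * slope u f l x = weighted f k x - potential u k x.
Proof.
rewrite /slope; under eq_bigr do rewrite mulr_sumr.
rewrite exchange_big /= (bigD1 k)//= [X in _ + X]big1 ?addr0.
  under eq_bigr do rewrite mulrA.
  by rewrite -mulr_suml JJi eqxx mul1r.
move=> m /negbTE mk; under eq_bigr do rewrite mulrA.
by rewrite -mulr_suml JJi eq_sym mk mul0r.
Qed.

Lemma potentialC u v x :
  \sum_k v k x * potential u k x = \sum_k u k x * potential v k x.
Proof.
rewrite /potential.
under eq_bigr do rewrite mulr_sumr.
under [RHS]eq_bigr do rewrite mulr_sumr.
rewrite exchange_big /=; apply: eq_bigr => k _; apply: eq_bigr => l _.
by rewrite (Qsym l k); ring.
Qed.

(** The potential terms cancel by symmetry of Q; only the W terms survive in the derivative of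
the product v^T J u. *)
Lemma slope_Green u v f g x :
  \sum_k \sum_l J k l * (v k x * slope u f l x + slope v g k x * u l x) =
  wpair v f x - wpair g u x.
Proof.
have -> : \sum_k \sum_l J k l * (v k x * slope u f l x + slope v g k x * u l x) =
    \sum_k v k x * (\sum_l J k l * slope u f l x) -
    \sum_k u k x * (\sum_l J k l * slope v g l x).
  transitivity (\sum_k v k x * (\sum_l J k l * slope u f l x) +
      \sum_k \sum_l J k l * (slope v g k x * u l x)).
    rewrite -big_split; apply: eq_bigr => k _ /=.
    by rewrite mulr_sumr -big_split; apply: eq_bigr => l _ /=; ring.
  congr (_ + _); rewrite exchange_big -sumrN; apply: eq_bigr => k _ /=.
  rewrite mulr_sumr -sumrN; apply: eq_bigr => l _ /=.
  by rewrite (Jskew l k); ring.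
under eq_bigr do rewrite J_slope mulrBr.
under [X in _ - X]eq_bigr do rewrite J_slope mulrBr.
by rewrite !sumrB (potentialC u v) -/(wpair v f x) -/(wpair u g x) (wpairC u g); ring.
Qed.

Lemma slopeD c u v f g k x :
  slope (fun l y => c * u l y + v l y) (fun l y => c * f l y + g l y) k x =
  c * slope u f k x + slope v g k x.
Proof.
rewrite /slope mulr_sumr -big_split; apply: eq_bigr => l _ /=.
rewrite weightedD; have -> : potential (fun l y => c * u l y + v l y) l x =
    c * potential u l x + potential v l x.
  by rewrite /potential mulr_sumr -big_split; apply: eq_bigr => m _ /=; ring.
ring.
Qed.

Lemma slope0 u f k x : (forall l, u l x = 0) -> (forall l, f l x = 0) -> slope u f k x = 0.
Proof.
move=> u0 f0; rewrite /slope big1// => l _.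
by rewrite /weighted /potential !big1 ?subr0 ?mulr0// => m _; rewrite ?u0 ?f0 mulr0.
Qed.

End FormalSystem.

(** * Orthogonal pairs come from solutions *)

Section RealSystem.
Context (R : realType) (lam : {sigma_finite_measure set R -> \bar R}) (K : finType).
Variables (I : set R) (J Ji : K -> K -> R) (Q W : K -> K -> R -> R).
Implicit Types (u v f g psi : K -> R -> R) (D : set R) (c d e : itv_bound R).

Local Notation Wf := (weighted W).
Local Notation sl := (slope Ji Q W).
Local Notation cut_in := (cut_in I).
Local Notation cut_primitive := (cut_primitive lam I).

Hypothesis Iconv : forall x y z, I x -> I z -> x <= y <= z -> I y.
Hypothesis Iopen : forall x, I x -> exists2 e, 0 < e & I (x - e) /\ I (x + e).
Hypothesis mQ : forall k l, measurable_fun setT (Q k l).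
Hypothesis mW : forall k l, measurable_fun setT (W k l).
Hypothesis iQ : forall k l s t, I s -> I t -> rintegrable lam `[s, t] (Q k l).
Hypothesis iW : forall k l s t, I s -> I t -> rintegrable lam `[s, t] (W k l).
Hypothesis Wsym : forall k l x, W k l x = W l k x.
Hypothesis Wpsd : forall x (a : K -> R), 0 <= \sum_k a k * \sum_l W k l x * a l.
Hypothesis Qsym : forall k l x, Q k l x = Q l k x.
Hypothesis Jskew : forall k l, J k l = - J l k.
Hypothesis JJi : forall k m, \sum_l J k l * Ji l m = (k == m)%:R.
Hypothesis JiJ : forall k m, \sum_l Ji k l * J l m = (k == m)%:R.

(** The equation J u' + Q u = W f on cuts: u is balanced, and its one-sided values are those of a
primitive of its own slope. *)
Definition cut_solution u f := exists z : K -> itv_bound R -> R,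
  (forall k y, I y -> u k y = cut_mean (z k) y) /\
  forall k, cut_primitive (sl u f k) (z k).

(** The part of the slope that depends on the solution: the matrix - J^-1 Q. *)
Definition feedback k m x := - \sum_l Ji k l * Q l m x.

Lemma slopeE u f k x :
  sl u f k x = \sum_l Ji k l * Wf f l x + \sum_m feedback k m x * u m x.
Proof.
rewrite /slope; under eq_bigr do rewrite mulrBr.
rewrite sumrB; congr (_ + _); rewrite -sumrN /feedback.
under [RHS]eq_bigr do rewrite mulNr mulr_suml.
under [LHS]eq_bigr do rewrite /potential mulr_sumr -sumrN.
rewrite exchange_big; apply: eq_bigr => l _ /=.
by rewrite -sumrN; apply: eq_bigr => m _; ring.
Qed.

Lemma weighted_measurable f l : (forall k, measurable_fun setT (f k)) ->
  measurable_fun setT (Wf f l).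
Proof. by move=> mf; apply: measurable_sum => m; exact: measurable_funM. Qed.

Lemma wpair_measurable f g : (forall k, measurable_fun setT (f k)) ->
  (forall k, measurable_fun setT (g k)) -> measurable_fun setT (wpair W f g).
Proof.
by move=> mf mg; apply: measurable_sum => m; apply: measurable_funM => //;
  exact: weighted_measurable.
Qed.

Lemma feedback_measurable k m : measurable_fun setT (feedback k m).
Proof.
have -> : feedback k m = (fun x => \sum_l (- Ji k l) * Q l m x).
  by apply/funext => x; rewrite /feedback -sumrN; apply: eq_bigr => l _; rewrite mulNr.
by apply: measurable_sum => l; exact: measurable_funM.
Qed.

Lemma feedback_rintegrable k m D : measurable D ->
  (forall l, rintegrable lam D (Q l m)) -> rintegrable lam D (feedback k m).
Proof.
move=> mD iQD; apply: rintegrableN => //; apply: rintegrable_sum => // l.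
exact: rintegrableZ.
Qed.

Lemma slope_rintegrable D u f C k : measurable D ->
  (forall k, measurable_fun setT (u k)) -> (forall k x, D x -> `|u k x| <= C) ->
  (forall k l, rintegrable lam D (Q k l)) -> (forall l, rintegrable lam D (Wf f l)) ->
  rintegrable lam D (sl u f k).
Proof.
move=> mD mu uC iQD iWf; apply: (eq_rintegrable mD (f := fun x => _)).
  by move=> x _; rewrite slopeE; reflexivity.
apply: rintegrableD => //.
  by apply: rintegrable_sum => // l; apply: rintegrableZ.
apply: rintegrable_sum => // m.
have mum : measurable_fun D (u m) by apply: measurable_funS (mu m).
have := rintegrable_bndl mD mum (uC m) (feedback_rintegrable k mD (fun l => iQD l m)).
by apply: eq_rintegrable => // x _; rewrite mulrC.
Qed.

(** On a short set the feedback operator with the half sign kernel has norm at most 1/2. *)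
Definition short D := [/\ measurable D, forall k l, rintegrable lam D (Q k l) &
  forall y, D y -> \sum_k \sum_m
    \int[lam]_x `|half_sign x y * (feedback k m \_ D) x| <= 2^-1].

(** Neumann series: on a short set the mean eta and one jump r at a cut e can be prescribed. *)
Lemma short_solution D psi (eta r : K -> R) e : short D ->
  (forall k, measurable_fun setT (psi k)) -> (forall k x, ~ D x -> psi k x = 0) ->
  (forall l, rintegrable lam setT (Wf psi l)) ->
  exists u, [/\ forall k, measurable_fun setT (u k),
    exists C, forall k x, `|u k x| <= C,
    forall k x, ~ D x -> u k x = 0,
    forall k, rintegrable lam setT (sl u psi k) &
    forall k y, D y -> u k y = eta k + (cut_step e y - 2^-1) * r k +
      \int[lam]_x (half_sign x y * sl u psi k x)].
Proof.
move=> [mD iQD sD] mpsi psi0 iWpsi.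
pose kern (p : R * R) := \1_D p.2 * half_sign p.1 p.2.
have mind : measurable_fun setT (\1_D : R -> R) by exact: measurable_indic.
have ind1 x : `|\1_D x : R| <= 1.
  by rewrite indicE; case: (x \in D); rewrite ger0_norm.
have mkern : measurable_fun setT kern.
  apply: measurable_funM; last exact: half_sign_measurable.
  exact: (measurableT_comp mind).
have kern1 p : `|kern p| <= 1.
  rewrite normrM -[leRHS]mulr1; apply: ler_pM => //.
  by apply: (le_trans (half_sign_norm _ _)); lra.
pose BD k m := feedback k m \_ D.
have iBD k m : rintegrable lam setT (BD k m).
  rewrite /BD -rintegrable_mkcond//; exact: feedback_rintegrable.
have small y : \sum_k \sum_m \int[lam]_x `|kern (x, y) * BD k m x| <= 2^-1.
  have [Dy|Dy] := pselect (D y); last first.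
    rewrite big1 ?invr_ge0// => k _; rewrite big1// => m _.
    under eq_Rintegral do rewrite /kern/= indicE memNset// !mul0r normr0.
    by rewrite Rintegral_cst// mul0r.
  apply: le_trans (sD y Dy); rewrite le_eqVlt; apply/orP; left; apply/eqP.
  apply: eq_bigr => k _; apply: eq_bigr => m _; apply: eq_Rintegral => x _.
  by rewrite /kern /= indicE mem_set// mul1r.
pose hpsi k x := \sum_l Ji k l * Wf psi l x.
have ihpsi k : rintegrable lam setT (hpsi k).
  by apply: rintegrable_sum => // l; apply: rintegrableZ.
pose F k y := \1_D y * (eta k + (cut_step e y - 2^-1) * r k +
  \int[lam]_x (half_sign x y * hpsi k x)).
have mF k : measurable_fun setT (F k).
  apply: measurable_funM => //; apply: measurable_funD; last exact: half_sign_integral_measurable.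
  apply: measurable_funD => //; apply: measurable_funM => //; apply: measurable_funB => //.
  exact: cut_step_measurable.
pose CF k := `|eta k| + 2 * `|r k| + 2^-1 * \int[lam]_x `|hpsi k x|.
have F0C k y : `|F k y| <= CF k.
  rewrite normrM -[leRHS]mul1r; apply: ler_pM => //.
  apply: (le_trans (ler_normD _ _)); apply: lerD; last first.
    exact: (kernel_integral_le (@half_sign_measurable R) (fun p => half_sign_norm p.1 p.2) y (ihpsi k)).
  apply: (le_trans (ler_normD _ _)); rewrite lerD2l normrM ler_wpM2r//.
  apply: (le_trans (ler_normB _ _)); have := cut_step_norm e y.
  by rewrite (ger0_norm (x := 2^-1))//; lra.
have FC k y : `|F k y| <= \sum_k CF k.
  apply: (le_trans (F0C k y)); rewrite (bigD1 k)//= lerDl; apply: sumr_ge0 => m _.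
  exact: le_trans (F0C m y).
have [u [mu_ [C uC] uE]] := Neumann_series mkern kern1 iBD small mF FC.
have u0 k y : ~ D y -> u k y = 0.
  move=> Dy; rewrite uE /F indicE memNset// mul0r add0r.
  under eq_Rintegral do rewrite /kern/= indicE memNset// !mul0r.
  by rewrite Rintegral_cst// mul0r.
have slE k x : sl u psi k x = hpsi k x + \sum_m BD k m x * u m x.
  rewrite slopeE; congr (_ + _); apply: eq_bigr => m _; rewrite /BD patchE.
  by case: ifPn => // /negP; rewrite inE => Dx; rewrite u0// !mulr0.
have iBu k : rintegrable lam setT (fun x => \sum_m BD k m x * u m x).
  apply: rintegrable_sum => // m.
  have := rintegrable_bndl measurableT (mu_ m) (fun x _ => uC m x) (iBD k m).
  by apply: eq_rintegrable => // x _; rewrite mulrC.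
exists u; split => //; first by exists C.
  move=> k; apply: (eq_rintegrable measurableT (f := fun x => hpsi k x + \sum_m BD k m x * u m x)).
    by move=> x _; rewrite slE.
  exact: rintegrableD.
move=> k y Dy; rewrite uE /F indicE mem_set// mul1r -addrA; congr (_ + _).
under [in RHS]eq_Rintegral do rewrite slE mulrDr.
rewrite RintegralD//; [|exact: half_sign_rintegrable..].
by congr (_ + _); apply: eq_Rintegral => x _; rewrite /kern/= indicE mem_set// mul1r.
Qed.

Definition supported s t f := forall k x, ~ (s <= x <= t) -> f k x = 0.

Lemma supported_rintegrable s t (h : R -> R) : (forall x, ~ (s <= x <= t) -> h x = 0) ->
  rintegrable lam `[s, t] h -> rintegrable lam setT h.
Proof.
move=> h0 /rintegrable_mkcond hi; apply: eq_rintegrable (hi _) => // x _.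
rewrite patchE; case: ifPn => // /negP xst; rewrite h0// => st; apply: xst.
by rewrite inE /= in_itv.
Qed.

Lemma weighted_rintegrable D f l : measurable D ->
  (forall k, measurable_fun setT (f k)) -> (forall k l, rintegrable lam D (W k l)) ->
  rintegrable lam D (wpair W f f) -> rintegrable lam D (Wf f l).
Proof.
move=> mD mf iWD iff.
apply: (@le_rintegrable _ _ _ _ _ _ (fun x => 2^-1 * (W l l x + wpair W f f x))) => //.
- by apply: measurable_funS (weighted_measurable l mf).
- by move=> x _; rewrite mulrC; exact: weighted_le.
- by apply: rintegrableZ => //; exact: rintegrableD.
Qed.

Lemma wpair_rintegrable D f g : measurable D ->
  (forall k, measurable_fun setT (f k)) -> (forall k, measurable_fun setT (g k)) ->
  rintegrable lam D (wpair W f f) -> rintegrable lam D (wpair W g g) ->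
  rintegrable lam D (wpair W f g).
Proof.
move=> mD mf mg iff igg.
apply: (@le_rintegrable _ _ _ _ _ _ (fun x => 2^-1 * (wpair W f f x + wpair W g g x))) => //.
- by apply: measurable_funS (wpair_measurable mf mg).
- by move=> x _; rewrite mulrC; exact: wpair_le.
- by apply: rintegrableZ => //; exact: rintegrableD.
Qed.

Lemma wpair_rintegrableD D a f g : measurable D ->
  (forall k, measurable_fun setT (f k)) -> (forall k, measurable_fun setT (g k)) ->
  rintegrable lam D (wpair W f f) -> rintegrable lam D (wpair W g g) ->
  rintegrable lam D (wpair W (fun k x => a * f k x + g k x) (fun k x => a * f k x + g k x)).
Proof.
move=> mD mf mg iff igg; have ifg := wpair_rintegrable mD mf mg iff igg.
apply: (eq_rintegrable mD (f := fun x => a * (a * wpair W f f x + wpair W f g x) +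
  (a * wpair W f g x + wpair W g g x))).
  by move=> x _; rewrite wpairDl// !wpairDr (wpairC Wsym g f).
by apply: rintegrableD => //; [apply: rintegrableZ => //|]; apply: rintegrableD => //;
  exact: rintegrableZ.
Qed.

Lemma wpair_bounded_rintegrable D f C : measurable D ->
  (forall k, measurable_fun setT (f k)) -> (forall k x, D x -> `|f k x| <= C) ->
  (forall k l, rintegrable lam D (W k l)) -> rintegrable lam D (wpair W f f).
Proof.
move=> mD mf fC iWD; apply: rintegrable_sum => // k.
have mfD j : measurable_fun D (f j) by apply: measurable_funS (mf j).
apply: (rintegrable_bndl mD (mfD k) (fC k)).
apply: rintegrable_sum => // l; have := rintegrable_bndl mD (mfD l) (fC l) (iWD k l).
by apply: eq_rintegrable => // x _; rewrite mulrC.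
Qed.

Section Duality.
Variables (v g : K -> R -> R).
Hypotheses (mv : forall k, measurable_fun setT (v k)) (mg : forall k, measurable_fun setT (g k)).
Hypothesis iv : forall s t, I s -> I t -> rintegrable lam `[s, t] (wpair W v v).
Hypothesis ig : forall s t, I s -> I t -> rintegrable lam `[s, t] (wpair W g g).

(** Boundedness of u makes it integrable against all entries of the coefficients; psi is controlled
only in the norm of W. *)
Definition test_pair s t u psi :=
  [/\ forall k, measurable_fun setT (u k), exists C, forall k x, `|u k x| <= C &
      supported s t u] /\
  [/\ forall k, measurable_fun setT (psi k), supported s t psi &
      rintegrable lam setT (wpair W psi psi)].

Hypothesis orthogonal : forall u psi s t, I s -> I t -> test_pair s t u psi ->
  cut_solution u psi -> (\int[lam]_x wpair W g u x) = (\int[lam]_x wpair W v psi x).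

(** The pairs (p, l) of a jump profile p and a value l such that some compactly supported u solves
the equation with psi up to the jumps p, and l = <g, u> - <v, psi>. The shifted kernel
half_sign x y + 1/2 makes u vanish to the left of its support. *)
Definition jump_graph : set ((K * R -> R^o) * R) := [set p | exists u psi s t,
  [/\ I s /\ I t, test_pair s t u psi, forall k, rintegrable lam setT (sl u psi k),
     forall k y, u k y = p.1 (k, y) + \int[lam]_x ((half_sign x y + 2^-1) * sl u psi k x) &
     p.2 = (\int[lam]_x wpair W g u x) - (\int[lam]_x wpair W v psi x)]].

Lemma wpair_supported s t f h : supported s t f -> supported s t h ->
  forall x, ~ (s <= x <= t) -> wpair W f h x = 0.
Proof.
by move=> f0 h0 x xst; rewrite /wpair big1// => k _; rewrite f0// mul0r.
Qed.

Lemma test_pair_rintegrable s t u psi : I s -> I t -> test_pair s t u psi ->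
  rintegrable lam setT (wpair W g u) /\ rintegrable lam setT (wpair W v psi).
Proof.
move=> Is It [[mu_ [C uC] u0] [mpsi psi0 ipsi]]; split.
  apply: (@supported_rintegrable s t) => [x xst|].
    by rewrite wpairC// /wpair big1// => k _; rewrite u0// mul0r.
  apply: wpair_rintegrable => //; first exact: ig.
  by apply: (wpair_bounded_rintegrable (C := C)) => // k l; exact: iW.
apply: (@supported_rintegrable s t) => [x xst|].
  by rewrite wpairC// /wpair big1// => k _; rewrite psi0// mul0r.
apply: wpair_rintegrable => //; first exact: iv.
exact: rintegrableS ipsi.
Qed.

Lemma test_pair_widen s t s' t' u psi : s' <= s -> t <= t' ->
  test_pair s t u psi -> test_pair s' t' u psi.
Proof.
move=> ss tt [[h1 h3 h4] [h2 h5 h6]]; split; split => // k x xst.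
  by apply: h4 => /andP[sx xt]; apply: xst; rewrite (le_trans ss sx) (le_trans xt tt).
by apply: h5 => /andP[sx xt]; apply: xst; rewrite (le_trans ss sx) (le_trans xt tt).
Qed.

Lemma test_pairD a s t u psi u' psi' : test_pair s t u psi -> test_pair s t u' psi' ->
  test_pair s t (fun k x => a * u k x + u' k x) (fun k x => a * psi k x + psi' k x).
Proof.
move=> [[h1 [C h3] h4] [h2 h5 h6]] [[k1 [C' k3] k4] [k2 k5 k6]]; split; split.
- by move=> k; apply: measurable_funD => //; exact: measurable_funM.
- exists (`|a| * C + C') => k x; apply: (le_trans (ler_normD _ _)); apply: lerD => //.
  by rewrite normrM ler_wpM2l.
- by move=> k x xst; rewrite h4// k4// mulr0 addr0.
- by move=> k; apply: measurable_funD => //; exact: measurable_funM.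
- by move=> k x xst; rewrite h5// k5// mulr0 addr0.
- exact: wpair_rintegrableD.
Qed.

Lemma half_sign_shift_rintegrable (h : R -> R) y : rintegrable lam setT h ->
  rintegrable lam setT (fun x => (half_sign x y + 2^-1) * h x).
Proof.
move=> hi; have := rintegrableD measurableT (half_sign_rintegrable y hi)
  (rintegrableZ 2^-1 measurableT hi).
by apply: eq_rintegrable => // x _; rewrite [RHS]mulrDl.
Qed.

Lemma half_sign_mean (h : R -> R) y : rintegrable lam setT h ->
  \int[lam]_x ((half_sign x y + 2^-1) * h x) =
  cut_mean (fun c => \int[lam]_(x in [set` Interval -oo%O c]) h x) y.
Proof.
move=> hi; rewrite /cut_mean !(Rintegral_mkcond lam [set` _]).
have hr c : rintegrable lam setT (h \_ [set` Interval -oo%O c]).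
  by rewrite -rintegrable_mkcond; [exact: rintegrableS hi|exact: measurable_itv].
rewrite mulrC -RintegralD//; [|exact: hr..].
rewrite -RintegralZl//; last by apply: rintegrableD; [|exact: hr..].
apply: eq_Rintegral => x _; rewrite !patchE /half_sign /cut_step.
have E c : (x \in [set` Interval -oo%O c]) = (BRight x <= c)%O.
  by apply/idP/idP; rewrite inE /= itv_boundlr /=.
have p0 : point = 0 :> R by [].
by rewrite !E !bnd_simp ?p0; case: (ltgtP x y) => _ /=; rewrite ?p0; lra.
Qed.

Lemma cut_primitive_integral (h : R -> R) : rintegrable lam setT h ->
  cut_primitive h (fun c => \int[lam]_(x in [set` Interval -oo%O c]) h x).
Proof.
move=> hi c d _ _ cd.
have -> : [set` Interval -oo%O d] = [set` Interval -oo%O c] `|` [set` Interval c d].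
  exact: itv_bndbnd_setU.
rewrite Rintegral_setU//; first by rewrite addrAC subrr add0r.
- by apply: rintegrableS hi => //; apply: measurableU; exact: measurable_itv.
- apply/disj_setPS => x [] /=; rewrite !itv_boundlr => /andP[_ h1] /andP[h2 _].
  by move: h2; rewrite cut_lr h1.
Qed.

Lemma rintegral_eq0 (h : R -> R) : (forall x, h x = 0) -> \int[lam]_x h x = 0.
Proof. by move=> h0; under eq_Rintegral do rewrite h0; rewrite Rintegral_cst// mul0r. Qed.

Lemma jump_graph0 : I !=set0 -> jump_graph (0, 0).
Proof.
move=> [x0 Ix0]; exists (fun _ _ => 0), (fun _ _ => 0), x0, x0.
have s0 k x : sl (fun _ _ => 0) (fun _ _ => 0) k x = 0 by exact: slope0.
have w0 f x : wpair W f (fun _ _ => 0) x = 0.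
  by rewrite /wpair big1// => k _; rewrite /weighted big1 ?mulr0// => l _; rewrite mulr0.
split => //=.
- split; split => //; first by exists 0 => k x; rewrite normr0.
  by apply: (eq_rintegrable measurableT (f := cst 0)) => [x _|]; [rewrite w0|exact: rintegrable0].
- move=> k; apply: (eq_rintegrable measurableT (f := cst 0)) => [x _|]; first by rewrite s0.
  exact: rintegrable0.
- by move=> k y; rewrite rintegral_eq0 ?addr0// => x; rewrite s0 mulr0.
- by rewrite !rintegral_eq0 ?subr0.
Qed.

(** Without jumps u is a genuine solution, and orthogonality forces l = 0. *)
Lemma jump_graph_linear : I !=set0 -> linear_graph jump_graph.
Proof.
move=> I0; split; first exact: jump_graph0.
- move=> a [r l] [r' l'] [u [psi [s [t [[Is It] h3 h4 /= h5 h6]]]]].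
  move=> [u' [psi' [s' [t' [[Is' It'] k3 k4 /= k5 k6]]]]].
  pose s1 := Num.min s s'; pose t1 := Num.max t t'.
  have Is1 : I s1 by rewrite /s1; case: leP.
  have It1 : I t1 by rewrite /t1; case: leP.
  have {}h3 : test_pair s1 t1 u psi.
    by apply: test_pair_widen h3; rewrite /s1 /t1 ?ge_min ?le_max lexx.
  have {}k3 : test_pair s1 t1 u' psi'.
    by apply: test_pair_widen k3; rewrite /s1 /t1 ?ge_min ?le_max lexx orbT.
  have [hi1 hi2] := test_pair_rintegrable Is1 It1 h3.
  have [ki1 ki2] := test_pair_rintegrable Is1 It1 k3.
  exists (fun k x => a * u k x + u' k x), (fun k x => a * psi k x + psi' k x), s1, t1.
  split => //=.
  + exact: test_pairD.
  + move=> k; apply: (eq_rintegrable measurableT (f := fun x => a * sl u psi k x + sl u' psi' k x)).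
      by move=> x _; rewrite slopeD.
    by apply: rintegrableD => //; exact: rintegrableZ.
  + move=> k y; rewrite h5 k5.
    have -> : \int[lam]_x ((half_sign x y + 2^-1) *
        sl (fun l x => a * u l x + u' l x) (fun l x => a * psi l x + psi' l x) k x) =
      a * \int[lam]_x ((half_sign x y + 2^-1) * sl u psi k x) +
      \int[lam]_x ((half_sign x y + 2^-1) * sl u' psi' k x).
      rewrite -RintegralZl//; last exact: half_sign_shift_rintegrable.
      rewrite -RintegralD//; last 2 first.
      - by apply: rintegrableZ => //; exact: half_sign_shift_rintegrable.
      - exact: half_sign_shift_rintegrable.
      by apply: eq_Rintegral => x _; rewrite slopeD; ring.
    by rewrite -[(a *: r + r') _]/(a * r _ + r' _); ring.
  + apply/esym; transitivity ((\int[lam]_x (a * wpair W g u x + wpair W g u' x)) -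
      (\int[lam]_x (a * wpair W v psi x + wpair W v psi' x))).
      by congr (_ - _); apply: eq_Rintegral => x _; rewrite wpairDr.
    rewrite !RintegralD//; [|exact: rintegrableZ..].
    by rewrite !RintegralZl// h6 k6; ring.
- move=> l [u [psi [s [t [[Is It] h3 h4 /= h5 ->]]]]].
  apply/eqP; rewrite subr_eq0; apply/eqP; apply: (orthogonal Is It h3).
  exists (fun k c => \int[lam]_(x in [set` Interval -oo%O c]) sl u psi k x); split.
    by move=> k y _; rewrite h5 add0r half_sign_mean.
  by move=> k; exact: cut_primitive_integral.
Qed.

(** Test functions on one piece have jumps only at its two ends and at one cut in it. *)
Definition three_jumps c e d (rc re rd : K -> R) : K * R -> R^o :=
  fun p => rc p.1 * cut_step c p.2 + re p.1 * cut_step e p.2 + rd p.1 * cut_step d p.2.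

(** The linear form on jumps that is induced by (v, g), written as the pairing z^T J r. *)
Definition cut_values (z : K -> itv_bound R -> R) := forall c e d rc re rd l,
  jump_graph (three_jumps c e d rc re rd, l) ->
  l = \sum_k \sum_m J k m * (z k c * rc m + z k e * re m + z k d * rd m).

(** The extension of the form is evaluated at single steps; J^-1 turns the result into the
pairing with J. *)
Lemma cut_values_exist : I !=set0 -> exists z, cut_values z.
Proof.
move=> /jump_graph_linear /linear_graph_extension[phi [philin phiG]].
pose st c m : K * R -> R^o := fun p => (p.1 == m)%:R * cut_step c p.2.
exists (fun k c => \sum_m phi (st c m) * Ji m k) => c e d rc re rd l /phiG <-.
have phi0 : phi 0 = 0.
  by have := philin (-1) 0 0; rewrite scaler0 addr0 mulN1r addNr.
have phiD x y : phi (x + y) = phi x + phi y by have := philin 1 x y; rewrite scale1r mul1r.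
have phiS (h : K -> K * R -> R^o) (r : K -> R) :
    phi (\sum_m r m *: h m) = \sum_m r m * phi (h m).
  rewrite (big_morph phi phiD phi0); apply: eq_bigr => m _.
  by have := philin (r m) (h m) 0; rewrite phi0 !addr0.
have -> : three_jumps c e d rc re rd =
    (\sum_m rc m *: st c m) + (\sum_m re m *: st e m) + (\sum_m rd m *: st d m).
  have E c' (r : K -> R) p : (\sum_m r m *: st c' m) p = r p.1 * cut_step c' p.2.
    rewrite fct_sumE (bigD1 p.1)//= big1 ?addr0.
      by rewrite -[LHS]/(r p.1 * (((p.1 == p.1)%:R * cut_step c' p.2))) eqxx mul1r.
    move=> m /negbTE mp; rewrite -[LHS]/(r m * (((p.1 == m)%:R * cut_step c' p.2))).
    by rewrite eq_sym mp mul0r mulr0.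
  by apply/funext => p; rewrite -[RHS]/((_ p + _ p) + _ p) !E.
rewrite !phiD !phiS.
have E c' (r : K -> R) : \sum_m r m * phi (st c' m) =
   \sum_k \sum_m J k m * ((\sum_l phi (st c' l) * Ji l k) * r m).
  rewrite exchange_big /=; apply: eq_bigr => m _.
  transitivity (r m * \sum_k J k m * \sum_l phi (st c' l) * Ji l k); last first.
    by rewrite mulr_sumr; apply: eq_bigr => k _; ring.
  congr (_ * _); under eq_bigr do rewrite mulr_sumr.
  rewrite exchange_big /=.
  have A l' : \sum_k J k m * (phi (st c' l') * Ji l' k) = phi (st c' l') * (l' == m)%:R.
    by rewrite -JiJ mulr_sumr; apply: eq_bigr => k _; ring.
  under eq_bigr do rewrite A.
  rewrite (bigD1 m)//= eqxx mulr1 big1 ?addr0// => l' /negbTE ->.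
  by rewrite mulr0.
rewrite !E -!big_split /=; apply: eq_bigr => k _.
by rewrite -!big_split /=; apply: eq_bigr => m _; ring.
Qed.

Definition cut_off D f k := f k \_ D.

Lemma cut_off_out D f k x : ~ D x -> cut_off D f k x = 0.
Proof. by move=> Dx; rewrite /cut_off patchE memNset. Qed.

Lemma cut_off_in D f k x : D x -> cut_off D f k x = f k x.
Proof. by move=> Dx; rewrite /cut_off patchE mem_set. Qed.

Lemma cut_off_measurable D f k : measurable D -> measurable_fun setT (f k) ->
  measurable_fun setT (cut_off D f k).
Proof.
move=> mD mf; apply/(measurable_restrictT _ mD); exact: measurable_funTS.
Qed.

Lemma cut_off_wpair D f h x : wpair W (cut_off D f) (cut_off D h) x = (wpair W f h \_ D) x.
Proof.
rewrite patchE; case: ifPn => [/set_mem|/negP]; rewrite ?inE => Dx; rewrite /wpair.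
  apply: eq_bigr => k _; rewrite cut_off_in//; congr (_ * _).
  by apply: eq_bigr => l _; rewrite cut_off_in.
by rewrite big1// => k _; rewrite cut_off_out// mul0r.
Qed.

Lemma wpair_cut_off D f h x : (forall k x, ~ D x -> f k x = 0) ->
  wpair W f (cut_off D h) x = wpair W f h x.
Proof.
move=> f0; apply: eq_bigr => k _; have [Dx|Dx] := pselect (D x); last by rewrite f0// !mul0r.
by congr (_ * _); apply: eq_bigr => l _; rewrite cut_off_in.
Qed.

Lemma cut_interval_sub c d : cut_in c -> cut_in d -> exists s t,
  [/\ I s, I t & [set` Interval c d] `<=` `[s, t]].
Proof.
case: c => [b s|//]; case: d => [b' t|//] /= Is It; exists s, t; split => // x /=.
rewrite itv_boundlr in_itv /=.
by case: b; case: b'; rewrite !bnd_simp => /andP[h1 h2]; rewrite ?h1 ?h2 ?(ltW h1) ?(ltW h2).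
Qed.

(** Only the mean of the end values is prescribed; an initial value problem on the piece may have no
solution. *)
Definition local_solution (z : K -> itv_bound R -> R) c d vD :=
  let D := [set` Interval c d] in let hv := sl vD (cut_off D g) in
  [/\ forall k, measurable_fun setT (vD k),
    exists C, forall k x, `|vD k x| <= C,
    forall k x, ~ D x -> vD k x = 0,
    forall k, rintegrable lam setT (hv k) &
    forall k y, D y -> vD k y = (z k c + z k d) / 2 +
      \int[lam]_x (half_sign x y * hv k x)].

(** The test function u with mean eta, jump r at e and source psi has jumps at c, e and d that are
known in terms of eta, r and its slope. Green's formula for u and the local solution vD then
expresses the defect of vD on psi by the defects of z as a primitive. Since eta, r and psi are
independent, all these defects vanish. *)
Lemma local_identity z c d e vD psi (eta r : K -> R) :
  let D := [set` Interval c d] in let hv := sl vD (cut_off D g) in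
  cut_values z -> cut_in c -> cut_in d -> (c <= e)%O -> (e <= d)%O -> short D ->
  local_solution z c d vD ->
  (forall k, measurable_fun setT (psi k)) -> (forall k x, ~ D x -> psi k x = 0) ->
  rintegrable lam setT (wpair W psi psi) ->
  (\int[lam]_x wpair W vD psi x) - (\int[lam]_x wpair W v psi x) =
  \sum_k \sum_m J k m * ((z k c - z k d + \int[lam]_x hv k x) * eta m +
    (z k e - (z k c + z k d) / 2 + \int[lam]_x ((cut_step e x - 2^-1) * hv k x)) * r m).
Proof.
move=> D hv hz Ic Id ce ed sD [mvD [Cv vDC] vD0 ihv vDE] mpsi psi0 ipsi.
have mD : measurable D by case: sD.
have [s [t [Is It Dst]]] := cut_interval_sub Ic Id.
have Dst' x : ~ (s <= x <= t) -> ~ D x by move=> xst /Dst /=; rewrite in_itv.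
have iWpsi l : rintegrable lam setT (Wf psi l).
  apply: (@supported_rintegrable s t) => [x xst|].
    by rewrite /weighted big1// => k _; rewrite psi0 ?mulr0//; exact: Dst'.
  apply: weighted_rintegrable => //; first by move=> k m; exact: iW.
  exact: rintegrableS ipsi.
have [u [mu_ [C uC] u0 ihu uE]] := short_solution eta r e sD mpsi psi0 iWpsi.
set hu := sl u psi in ihu uE.
have hu0 k x : ~ D x -> hu k x = 0.
  by move=> Dx; apply: slope0 => l; [exact: u0|exact: psi0].
have hv0 k x : ~ D x -> hv k x = 0.
  by move=> Dx; apply: slope0 => l; [exact: vD0|exact: cut_off_out].
pose iu k := \int[lam]_x hu k x.
(* The jumps of u at the ends of the piece, which bring it from 0 to its left end value and from
   its right end value back to 0. *)
pose rc k := eta k - 2^-1 * r k - 2^-1 * iu k.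
pose rd k := - eta k - 2^-1 * r k - 2^-1 * iu k.
have test : test_pair s t u psi.
  split; split => //; first by exists C.
  - by move=> k x /Dst'; exact: u0.
  - by move=> k x /Dst'; exact: psi0.
have jg : jump_graph (three_jumps c e d rc r rd,
    (\int[lam]_x wpair W g u x) - (\int[lam]_x wpair W v psi x)).
  exists u, psi, s, t; split => // k y; rewrite -/hu /three_jumps /=.
  have [Dy|Dy] := pselect (D y).
    have /andP[cy yd] : (c <= BLeft y)%O && (BRight y <= d)%O.
      by move: Dy; rewrite /D /= itv_boundlr.
    rewrite uE// /cut_step cy (cut_lr d) yd /= /rc /rd.
    have -> : \int[lam]_x ((half_sign x y + 2^-1) * hu k x) =
       \int[lam]_x (half_sign x y * hu k x) + 2^-1 * iu k.
      rewrite /iu -RintegralZl//; last exact: ihu.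
      rewrite -RintegralD//; last 2 first.
      - exact: half_sign_rintegrable.
      - by apply: rintegrableZ => //; exact: ihu.
      by apply: eq_Rintegral => x _; rewrite mulrDl.
    by ring.
  rewrite u0//.
  have : ~~ ((c <= BLeft y)%O && (BRight y <= d)%O).
    by apply/negP => h; apply: Dy; rewrite /D /= itv_boundlr.
  have [cy /=|cy _] := boolP (c <= BLeft y)%O; last first.
    have ey : (e <= BLeft y)%O = false by apply/negbTE; apply: contra cy; exact: le_trans.
    have dy : (d <= BLeft y)%O = false.
      by apply/negbTE; apply: contra cy; apply: le_trans; exact: le_trans ed.
    rewrite /cut_step ey dy (negbTE cy) rintegral_eq0 ?mulr0 ?addr0// => x.
    have [Dx|Dx] := pselect (D x); last by rewrite hu0// mulr0.
    have : (c <= BLeft x)%O by move: Dx; rewrite /D /= itv_boundlr => /andP[].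
    move=> cx; have xy : (BLeft x <= BLeft y)%O = false.
      by apply/negbTE; apply: contra cy; exact: le_trans.
    have xy' : (BRight x <= BLeft y)%O = false.
      apply/negbTE; apply: contra cy; apply: le_trans; apply: (le_trans cx).
      by rewrite bnd_simp.
    by rewrite /half_sign /cut_step xy xy' /= addr0 mul0r sub0r addNr mul0r.
  rewrite -cut_lr => dy.
  have ey : (e <= BLeft y)%O by exact: le_trans dy.
  rewrite /cut_step ey dy cy /=.
  have -> : \int[lam]_x ((half_sign x y + 2^-1) * hu k x) = iu k.
    apply: eq_Rintegral => x _; have [Dx|Dx] := pselect (D x); last by rewrite hu0// mulr0.
    have xd : (BRight x <= d)%O by move: Dx; rewrite /D /= itv_boundlr => /andP[].
    have xy : (BRight x <= BLeft y)%O by exact: le_trans dy.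
    have xy' : (BLeft x <= BLeft y)%O by apply: le_trans xy; rewrite bnd_simp.
    by rewrite /half_sign /cut_step xy xy' /=; field.
  by rewrite /rc /rd; field.
have hphi := hz _ _ _ _ _ _ _ jg.
(* Green's formula on the piece, entry by entry of J. *)
have Green : (\int[lam]_x wpair W vD psi x) - (\int[lam]_x wpair W g u x) =
    \sum_k \sum_m J k m * ((z k c + z k d) / 2 * iu m + eta m * (\int[lam]_x hv k x) +
      r m * \int[lam]_x ((cut_step e x - 2^-1) * hv k x)).
  have E x : wpair W vD psi x - wpair W g u x =
      \sum_k \sum_m J k m * (vD k x * hu m x + hv k x * u m x).
    rewrite slope_Green//; congr (_ - _).
    by rewrite wpairC// [RHS]wpairC// wpair_cut_off.
  have bi (h1 : R -> R) C1 (h2 : R -> R) : measurable_fun setT h1 -> (forall x, `|h1 x| <= C1) ->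
      rintegrable lam setT h2 -> rintegrable lam setT (fun x => h1 x * h2 x).
    by move=> mh1 f1C; apply: rintegrable_bndl => // x _; exact: f1C.
  have i1 k m : rintegrable lam setT (fun x => vD k x * hu m x) by exact: bi.
  have i2 k m : rintegrable lam setT (fun x => hv k x * u m x).
    have := bi _ _ _ (mu_ m) (uC m) (ihv k).
    by apply: eq_rintegrable => // x _; rewrite mulrC.
  have i3 k m : rintegrable lam setT (fun x => J k m * (vD k x * hu m x + hv k x * u m x)).
    by apply: rintegrableZ => //; apply: rintegrableD.
  have ivDpsi : rintegrable lam setT (wpair W vD psi).
    have := @rintegrable_sum _ _ _ lam setT _ (index_enum K) (fun k x => vD k x * Wf psi k x) measurableT.
    by apply => k; exact: bi.
  rewrite -RintegralB//; last by have [] := test_pair_rintegrable Is It test.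
  under eq_Rintegral do rewrite E.
  rewrite Rintegral_sum//; last by move=> k; exact: rintegrable_sum.
  apply: eq_bigr => k _; rewrite Rintegral_sum//; apply: eq_bigr => m _.
  rewrite RintegralZl//; last exact: rintegrableD.
  by congr (_ * _); exact: (scalar_Green mD (ihv k) (ihu m) (hv0 k) (hu0 m) (vDE k) (uE m)).2.
have -> : (\int[lam]_x wpair W vD psi x) - (\int[lam]_x wpair W v psi x) =
  ((\int[lam]_x wpair W vD psi x) - (\int[lam]_x wpair W g u x)) +
  ((\int[lam]_x wpair W g u x) - (\int[lam]_x wpair W v psi x)) by ring.
rewrite Green hphi -big_split; apply: eq_bigr => k _ /=.
by rewrite -big_split; apply: eq_bigr => m _ /=; rewrite /rc /rd; field.
Qed.

(** What is to be shown for the whole interval, on the part between the cuts c and d. *)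
Definition piece (z : K -> itv_bound R -> R) c d :=
  let D := [set` Interval c d] in let vt k := cut_mean (z k) in
  [/\ forall k, measurable_fun D (vt k), exists C, forall k x, D x -> `|vt k x| <= C,
    forall k, rintegrable lam D (sl vt g k),
    forall k, z k d - z k c = \int[lam]_(x in D) sl vt g k x &
    {ae lam, forall x, D x -> forall k, Wf (fun k x => vt k x - v k x) k x = 0}].

Lemma J_cancel (a : K -> R) :
  (forall eta : K -> R, \sum_k \sum_m J k m * (a k * eta m) = 0) -> forall k, a k = 0.
Proof.
move=> h k0; rewrite -[RHS](h (fun m => Ji m k0)).
rewrite (bigD1 k0)//= [X in _ + X]big1 ?addr0 => [|k /negbTE kk0].
  transitivity (a k0 * \sum_m J k0 m * Ji m k0); first by rewrite JJi eqxx mulr1.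
  by rewrite mulr_sumr; apply: eq_bigr => m _; ring.
transitivity (a k * \sum_m J k m * Ji m k0); last by rewrite JJi kk0 mulr0.
by rewrite mulr_sumr; apply: eq_bigr => m _; ring.
Qed.

(** The choice psi = 0 with eta or r alone identifies z with the primitive of the slope of the local
solution; then the choice psi = vD - v shows that vD and v agree almost everywhere for W. *)
Lemma short_piece z c d : cut_values z -> cut_in c -> cut_in d -> (c <= d)%O ->
  short [set` Interval c d] -> piece z c d.
Proof.
move=> hz Ic Id cd sD; set D := [set` Interval c d] in sD *.
have mD : measurable D by case: sD.
have [s [t [Is It Dst]]] := cut_interval_sub Ic Id.
have Dst' x : ~ (s <= x <= t) -> ~ D x by move=> xst /Dst /=; rewrite in_itv.
have mgD k : measurable_fun setT (cut_off D g k) by exact: cut_off_measurable.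
have iDD f : (forall k, measurable_fun setT (f k)) -> rintegrable lam `[s, t] (wpair W f f) ->
    rintegrable lam setT (wpair W (cut_off D f) (cut_off D f)).
  move=> mf ifW; apply: (@supported_rintegrable s t) => [x /Dst' Dx|].
    by rewrite cut_off_wpair patchE memNset.
  apply: (eq_rintegrable (f := wpair W f f \_ D)) => // [x _|]; first by rewrite cut_off_wpair.
  by apply/rintegrable_restrict => //; apply: rintegrableS ifW => //; exact: measurableI.
have iWgD l : rintegrable lam setT (Wf (cut_off D g) l).
  apply: (@supported_rintegrable s t) => [x xst|].
    by rewrite /weighted big1// => k _; rewrite cut_off_out ?mulr0//; exact: Dst'.
  apply: weighted_rintegrable => //; first by move=> k m; exact: iW.
  by apply: rintegrableS (iDD _ mg (ig Is It)).
have [vD [mvD [C vDC] vD0 ihv vDE]] := short_solution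
  (fun k => (z k c + z k d) / 2) (fun=> 0) c sD mgD (fun k x => @cut_off_out D g k x) iWgD.
set hv := sl vD (cut_off D g) in ihv vDE.
have loc : local_solution z c d vD.
  by split => //; [exists C|move=> k y Dy; rewrite vDE// mulr0 addr0].
have hv0 k x : ~ D x -> hv k x = 0.
  by move=> Dx; apply: slope0 => l; [exact: vD0|exact: cut_off_out].
have id0 e (eta r : K -> R) : (c <= e)%O -> (e <= d)%O ->
    \sum_k \sum_m J k m * ((z k c - z k d + \int[lam]_x hv k x) * eta m +
    (z k e - (z k c + z k d) / 2 + \int[lam]_x ((cut_step e x - 2^-1) * hv k x)) * r m) = 0.
  move=> ce ed; have w0 f x : wpair W f (fun _ _ => 0) x = 0.
    by rewrite /wpair big1// => k _; rewrite /weighted big1 ?mulr0// => l _; rewrite mulr0.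
  rewrite -(local_identity eta r hz Ic Id ce ed sD loc (psi := fun _ _ => 0))//.
    by rewrite !rintegral_eq0// subr0.
  apply: (eq_rintegrable measurableT (f := cst 0)) => [x _|]; last exact: rintegrable0.
  by rewrite w0.
have zcd k : z k d - z k c = \int[lam]_x hv k x.
  suff : z k c - z k d + \int[lam]_x hv k x = 0 by lra.
  apply: (@J_cancel (fun k => z k c - z k d + \int[lam]_x hv k x)) => eta.
  rewrite -[RHS](id0 c eta (fun=> 0) (lexx _) cd).
  by apply: eq_bigr => j _; apply: eq_bigr => m _; rewrite mulr0 addr0.
have ze e k : (c <= e)%O -> (e <= d)%O -> z k e = (z k c + z k d) / 2 -
    \int[lam]_x ((cut_step e x - 2^-1) * hv k x).
  move=> ce ed.
  suff : z k e - (z k c + z k d) / 2 + \int[lam]_x ((cut_step e x - 2^-1) * hv k x) = 0 by lra.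
  apply: (@J_cancel (fun k => z k e - (z k c + z k d) / 2 +
    \int[lam]_x ((cut_step e x - 2^-1) * hv k x))) => r.
  rewrite -[RHS](id0 e (fun=> 0) r ce ed).
  by apply: eq_bigr => j _; apply: eq_bigr => m _; rewrite mulr0 add0r.
pose vt k := cut_mean (z k).
have vtE k y : D y -> vt k y = vD k y.
  move=> Dy; rewrite vDE// mulr0 addr0; apply: cut_mean_half_sign => // b.
  have /andP[cy yd] : (c <= BLeft y)%O && (BRight y <= d)%O.
    by move: Dy; rewrite /D /= itv_boundlr.
  by apply: ze; [apply: (le_trans cy)|apply: le_trans yd]; case: b; rewrite bnd_simp.
have slE k x : D x -> sl vt g k x = hv k x.
  move=> Dx; rewrite /hv /slope; apply: eq_bigr => l _; congr (_ * (_ - _)).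
    by apply: eq_bigr => m _; rewrite cut_off_in.
  by apply: eq_bigr => m _; rewrite vtE.
split.
- move=> k; apply: (eq_measurable_fun (vD k)) => [x /set_mem Dx|]; first by rewrite -vtE.
  exact: (measurable_funTS (mvD k)).
- by exists C => k x Dx; rewrite -/(vt k x) vtE.
- move=> k; apply: (eq_rintegrable mD (f := hv k)) => [x /set_mem Dx|]; first by rewrite -slE.
  exact: rintegrableS (ihv k).
- move=> k; rewrite zcd [RHS]Rintegral_mkcond; apply: eq_Rintegral => x _.
  rewrite patchE; case: ifPn => [/set_mem Dx|/negP]; first by rewrite -slE.
  by rewrite inE => Dx; rewrite hv0.
(* The test source is vD - v itself, so that the identity yields its W-norm. *)
- pose f k x := -1 * v k x + vD k x.
  have mf k : measurable_fun setT (f k) by apply: measurable_funD => //; exact: measurable_funM.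
  have iff : rintegrable lam `[s, t] (wpair W f f).
    apply: wpair_rintegrableD => //; first exact: iv.
    by apply: (wpair_bounded_rintegrable (C := C)) => // k l; exact: iW.
  have mpsi k : measurable_fun setT (cut_off D f k) by exact: cut_off_measurable.
  have ipsi := iDD _ mf iff.
  have out k x : ~ D x -> cut_off D f k x = 0 by exact: cut_off_out.
  have := local_identity (fun=> 0) (fun=> 0) hz Ic Id (lexx _) cd sD loc mpsi out ipsi.
  rewrite [X in _ = X]big1 => [|k _]; last by rewrite big1// => m _; rewrite !mulr0 addr0 mulr0.
  have iofD f1 f2 : (forall k, measurable_fun setT (f1 k)) -> (forall k, measurable_fun setT (f2 k)) ->
     rintegrable lam `[s, t] (wpair W f1 f1) -> rintegrable lam `[s,t] (wpair W f2 f2) ->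
     rintegrable lam setT (wpair W f1 (cut_off D f2)).
    move=> mf1 mf2 if1 if2; apply: (@supported_rintegrable s t) => [x /Dst' Dx|].
      by rewrite wpairC// /wpair big1// => k _; rewrite cut_off_out ?mul0r.
    apply: wpair_rintegrable => // [k|]; first exact: cut_off_measurable.
    by apply: rintegrableS (iDD _ mf2 if2).
  have ivD : rintegrable lam `[s, t] (wpair W vD vD).
    by apply: (wpair_bounded_rintegrable (C := C)) => // k l; exact: iW.
  rewrite -RintegralB//; [|exact: iofD|by apply: iofD => //; exact: iv].
  have -> : \int[lam]_x (wpair W vD (cut_off D f) x - wpair W v (cut_off D f) x) =
      \int[lam]_x wpair W (cut_off D f) (cut_off D f) x.
    apply: eq_Rintegral => x _; rewrite [RHS]wpair_cut_off// [RHS]wpairC//.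
    have -> : wpair W f (cut_off D f) x =
        -1 * wpair W v (cut_off D f) x + wpair W vD (cut_off D f) x by exact: wpairDl.
    by ring.
  move/(Rintegral_eq0_ae measurableT ipsi (fun x _ => wpair_ge0 Wpsd _ x)).
  apply: filterS => x h Dx k; rewrite -[RHS](weighted_eq0 Wsym Wpsd (h Logic.I) k).
  by apply: eq_bigr => m _; rewrite cut_off_in// /f -/(vt m x) vtE//; ring.
Qed.

Lemma piece_trans z c x d : (c <= x)%O -> (x <= d)%O ->
  piece z c x -> piece z x d -> piece z c d.
Proof.
move=> cx xd [h1 [C h2] h3 h4 h5] [k1 [C' k2] k3 k4 k5].
have E : [set` Interval c d] = [set` Interval c x] `|` [set` Interval x d].
  exact: itv_bndbnd_setU.
have iU k : rintegrable lam ([set` Interval c x] `|` [set` Interval x d])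
    (sl (fun k => cut_mean (z k)) g k).
  have [i1 i2] := (h3 k, k3 k).
  apply/integrableP; split.
    apply/measurable_EFinP/measurable_funU; [exact: measurable_itv..|split].
      exact: rintegrable_measurable i1.
    exact: rintegrable_measurable i2.
  move: i1 i2 => /integrableP[m1 i1] /integrableP[m2 i2].
  have hd : [disjoint [set` Interval c x] & [set` Interval x d]].
    apply/disj_setPS => y [] /=; rewrite !itv_boundlr => /andP[_ p1] /andP[p2 _].
    by move: p2; rewrite cut_lr p1.
  rewrite ge0_integral_setU//; first exact: lte_add_pinfty.
  - apply: measurableT_comp => //; apply/measurable_funU; [exact: measurable_itv..|].
    by split.
split; rewrite E.
- move=> k; apply/measurable_funU; [exact: measurable_itv..|split; [exact: h1|exact: k1]].
- exists (Num.max C C') => k y [/h2|/k2] => /(_ k) h; rewrite le_max h ?orbT//.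
- exact: iU.
- move=> k; rewrite Rintegral_setU//.
  + by rewrite -h4 -k4; ring.
  + exact: iU.
  + apply/disj_setPS => y [] /=; rewrite !itv_boundlr => /andP[_ p1] /andP[p2 _].
    by move: p2; rewrite cut_lr p1.
- by apply: (filterS2 _ _ h5 k5) => y p1 p2 [/p1|/p2].
Qed.

(** The half sign kernel vanishes on the diagonal, so a single point is short whatever its mass.
This is why no smallness of the atoms of the coefficients is needed. *)
Lemma short_point D p : I p -> measurable D -> D `<=` [set p] -> short D.
Proof.
move=> Ip mD Dp; split => //.
  move=> k l; apply: rintegrableS (iQ k l Ip Ip) => // x /Dp -> /=.
  by rewrite in_itv /= lexx.
move=> y Dy; rewrite big1 ?invr_ge0// => k _; rewrite big1// => m _.
apply: rintegral_eq0 => x; rewrite patchE; case: ifPn => [/set_mem Dx|_].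
  by rewrite (Dp x Dx) (Dp y Dy) half_signxx mul0r normr0.
by rewrite -[point]/(0 : R) mulr0 normr0.
Qed.

Lemma short_small D : measurable D -> (forall k l, rintegrable lam D (Q k l)) ->
  \int[lam]_(x in D) (\sum_k \sum_m `|feedback k m x|) <= 1 -> short D.
Proof.
move=> mD iQD small; split => // y Dy.
have ifb k m : rintegrable lam D (fun x => `|feedback k m x|).
  by apply: rintegrable_norm => //; exact: feedback_rintegrable.
apply: (@le_trans _ _ (2^-1 * \int[lam]_(x in D) (\sum_k \sum_m `|feedback k m x|))); last first.
  by rewrite -[leRHS]mulr1 ler_wpM2l.
rewrite Rintegral_sum//; last by move=> k; exact: rintegrable_sum.
rewrite mulr_sumr; apply: ler_sum => k _; rewrite Rintegral_sum// mulr_sumr.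
apply: ler_sum => m _; rewrite (Rintegral_mkcond lam D).
have ip : rintegrable lam setT ((fun x => `|feedback k m x|) \_ D).
  by rewrite -rintegrable_mkcond.
have ipp : rintegrable lam setT (fun x => 2^-1 * ((fun x => `|feedback k m x|) \_ D) x).
  exact: rintegrableZ.
have le x : `|half_sign x y * (feedback k m \_ D) x| <=
    2^-1 * ((fun x => `|feedback k m x|) \_ D) x.
  rewrite normrM !patchE; case: ifP => _; first by rewrite ler_wpM2r// half_sign_norm.
  by rewrite -[point]/(0 : R) normr0 !mulr0.
rewrite -RintegralZl//; apply: le_Rintegral => //.
apply: (@le_rintegrable _ _ _ _ _ _ (fun x => 2^-1 * ((fun x => `|feedback k m x|) \_ D) x)) => //.
- apply/measurableT_comp => //; apply: measurable_funM; first exact: half_sign_measurable_l.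
  by apply/(measurable_restrictT _ mD); apply: measurable_funTS; exact: feedback_measurable.
- by move=> x _; rewrite normr_id.
Qed.

(** Punctured neighbourhoods lose all mass as they shrink, although x itself may carry some. *)
Lemma short_near x : I x -> exists2 e, 0 < e & [/\ I (x - e), I (x + e),
  forall y, x < y -> y <= x + e -> short `]x, y[ & forall y, y < x -> x - e <= y -> short `]y, x[].
Proof.
move=> Ix; have [e0 e00 [Im Ip]] := Iopen Ix.
pose h y := \sum_k \sum_m `|feedback k m y|.
have h0 y : 0 <= h y by apply: sumr_ge0 => k _; apply: sumr_ge0.
have ih s t : I s -> I t -> rintegrable lam `[s, t] h.
  move=> Is It; apply: rintegrable_sum => // k; apply: rintegrable_sum => // m.
  apply: rintegrable_norm => //; apply: feedback_rintegrable => // l; exact: iQ.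
have [e1 [e1_gt0 e1e small1]] : exists r : R, [/\ 0 < r, r <= e0 & \int[lam]_(y in `]x, x + r]) `|h y| <= 1].
  apply: small_right => //; apply: rintegrableS (ih _ _ Ix Ip) => // y; rewrite /= !in_itv /=.
  by move=> /andP[/ltW -> ->].
have [e2 [e2_gt0 e2e small2]] : exists r : R, [/\ 0 < r, r <= e0 & \int[lam]_(y in `[x - r, x[) `|h y| <= 1].
  apply: small_left => //; apply: rintegrableS (ih _ _ Im Ix) => // y; rewrite /= !in_itv /=.
  by move=> /andP[-> /ltW ->].
have le_min1 : Num.min e1 e2 <= e1 by rewrite ge_min lexx.
have le_min2 : Num.min e1 e2 <= e2 by rewrite ge_min lexx orbT.
have min_gt0 : 0 < Num.min e1 e2 by rewrite lt_min e1_gt0.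
set e := Num.min e1 e2 in le_min1 le_min2 min_gt0.
have II y : x - e0 <= y <= x + e0 -> I y by exact: Iconv.
have sub s t (D : set R) : I s -> I t -> measurable D -> D `<=` `[s, t] ->
    \int[lam]_(y in D) `|h y| <= 1 -> short D.
  move=> Is It mD Dst hD; apply: short_small => //.
    by move=> k l; apply: rintegrableS (iQ k l Is It).
  by apply: le_trans hD; rewrite le_eqVlt; apply/orP; left; apply/eqP;
    apply: eq_Rintegral => y _; rewrite ger0_norm.
exists e => //; split=> [||y xy ye|y yx ye]; [by apply: II; lra..|apply: (sub x (x + e1))|apply: (sub (x - e2) x)] => //.
- by apply: II; lra.
- by move=> r; rewrite /= !in_itv /= => /andP[h1 h2]; lra.
- apply: le_trans small1; apply: Rintegral_restrict_ge0 => //.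
  + by move=> r; rewrite /= !in_itv /= => /andP[h1 h2]; lra.
  + apply: rintegrable_norm => //; apply: rintegrableS (ih _ _ Ix Ip) => // r.
    by rewrite /= !in_itv /= => /andP[h1 h2]; lra.
- by apply: II; lra.
- by move=> r; rewrite /= !in_itv /= => /andP[h1 h2]; lra.
- apply: le_trans small2; apply: Rintegral_restrict_ge0 => //.
  + by move=> r; rewrite /= !in_itv /= => /andP[h1 h2]; lra.
  + apply: rintegrable_norm => //; apply: rintegrableS (ih _ _ Im Ix) => // r.
    by rewrite /= !in_itv /= => /andP[h1 h2]; lra.
Qed.

(** An interval around a point x consists of x, of two punctured one-sided neighbourhoods of x,
and of the end points. *)
Lemma all_pieces z : cut_values z ->
  forall c d, cut_in c -> cut_in d -> (c <= d)%O -> piece z c d.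
Proof.
move=> hz.
have pt c d p : I p -> cut_in c -> cut_in d -> (c <= d)%O -> (BLeft p <= c)%O -> (d <= BRight p)%O ->
    piece z c d.
  move=> Ip Ic Id cd pc dp; apply: short_piece => //; apply: (short_point Ip).
    exact: measurable_itv.
  move=> y /=; rewrite itv_boundlr => /andP[cy yd].
  have : (BLeft p <= BLeft y)%O by exact: le_trans cy.
  have : (BRight y <= BRight p)%O by exact: le_trans dp.
  by rewrite !bnd_simp => yp py; apply/eqP; rewrite eq_le yp.
(* All four pairs of sides are carried along, since pieces may end on either side of a point. *)
pose P s t := forall b b', (BSide b s <= BSide b' t)%O -> piece z (BSide b s) (BSide b' t).
suff hP s t : I s -> I t -> s <= t -> P s t.
  move=> [b s|//] [b' t|//] /= Is It st; apply: hP => //.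
  by move: st; case: b; case: b'; rewrite !bnd_simp// => /ltW.
apply: local_to_global => //.
  move=> x y w; rewrite le_eqVlt => /predU1P[<-//|xy].
  rewrite le_eqVlt => /predU1P[<-//|yw] Pxy Pyw b b' _.
  apply: (@piece_trans _ _ (BLeft y)).
  - by case: b; rewrite bnd_simp// ltW.
  - by case: b'; rewrite bnd_simp// ltW.
  - by apply: Pxy; case: b; rewrite bnd_simp// ltW.
  - by apply: Pyw; case: b'; rewrite bnd_simp// ltW.
move=> x Ix; have [e e0 [Ime Ipe sp sm]] := short_near Ix; exists e => //.
move=> s' t' Is It es; rewrite le_eqVlt => /predU1P[sx|sx];
  rewrite le_eqVlt => /predU1P[xt|xt] te b b' bb.
- move: bb; rewrite sx -xt => bb; apply: (pt _ _ x) => //.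
    by case: (b); rewrite bnd_simp.
  by case: (b'); rewrite bnd_simp.
- rewrite sx; apply: (@piece_trans _ _ (BRight x)).
  + by case: (b); rewrite bnd_simp.
  + by case: (b'); rewrite bnd_simp// ltW.
  + by apply: (pt _ _ x) => //; case: (b); rewrite bnd_simp.
  apply: (@piece_trans _ _ (BLeft t')).
  + by rewrite bnd_simp.
  + by case: (b'); rewrite bnd_simp.
  + by apply: short_piece => //; apply: sp => //; exact: ltW.
  + by apply: (pt _ _ t') => //; case: (b'); rewrite bnd_simp.
- rewrite -xt; apply: (@piece_trans _ _ (BRight s')).
  + by case: (b); rewrite bnd_simp.
  + by case: (b'); rewrite bnd_simp// ltW.
  + by apply: (pt _ _ s') => //; case: (b); rewrite bnd_simp.
  apply: (@piece_trans _ _ (BLeft x)).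
  + by rewrite bnd_simp.
  + by case: (b'); rewrite bnd_simp.
  + by apply: short_piece => //; apply: sm => //; exact: ltW.
  + by apply: (pt _ _ x) => //; case: (b'); rewrite bnd_simp.
- apply: (@piece_trans _ _ (BRight s')).
  + by case: (b); rewrite bnd_simp.
  + by have st' := lt_trans sx xt; case: (b'); rewrite bnd_simp// ltW.
  + by apply: (pt _ _ s') => //; case: (b); rewrite bnd_simp.
  apply: (@piece_trans _ _ (BLeft x)).
  + by rewrite bnd_simp.
  + by case: (b'); rewrite bnd_simp// ltW.
  + by apply: short_piece => //; apply: sm => //; exact: ltW.
  apply: (@piece_trans _ _ (BRight x)).
  + by rewrite bnd_simp.
  + by case: (b'); rewrite bnd_simp// ltW.
  + by apply: (pt _ _ x) => //; rewrite bnd_simp.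
  apply: (@piece_trans _ _ (BLeft t')).
  + by rewrite bnd_simp.
  + by case: (b'); rewrite bnd_simp.
  + by apply: short_piece => //; apply: sp => //; exact: ltW.
  + by apply: (pt _ _ t') => //; case: (b'); rewrite bnd_simp.
Qed.

(** The values z that come from the linear form on jumps solve the equation on every piece. *)
Theorem solution_of_orthogonal : I !=set0 -> exists vt : K -> R -> R,
  [/\ cut_solution vt g,
    forall s t, I s -> I t -> forall k, measurable_fun `[s, t] (vt k),
    forall s t, I s -> I t -> forall k, rintegrable lam `[s, t] (sl vt g k) &
    forall s t, I s -> I t -> {ae lam, forall x, `[s, t]%classic x ->
      forall k, Wf (fun k x => vt k x - v k x) k x = 0}].
Proof.
move=> /cut_values_exist[z hz]; have hp := all_pieces hz.
exists (fun k => cut_mean (z k)); split.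
- exists z; split => // k c d Ic Id cd; have [_ _ _ h _] := hp _ _ Ic Id cd.
  exact: h.
- move=> s t Is It k; have [st|ts] := leP s t.
    by have [h _ _ _ _] := hp (BLeft s) (BRight t) Is It ltac:(by rewrite bnd_simp); exact: h.
  rewrite set_itv_ge ?bnd_simp -?ltNge//; exact: measurable_fun_set0.
- move=> s t Is It k; have [st|ts] := leP s t.
    by have [_ _ h _ _] := hp (BLeft s) (BRight t) Is It ltac:(by rewrite bnd_simp); exact: h.
  by rewrite set_itv_ge ?bnd_simp -?ltNge//; exact: integrable_set0.
- move=> s t Is It; have [st|ts] := leP s t.
    by have [_ _ _ _ h] := hp (BLeft s) (BRight t) Is It ltac:(by rewrite bnd_simp).
  by apply: nearW => x; rewrite set_itv_ge ?bnd_simp -?ltNge.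
Qed.

End Duality.
End RealSystem.

(** * Green's formula for compactly supported solutions *)

Section Primitives.
Context (R : realType) (lam : {sigma_finite_measure set R -> \bar R}) (I : set R).
Implicit Types (h : R -> R) (z : itv_bound R -> R) (c d e : itv_bound R).
Hypothesis Iconv : forall x y w : R, I x -> I w -> x <= y <= w -> I y.
Hypothesis Iopen : forall x, I x -> exists2 r : R, 0 < r & I (x - r) /\ I (x + r).

Definition loc_rintegrable h := forall s t, I s -> I t -> rintegrable lam `[s, t] h.

Lemma loc_rintegrable_cuts h c d : loc_rintegrable h -> cut_in I c -> cut_in I d ->
  rintegrable lam [set` Interval c d] h.
Proof.
move=> ih Ic Id; have [s [t [Is It Dst]]] := cut_interval_sub Ic Id.
by apply: rintegrableS (ih s t Is It).
Qed.

Lemma cut_primitive_le h z c d (D : set R) : loc_rintegrable h -> cut_primitive lam I h z ->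
  cut_in I c -> cut_in I d -> (c <= d)%O -> measurable D -> [set` Interval c d] `<=` D ->
  rintegrable lam D h -> `|z d - z c| <= \int[lam]_(x in D) `|h x|.
Proof.
move=> ih hz Ic Id cd mD sD iD; rewrite (hz c d)//.
have iI := loc_rintegrable_cuts ih Ic Id.
apply: (@le_trans _ _ (\int[lam]_(x in [set` Interval c d]) `|h x|)).
  by apply: le_normr_Rintegral => //; exact: measurable_itv.
apply: Rintegral_restrict_ge0 => //; first exact: rintegrable_norm.
Qed.

(** The value of a primitive at the cut BRight x is its right limit at x. *)
Lemma cut_limit_right h z x (eps : R) : loc_rintegrable h -> cut_primitive lam I h z ->
  I x -> 0 < eps -> exists2 r : R, 0 < r & forall y, x < y -> y < x + r ->
    I y /\ forall b, `|z (BSide b y) - z (BRight x)| <= eps.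
Proof.
move=> ih hz Ix eps0; have [r0 r00 [Im Ip]] := Iopen Ix.
have [r [r_gt0 rr0 small]] : exists r : R, [/\ 0 < r, r <= r0 &
    \int[lam]_(y in `]x, x + r]) `|h y| <= eps].
  apply: small_right => //; apply: rintegrableS (ih _ _ Ix Ip) => // y.
  by rewrite /= !in_itv /= => /andP[/ltW -> ->].
exists r => // y xy yr; have Iy : I y by apply: (Iconv Ix Ip); lra.
split => // b; apply: le_trans small; apply: cut_primitive_le => //.
- by case: b; rewrite bnd_simp// ltW.
- by move=> w /=; rewrite itv_boundlr in_itv /=; case: b; rewrite !bnd_simp => /andP[h1 h2]; lra.
- apply: rintegrableS (ih _ _ Ix Ip) => // w; rewrite /= !in_itv /= => /andP[h1 h2]; lra.
Qed.

Lemma cut_limit_left h z x (eps : R) : loc_rintegrable h -> cut_primitive lam I h z ->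
  I x -> 0 < eps -> exists2 r : R, 0 < r & forall y, y < x -> x - r < y ->
    I y /\ forall b, `|z (BSide b y) - z (BLeft x)| <= eps.
Proof.
move=> ih hz Ix eps0; have [r0 r00 [Im Ip]] := Iopen Ix.
have [r [r_gt0 rr0 small]] : exists r : R, [/\ 0 < r, r <= r0 &
    \int[lam]_(y in `[x - r, x[) `|h y| <= eps].
  apply: small_left => //; apply: rintegrableS (ih _ _ Im Ix) => // y.
  by rewrite /= !in_itv /= => /andP[-> /ltW ->].
exists r => // y xy yr; have Iy : I y by apply: (Iconv Im Ix); lra.
split => // b; rewrite distrC; apply: le_trans small; apply: cut_primitive_le => //.
- by case: b; rewrite bnd_simp// ltW.
- by move=> w /=; rewrite itv_boundlr in_itv /=; case: b; rewrite !bnd_simp => /andP[h1 h2]; lra.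
- apply: rintegrableS (ih _ _ Im Ix) => // w; rewrite /= !in_itv /= => /andP[h1 h2]; lra.
Qed.

Lemma cut_mean_limit_right h z x (eps : R) : loc_rintegrable h -> cut_primitive lam I h z ->
  I x -> 0 < eps -> exists2 r : R, 0 < r & forall y, x < y -> y < x + r ->
    I y /\ `|cut_mean z y - z (BRight x)| <= eps.
Proof.
move=> ih hz Ix eps0; have [r r0 hr] := cut_limit_right ih hz Ix eps0.
exists r => // y xy yr; have [Iy h1] := hr y xy yr; split => //.
have := h1 true; have := h1 false; rewrite !ler_norml /cut_mean => /andP[p1 p2] /andP[q1 q2].
by apply/andP; split; lra.
Qed.

Lemma cut_mean_limit_left h z x (eps : R) : loc_rintegrable h -> cut_primitive lam I h z ->
  I x -> 0 < eps -> exists2 r : R, 0 < r & forall y, y < x -> x - r < y ->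
    I y /\ `|cut_mean z y - z (BLeft x)| <= eps.
Proof.
move=> ih hz Ix eps0; have [r r0 hr] := cut_limit_left ih hz Ix eps0.
exists r => // y xy yr; have [Iy h1] := hr y xy yr; split => //.
have := h1 true; have := h1 false; rewrite !ler_norml /cut_mean => /andP[p1 p2] /andP[q1 q2].
by apply/andP; split; lra.
Qed.

(** The mean value of a primitive at an inner point, in terms of its end values; this form can be
inserted into Fubini's theorem. *)
Lemma cut_primitive_mean h z c d y : loc_rintegrable h -> cut_primitive lam I h z ->
  cut_in I c -> cut_in I d -> [set` Interval c d] y ->
  cut_mean z y = (z c + z d) / 2 +
    \int[lam]_x (half_sign x y * (h \_ [set` Interval c d]) x).
Proof.
move=> ih hz Ic Id; set D := [set` Interval c d] => Dy.
have mD : measurable D by exact: measurable_itv.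
have iD : rintegrable lam setT (h \_ D).
  by rewrite -rintegrable_mkcond//; exact: loc_rintegrable_cuts.
have /andP[cy yd] : (c <= BLeft y)%O && (BRight y <= d)%O.
  by move: Dy; rewrite /D /= itv_boundlr.
have Iy : I y.
  have [s [t [Is It Dst]]] := cut_interval_sub Ic Id.
  by have := Dst _ Dy; rewrite /= in_itv /=; exact: Iconv.
apply: cut_mean_half_sign => // b; set e := BSide b y.
have ce : (c <= e)%O by apply: (le_trans cy); rewrite /e; case: b {e}; rewrite bnd_simp.
have ed : (e <= d)%O by apply: le_trans yd; rewrite /e; case: b {e ce}; rewrite bnd_simp.
have h1 := hz c e Ic Iy ce; have h2 := hz e d Iy Id ed.
have i1 := loc_rintegrable_cuts ih Ic (Iy : cut_in I e).
have i2 := loc_rintegrable_cuts ih (Iy : cut_in I e) Id.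
have -> : \int[lam]_x ((cut_step e x - 2^-1) * (h \_ D) x) =
    2^-1 * \int[lam]_(x in [set` Interval e d]) h x - 2^-1 * \int[lam]_(x in [set` Interval c e]) h x.
  rewrite !(Rintegral_mkcond lam [set` _]).
  have j1 : rintegrable lam setT (h \_ [set` Interval c e]).
    by rewrite -rintegrable_mkcond//; exact: measurable_itv.
  have j2 : rintegrable lam setT (h \_ [set` Interval e d]).
    by rewrite -rintegrable_mkcond//; exact: measurable_itv.
  rewrite -!RintegralZl// -RintegralB//; [|exact: rintegrableZ..].
  apply: eq_Rintegral => x _; rewrite !patchE.
  have E c' d' : (x \in [set` Interval c' d']) = (c' <= BLeft x)%O && (BRight x <= d')%O.
    by apply/idP/idP; rewrite inE /= itv_boundlr.
  have p0 : point = 0 :> R by [].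
  rewrite /D !E /cut_step (cut_lr e).
  have [xe|xe] /= := boolP (BRight x <= e)%O.
    rewrite (le_trans xe ed) !andbT; case: ifP => _; rewrite ?p0; lra.
  have -> : (c <= BLeft x)%O by apply: (le_trans ce); rewrite cut_lr.
  by case: ifP => /= _; rewrite ?p0; lra.
by lra.
Qed.

End Primitives.

Section Green.
Context (R : realType) (lam : {sigma_finite_measure set R -> \bar R}) (K : finType).
Variables (I : set R) (J Ji : K -> K -> R) (Q W : K -> K -> R -> R).
Implicit Types (u v f g psi : K -> R -> R).
Local Notation sl := (slope Ji Q W).
Hypothesis Iconv : forall x y z, I x -> I z -> x <= y <= z -> I y.
Hypothesis Iopen : forall x, I x -> exists2 e, 0 < e & I (x - e) /\ I (x + e).
Hypothesis Wsym : forall k l x, W k l x = W l k x.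
Hypothesis Qsym : forall k l x, Q k l x = Q l k x.
Hypothesis Jskew : forall k l, J k l = - J l k.
Hypothesis JJi : forall k m, \sum_l J k l * Ji l m = (k == m)%:R.

(** On an interval that contains the support of u in its interior the boundary terms vanish. *)
Lemma Green_identity u v f g s t s' t' : I s' -> I t' -> s' < s -> s <= t -> t < t' ->
  cut_solution lam I Ji Q W u f -> cut_solution lam I Ji Q W v g ->
  (forall k, loc_rintegrable lam I (sl u f k)) -> (forall k, loc_rintegrable lam I (sl v g k)) ->
  (forall k x, I x -> ~ (s <= x <= t) -> u k x = 0) ->
  \int[lam]_(x in `]s', t'[) (wpair W v f x - wpair W g u x) = 0.
Proof.
move=> Is' It' ss st tt [zu [uE hzu]] [zv [vE hzv]] iu iv u0.
set D := [set` Interval (BRight s') (BLeft t')]; rewrite -/D.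
have mD : measurable D by exact: measurable_itv.
have Ic : cut_in I (BRight s') by []. have Id : cut_in I (BLeft t') by [].
have zu1 k : zu k (BRight s') = 0.
  apply/eqP; rewrite -normr_le0; apply/ler_addgt0Pr => eps eps0; rewrite add0r.
  have [r r0 hr] := cut_mean_limit_right Iconv Iopen (iu k) (hzu k) Is' eps0.
  pose y := Num.min (s' + r / 2) ((s' + s) / 2).
  have y1 : y <= s' + r / 2 by rewrite ge_min lexx.
  have y2 : y <= (s' + s) / 2 by rewrite ge_min lexx orbT.
  have y3 : s' < y by rewrite lt_min; apply/andP; split; lra.
  have [Iy] := hr y y3 ltac:(lra).
  rewrite -uE// u0//; first by rewrite sub0r normrN.
  by move=> /andP[]; lra.
have zu2 k : zu k (BLeft t') = 0.
  apply/eqP; rewrite -normr_le0; apply/ler_addgt0Pr => eps eps0; rewrite add0r.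
  have [r r0 hr] := cut_mean_limit_left Iconv Iopen (iu k) (hzu k) It' eps0.
  pose y := Num.max (t' - r / 2) ((t' + t) / 2).
  have y1 : t' - r / 2 <= y by rewrite le_max lexx.
  have y2 : (t' + t) / 2 <= y by rewrite le_max lexx orbT.
  have y3 : y < t' by rewrite gt_max; apply/andP; split; lra.
  have [Iy] := hr y y3 ltac:(lra).
  rewrite -uE// u0//; first by rewrite sub0r normrN.
  by move=> /andP[]; lra.
have Iin y : D y -> I y.
  by rewrite /D /= in_itv /= => /andP[h1 h2]; apply: (Iconv Is' It'); rewrite (ltW h1) (ltW h2).
pose hu k := sl u f k \_ D; pose hv k := sl v g k \_ D.
have ihu k : rintegrable lam setT (hu k).
  by rewrite -rintegrable_mkcond//; exact: loc_rintegrable_cuts.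
have ihv k : rintegrable lam setT (hv k).
  by rewrite -rintegrable_mkcond//; exact: loc_rintegrable_cuts.
have p0 : point = 0 :> R by [].
have hu0 k x : ~ D x -> hu k x = 0 by move=> Dx; rewrite /hu patchE memNset.
have hv0 k x : ~ D x -> hv k x = 0 by move=> Dx; rewrite /hv patchE memNset.
have cd : (BRight s' <= BLeft t')%O by rewrite bnd_simp; lra.
have vDE k y : D y -> v k y = (zv k (BRight s') + zv k (BLeft t')) / 2 +
    \int[lam]_x (half_sign x y * hv k x).
  by move=> Dy; rewrite vE; [exact: (cut_primitive_mean Iconv (iv k) (hzv k) Ic Id Dy)|exact: Iin].
have uDE k y : D y -> u k y = 0 + (cut_step (BLeft s') y - 2^-1) * 0 +
    \int[lam]_x (half_sign x y * hu k x).
  move=> Dy; rewrite uE; last exact: Iin.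
  rewrite (cut_primitive_mean Iconv (iu k) (hzu k) Ic Id Dy) zu1 zu2.
  by rewrite addr0 mul0r mulr0 addr0.
have int0 k : \int[lam]_x hu k x = 0.
  by rewrite -Rintegral_mkcond -(hzu k _ _ Ic Id cd) zu1 zu2 subr0.
have G k m := scalar_Green mD (ihv k) (ihu m) (hv0 k) (hu0 m) (vDE k) (uDE m).
rewrite Rintegral_mkcond.
transitivity (\int[lam]_x (\sum_k \sum_m J k m * (v k x * hu m x + hv k x * u m x))).
  apply: eq_Rintegral => x _; rewrite patchE; case: ifPn => [/set_mem Dx|].
    rewrite -(slope_Green Wsym Qsym Jskew JJi); apply: eq_bigr => k _; apply: eq_bigr => m _.
    by rewrite /hu /hv !patchE mem_set.
  move/negP; rewrite inE => Dx; rewrite p0 big1// => k _; rewrite big1// => m _.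
  by rewrite hu0// hv0// mulr0 mul0r addr0 mulr0.
have i3 k m : rintegrable lam setT (fun x => J k m * (v k x * hu m x + hv k x * u m x)).
  by apply: rintegrableZ => //; exact: (G k m).1.
rewrite Rintegral_sum//; last by move=> k; exact: rintegrable_sum.
rewrite big1// => k _; rewrite Rintegral_sum// big1// => m _.
rewrite RintegralZl//; last exact: (G k m).1.
by rewrite (G k m).2 int0 !(mulr0, mul0r, addr0).
Qed.

(** The products of square integrable functions are integrable on I, so the bounded intervals
can exhaust I. *)
Lemma Green_symmetric u v f g s t (p q : nat -> R) : I s -> I t -> s <= t ->
  (forall n, I (p n) /\ I (q n)) -> (forall n, p n.+1 <= p n /\ q n <= q n.+1) ->
  (forall x, I x -> exists n, p n < x < q n) -> measurable I ->
  cut_solution lam I Ji Q W u f -> cut_solution lam I Ji Q W v g ->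
  (forall k, loc_rintegrable lam I (sl u f k)) -> (forall k, loc_rintegrable lam I (sl v g k)) ->
  (forall k x, I x -> ~ (s <= x <= t) -> u k x = 0) ->
  rintegrable lam I (wpair W v f) -> rintegrable lam I (wpair W g u) ->
  \int[lam]_(x in I) wpair W v f x = \int[lam]_(x in I) wpair W g u x.
Proof.
move=> Is It st Ipq mono exh mI su sv iu iv u0 i1 i2.
apply/eqP; rewrite -subr_eq0 -RintegralB//; apply/eqP.
set h := fun x => wpair W v f x - wpair W g u x.
have ih : rintegrable lam I h by exact: rintegrableB.
have [n1 /andP[h11 h12]] := exh s Is; have [n2 /andP[h21 h22]] := exh t It.
have pmono m n : (m <= n)%N -> p n <= p m.
  have /nonincreasing_seqP h1 : forall k, p k.+1 <= p k by move=> k; exact: (mono k).1.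
  exact: h1.
have qmono m n : (m <= n)%N -> q m <= q n.
  have /nondecreasing_seqP h1 : forall k, q k <= q k.+1 by move=> k; exact: (mono k).2.
  exact: h1.
pose N := maxn n1 n2.
pose F n := I `\` `]p (N + n)%N, q (N + n)%N[%classic.
have mF n : measurable (F n) by apply: measurableD => //; exact: measurable_itv.
have dF n : F n.+1 `<=` F n.
  move=> x [Ix hx]; split => // xx; apply: hx; move: xx; rewrite /= !in_itv /= addnS => /andP[y1 y2].
  by have [z1 z2] := mono (N + n)%N; rewrite (le_lt_trans z1 y1) (lt_le_trans y2 z2).
have F0 : \bigcap_n F n = set0.
  apply/seteqP; split => // x hx; have [Ix _] := hx 0%N Logic.I.
  have [m /andP[m1 m2]] := exh x Ix; have [_ hh] := hx m Logic.I; apply: hh.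
  rewrite /= in_itv /= (le_lt_trans (pmono m (N + m)%N (leq_addl _ _)) m1).
  exact: lt_le_trans m2 (qmono m (N + m)%N (leq_addl _ _)).
have iF : rintegrable lam (F 0%N) h by apply: rintegrableS ih => // x [].
have cv := Rintegral_decreasing_cvg0 mF dF F0 iF.
have E n : \int[lam]_(x in F n) h x = \int[lam]_(x in I) h x.
  have sub : `]p (N + n)%N, q (N + n)%N[%classic `<=` I.
    move=> x; rewrite /= in_itv /= => /andP[y1 y2].
    by apply: (Iconv (Ipq (N + n)%N).1 (Ipq (N + n)%N).2); rewrite (ltW y1) (ltW y2).
  have EI : I = `]p (N + n)%N, q (N + n)%N[ `|` F n by rewrite /F setDUK.
  have dj : [disjoint `]p (N + n)%N, q (N + n)%N[%classic & F n].
    by apply/disj_setPS => x [? [_ ?]].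
  rewrite EI Rintegral_setU//; last by rewrite -EI.
  rewrite (Green_identity (s := s) (t := t) _ _ _ _ _ su sv) ?add0r//.
  - exact: (Ipq _).1.
  - exact: (Ipq _).2.
  - by apply: le_lt_trans h11; apply: pmono; rewrite (leq_trans (leq_maxl n1 n2))// leq_addr.
  - by apply: lt_le_trans h22 _; apply: qmono; rewrite (leq_trans (leq_maxr n1 n2))// leq_addr.
have : (fun n => \int[lam]_(x in F n) h x) @ \oo --> \int[lam]_(x in I) h x.
  by under eq_fun do rewrite E; exact: cvg_cst.
by move=> /cvg_lim <- //; apply/cvg_lim.
Qed.

End Green.

(** * Smooth steps *)

Section Smooth.
Context (R : realType).
Implicit Types (f g : R -> R) (k : nat) (x : R).

(** Differentiability of order k + 1, by recursion on the derivative, which suits products and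
affine substitutions better than iterated derivatives. *)
Fixpoint differentiable_upto k f : Prop :=
  (forall x, derivable f x 1) /\
  if k is k'.+1 then differentiable_upto k' (derive1 f) else True.

Lemma differentiable_uptoW k f : differentiable_upto k.+1 f -> differentiable_upto k f.
Proof.
elim: k f => [|k ih] f; first by move=> [].
by move=> [h1 h2]; split => //; apply: ih.
Qed.

Lemma differentiable_upto_derivable k f : differentiable_upto k f -> forall x, derivable f x 1.
Proof. by case: k => [|k] []. Qed.

Lemma derive1n_derivable f : (forall k, differentiable_upto k f) ->
  forall k x, derivable (derive1n k f) x 1.
Proof.
move=> h k; have {}h := h k; elim: k f h => [|k ih] f [h1 h2]; first exact: h1.
by move=> x; rewrite /derive1n iterSr; exact: ih.
Qed.

Lemma differentiable_uptoD k f g : differentiable_upto k f -> differentiable_upto k g ->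
  differentiable_upto k (fun x => f x + g x).
Proof.
elim: k f g => [|k ih] f g [f1 f2] [g1 g2]; (split; first by move=> x; exact: derivableD) => //.
have -> : derive1 (fun x => f x + g x) = (fun x => derive1 f x + derive1 g x).
  by apply/funext => x; rewrite !derive1E deriveD.
exact: ih.
Qed.

Lemma differentiable_uptoM k f g : differentiable_upto k f -> differentiable_upto k g ->
  differentiable_upto k (fun x => f x * g x).
Proof.
elim: k f g => [|k ih] f g hf hg; have f1 := differentiable_upto_derivable hf;
  have g1 := differentiable_upto_derivable hg;
  (split; first by move=> x; exact: derivableM) => //.
have -> : derive1 (fun x => f x * g x) = (fun x => derive1 f x * g x + f x * derive1 g x).
  by apply/funext => x; rewrite !derive1E deriveM// /GRing.scale /=; ring.
apply: differentiable_uptoD; apply: ih.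
- by case: hf.
- exact: differentiable_uptoW.
- exact: differentiable_uptoW.
- by case: hg.
Qed.

Lemma differentiable_upto_cst k (c : R) : differentiable_upto k (fun=> c).
Proof.
elim: k c => [|k ih] c; (split; first by move=> x; exact: derivable_cst) => //.
have -> : derive1 (fun=> c) = (fun=> 0) :> (R -> R).
  by apply/funext => y; rewrite derive1_cst.
exact: ih.
Qed.

Lemma is_derive_affine f (a b x : R) : derivable f (a * x + b) 1 ->
  is_derive x 1 (fun x => f (a * x + b)) (a * derive1 f (a * x + b)).
Proof.
move=> df.
have h1 : is_derive (a * x + b) 1 f (derive1 f (a * x + b)).
  by rewrite derive1E; apply/derivableP.
have h2 : is_derive x 1 (fun x : R => a * x + b) a.
  apply: is_derive_eq; rewrite addr0 -[_ *: _]/(_ * _). by rewrite ?scaler0 ?add0r; ring.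
have := @is_derive1_comp _ f (fun x => a * x + b) x _ _ h1 h2.
by move=> h; apply: is_derive_eq h _; rewrite mulrC.
Qed.

Lemma differentiable_upto_affine k f (a b : R) : differentiable_upto k f ->
  differentiable_upto k (fun x => f (a * x + b)).
Proof.
elim: k f => [|k ih] f hf; have f1 := differentiable_upto_derivable hf;
  (split; first by move=> x; have [] := is_derive_affine (f1 (a * x + b))) => //.
have -> : derive1 (fun x => f (a * x + b)) = (fun x => a * derive1 f (a * x + b)).
  apply/funext => x; rewrite derive1E.
  by have h := is_derive_affine (f1 (a * x + b)); rewrite derive_val.
apply: differentiable_uptoM; first exact: differentiable_upto_cst.
by apply: ih; case: hf.
Qed.

(** The functions p(1/x) exp(-1/x), extended by 0 to the negative axis. This family is closed
under differentiation, so all its members are smooth. *)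
Definition flat (p : {poly R}) x := if 0 < x then p.[x^-1] * expR (- x^-1) else 0.

Lemma poly_expR_bounded (p : {poly R}) :
  exists M, forall y : R, 0 <= y -> `|p.[y] * expR (- y)| <= M.
Proof.
have h n (y : R) : 0 <= y -> y ^+ n * expR (- y) <= n`!%:R.
  move=> y0; rewrite expRN ler_pdivrMr ?expR_gt0//.
  case: n => [|n]; first by rewrite expr0 fact0 mul1r -[leLHS](@expR0 R) ler_expR.
  rewrite -ler_pdivrMl ?ltr0n ?fact_gt0// mulrC.
  by apply: le_trans (expR_ge1Dxn n y0); rewrite lerDr.
exists (\sum_(i < size p) `|p`_i| * i`!%:R) => y y0.
rewrite horner_coef mulr_suml; apply: (le_trans (ler_norm_sum _ _ _)).
apply: ler_sum => i _; rewrite -mulrA normrM ler_wpM2l// ger0_norm ?h//.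
by rewrite mulr_ge0 ?exprn_ge0 ?expR_ge0.
Qed.

Let dpoly (p : {poly R}) : {poly R} := 'X^2 * (p - p^`()%R).

Lemma is_derive_flat (p : {poly R}) x : is_derive x 1 (flat p) (flat (dpoly p) x).
Proof.
have [x0|x0|->] := ltgtP x 0.
- have near0 : \forall y \near x, cst 0 y = flat p y.
    by near=> y; rewrite /flat ltNge ifF//; apply/negbTE; rewrite negbK ltW//;
      near: y; exact: lt_nbhsl.
  by rewrite /flat ltNge (ltW x0) /=; apply: near_eq_is_derive near0 _.
- have near0 : \forall y \near x, p.[y^-1] * expR (- y^-1) = flat p y.
    by near=> y; rewrite /flat ifT//; near: y; exact: lt_nbhsr.
  apply: near_eq_is_derive near0 _.
  have xn0 : x != 0 by rewrite gt_eqF.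
  have h1 : is_derive x 1 (fun y : R => y^-1) (- (x ^- 2)).
    apply: is_derive_eq (@is_deriveV _ id x 1 1 xn0 (is_derive_id x 1)) _.
    by rewrite /GRing.scale /= mulr1.
  have h2 : is_derive x 1 (fun y : R => p.[y^-1]) (p^`()%R.[x^-1] * (- (x ^- 2))).
    have hp : is_derive (x^-1) 1 (horner p) (p^`()%R.[x^-1]).
      by rewrite derivE derive1E; apply/derivableP; exact: derivable_horner.
    exact: (@is_derive1_comp _ _ _ _ _ _ hp h1).
  have h3 : is_derive x 1 (fun y : R => expR (- y^-1)) (expR (- x^-1) * (x ^- 2)).
    have hN : is_derive x 1 (fun y : R => - y^-1) (x ^- 2).
      by apply: is_derive_eq; rewrite opprK.
    exact: (@is_derive1_comp _ _ _ _ _ _ (is_derive_expR _) hN).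
  apply: is_derive_eq (is_deriveM h2 h3) _.
  by rewrite /flat x0 /dpoly !hornerE /GRing.scale /= exprVn; ring.
- rewrite /flat ltxx.
  have [M hM] := poly_expR_bounded ('X^2 * p).
  have M0 : 0 <= M by apply: le_trans (hM 0 (lexx _)).
  have key : (fun h : R => h^-1 *: ((flat p \o shift 0) (h *: 1) - flat p 0)) @ 0^' --> 0.
    apply/cvgrPdist_le => e e0; near=> h.
    have he : `|h| <= e / (M + 1) by near: h; apply: dnbhs0_le; rewrite divr_gt0//; lra.
    rewrite sub0r normrN /= /shift /= addr0 {2}/flat ltxx subr0 /GRing.scale /= mulr1 /flat.
    case: ifPn => [h0|_]; last by rewrite mulr0 normr0 ltW.
    have -> : h^-1 * (p.[h^-1] * expR (- h^-1)) =
        h * (('X^2 * p).[h^-1] * expR (- h^-1)).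
      by rewrite hornerM hornerXn expr2; move: (expR _) (p.[_]) => E P; field; rewrite gt_eqF.
    rewrite normrM; apply: (@le_trans _ _ (e / (M + 1) * M)).
      by apply: ler_pM => //; apply: hM; rewrite invr_ge0 ltW.
    rewrite -mulrA ger_pMr// mulrC ler_pdivrMr; lra.
  apply: DeriveDef; first by apply/cvg_ex; exists 0.
  exact: cvg_lim key.
Unshelve. all: by end_near.
Qed.

Lemma differentiable_upto_flat k (p : {poly R}) : differentiable_upto k (flat p).
Proof.
elim: k p => [|k ih] p; (split; first by move=> x; have [] := is_derive_flat p x) => //.
have -> : derive1 (flat p) = flat (dpoly p).
  by apply/funext => x; rewrite derive1E; have h := is_derive_flat p x; rewrite derive_val.
exact: ih.
Qed.

(** The product of a flat function at 0 and of its mirror image at 1. *)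
Definition bump x := flat 1 x * flat 1 (1 - x).

Lemma differentiable_upto_bump k : differentiable_upto k bump.
Proof.
apply: differentiable_uptoM; first exact: differentiable_upto_flat.
have := differentiable_upto_affine (-1) 1 (differentiable_upto_flat k 1).
by congr differentiable_upto; apply/funext => x; rewrite mulN1r addrC.
Qed.

Lemma bump_ge0 x : 0 <= bump x.
Proof.
have h y : 0 <= flat 1 y by rewrite /flat; case: ifP => // _; rewrite hornerE mul1r expR_ge0.
exact: mulr_ge0.
Qed.

Lemma bump_out x : ~ (0 < x < 1) -> bump x = 0.
Proof.
rewrite /bump /flat subr_gt0; case: (0 < x) => /=; last by rewrite mul0r.
by case: (x < 1) => // _; rewrite mulr0.
Qed.

Lemma bump_gt0 x : 0 < x < 1 -> 0 < bump x.
Proof.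
have h y : 0 < y -> 0 < flat 1 y by rewrite /flat => ->; rewrite hornerE mul1r expR_gt0.
by move=> /andP[x0 x1]; apply: mulr_gt0; apply: h; rewrite ?subr_gt0.
Qed.

Lemma differentiable_upto_continuous f : (forall x, derivable f x 1) -> continuous f.
Proof. by move=> df x; apply/differentiable_continuous/derivable1_diffP. Qed.

Lemma continuous_bump : continuous bump.
Proof.
exact/differentiable_upto_continuous/(differentiable_upto_derivable (differentiable_upto_bump 0)).
Qed.

Local Notation leb := (@lebesgue_measure R).

(** A primitive of the bump: 0 on the negative axis and constant beyond 1. *)
Definition smooth_step x : R := \int[leb]_(t in `]-oo, x]) bump t.

Lemma bump_rintegrable : rintegrable leb setT bump.
Proof.
have h01 : rintegrable leb `[0, 1] bump.
  apply: continuous_compact_integrable; first exact: segment_compact.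
  exact/continuous_subspaceT/continuous_bump.
have := proj1 (rintegrable_mkcond leb bump (measurable_itv `[0, 1])) h01.
apply: eq_rintegrable => // x _; rewrite patchE; case: ifPn => // /negP h.
rewrite bump_out// => /andP[x0 x1]; apply: h; rewrite inE /= in_itv /=.
by rewrite !ltW.
Qed.

Lemma smooth_step_derive x : derivable smooth_step x 1 /\ derive1 smooth_step x = bump x.
Proof.
apply: (@continuous_FTC1 _ bump -oo%O x (x + 1)).
- by rewrite ltrDl.
- exact: rintegrableS bump_rintegrable.
- by rewrite /= ltNyr.
- exact: continuous_bump.
Qed.

Lemma differentiable_upto_smooth_step k : differentiable_upto k smooth_step.
Proof.
have h x : derivable smooth_step x 1 by case: (smooth_step_derive x).
case: k => [|k]; split => //.
have -> : derive1 smooth_step = bump by apply/funext => x; case: (smooth_step_derive x).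
exact: differentiable_upto_bump.
Qed.

Lemma smooth_step_le0 x : x <= 0 -> smooth_step x = 0.
Proof.
move=> x0; rewrite /smooth_step; under eq_Rintegral.
  move=> t; rewrite inE /= in_itv /= => tx; rewrite bump_out; last first.
    by move=> /andP[t0 _]; move: (lt_le_trans t0 (le_trans tx x0)); rewrite ltxx.
  over.
by rewrite Rintegral_cst// mul0r.
Qed.

Lemma smooth_step_nondecreasing : {homo smooth_step : x y / x <= y}.
Proof.
move=> x y xy; apply: Rintegral_restrict_ge0 => //.
- by move=> t; rewrite /= !in_itv /= => /le_trans; apply.
- exact: rintegrableS bump_rintegrable.
- by move=> t _; exact: bump_ge0.
Qed.

Lemma smooth_step_ge1 x : 1 <= x -> smooth_step x = smooth_step 1.
Proof.
move=> x1; rewrite /smooth_step !(Rintegral_mkcond leb [set` _]).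
apply: eq_Rintegral => t _; rewrite !patchE.
have [t1|t1] := leP t 1.
  by rewrite !mem_set//= in_itv//= (le_trans t1 x1).
rewrite bump_out ?if_same//; by move=> /andP[_]; rewrite ltNge (ltW t1).
Qed.

Lemma smooth_step1_gt0 : 0 < smooth_step 1.
Proof.
have h0 x : 0 <= x -> 0 <= smooth_step x.
  by move=> /smooth_step_nondecreasing; rewrite smooth_step_le0.
rewrite lt_neqAle h0// andbT; apply/negP => /eqP S1.
have S0 x : 0 < x < 1 -> smooth_step x = 0.
  move=> /andP[x0 x1]; have := smooth_step_nondecreasing (ltW x1).
  by rewrite -S1 => h1; apply/eqP; rewrite eq_le h1 h0// ltW.
have half : 0 < (2^-1 : R) < 1 by apply/andP; split; lra.
have := bump_gt0 half; rewrite -(smooth_step_derive 2^-1).2 derive1E.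
rewrite (@near_eq_derive _ _ _ _ (cst 0)) ?derive_cst ?ltxx//.
near=> y; rewrite S0//; apply/andP; split; near: y; [apply: lt_nbhsr|apply: lt_nbhsl]; lra.
Unshelve. all: by end_near.
Qed.

End Smooth.

(** * Exhaustion of an open interval *)

Section OpenInterval.
Context (R : realType) (a b : \bar R).
Local Notation I := (oint a b).

Lemma oint_conv (x y z : R) : I x -> I z -> x <= y <= z -> I y.
Proof.
move=> [ax _] [_ zb] /andP[xy yz]; split.
  by apply: (lt_le_trans ax); rewrite lee_fin.
by apply: le_lt_trans zb; rewrite lee_fin.
Qed.

Lemma oint_open (x : R) : I x -> exists2 e : R, 0 < e & I (x - e) /\ I (x + e).
Proof.
move=> [ax xb].
have [e1 e10 ae] : exists2 e : R, 0 < e & (a < (x - e)%:E)%E.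
  case: a ax => [r|//|_]; last by exists 1 => //; rewrite ltNyr.
  rewrite lte_fin => rx; exists ((x - r) / 2); first by lra.
  by rewrite lte_fin; lra.
have [e2 e20 be] : exists2 e : R, 0 < e & ((x + e)%:E < b)%E.
  case: b xb => [r|_|//]; last by exists 1 => //; rewrite ltry.
  rewrite lte_fin => rx; exists ((r - x) / 2); first by lra.
  by rewrite lte_fin; lra.
have l1 : Num.min e1 e2 <= e1 by rewrite ge_min lexx.
have l2 : Num.min e1 e2 <= e2 by rewrite ge_min lexx orbT.
have l3 : 0 < Num.min e1 e2 by rewrite lt_min e10.
set e := Num.min e1 e2 in l1 l2 l3.
exists e => //; split; split.
- by apply: (lt_le_trans ae); rewrite lee_fin; lra.
- by apply: le_lt_trans xb; rewrite lee_fin; lra.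
- by apply: (lt_le_trans ax); rewrite lee_fin; lra.
- by apply: le_lt_trans be; rewrite lee_fin; lra.
Qed.

Lemma oint_itvE : I = [set` Interval
  (match a with EFin r => BRight r | -oo%E => BInfty _ true | +oo%E => BInfty _ false end)
  (match b with EFin r => BLeft r | -oo%E => BInfty _ true | +oo%E => BInfty _ false end)].
Proof.
rewrite /oint; apply/seteqP; split => x /=; rewrite itv_boundlr.
  by case: a => [r||] []; case: b => [r'||] //; rewrite ?lte_fin ?bnd_simp => *; apply/andP; split.
by case: a => [r||]; case: b => [r'||]; rewrite ?lte_fin ?bnd_simp ?ltry ?ltNyr // => /andP[].
Qed.

Lemma oint_measurable : measurable I.
Proof. by rewrite oint_itvE; exact: measurable_itv. Qed.

Lemma oint_nonempty : (a < b)%E -> I !=set0.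
Proof.
case: a => [r||]; case: b => [r'||] //.
- rewrite lte_fin => rr; exists ((r + r') / 2); split; rewrite lte_fin; lra.
- by exists (r + 1); split; rewrite ?ltry// lte_fin; lra.
- by exists (r' - 1); split; rewrite ?ltNyr// lte_fin; lra.
- by exists 0; split; rewrite ?ltry ?ltNyr.
Qed.

Lemma vanishing_sequence (e : R) : 0 < e -> exists d : nat -> R,
  [/\ forall n, 0 < d n <= e, forall n, d n.+1 <= d n &
      forall x, 0 < x -> exists n, d n < x].
Proof.
move=> e0; exists (fun n => e * n.+1%:R^-1); split => [n|n|x x0].
- have /andP[h1 h2] := natSinv_itv R n; rewrite mulr_gt0//=.
  by rewrite -[leRHS]mulr1 ler_wpM2l// ltW.
- by rewrite ler_wpM2l ?natSinv_le// ltW.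
- exact: natSinv_small.
Qed.

(** Finite end points and infinite ones are approached by different sequences. *)
Lemma oint_exhaustion : (a < b)%E -> exists p q : nat -> R,
  [/\ forall n, I (p n) /\ I (q n), forall n, p n < q n,
      forall n, p n.+1 <= p n /\ q n <= q n.+1 &
      forall x, I x -> exists n, p n < x < q n].
Proof.
move=> /oint_nonempty[x0 Ix0]; have [e e0 [Im Ip]] := oint_open Ix0.
have [p [p1 p2 p3 p4]] : exists p : nat -> R, [/\ forall n, I (p n), forall n, p n < x0,
    forall n, p n.+1 <= p n & forall x, I x -> exists n, p n < x].
  case: (Ix0) => ax xb; case Ea : a ax Im => [r|//|] ax Im.
  - have rx : 0 < (x0 - r) / 2 by rewrite lte_fin in ax; lra.
    have [d [d1 d2 d3]] := vanishing_sequence rx.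
    exists (fun n => r + d n); split => [n|n|n|x].
    + have /andP[h1 h2] := d1 n; split; first by rewrite lte_fin; lra.
      by apply: le_lt_trans xb; rewrite lee_fin; lra.
    + by have /andP[h1 h2] := d1 n; lra.
    + by rewrite lerD2l.
    + rewrite /oint /= lte_fin => -[rx1 _].
      have rx2 : 0 < x - r by lra.
      by have [n hn] := d3 _ rx2; exists n; lra.
  - exists (fun n => x0 - n.+1%:R); split => [n|n|n|x _].
    + split; first by rewrite ltNyr.
      by apply: le_lt_trans xb; rewrite lee_fin gerBl ler0n.
    + by rewrite ltrBlDr ltrDl ltr0n.
    + by rewrite lerD2l lerN2 ler_nat.
    + have [n hn] : exists n : nat, x0 - x < n.+1%:R.
        exists (Num.truncn `|x0 - x|); apply: le_lt_trans (ler_norm _) _.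
        by rewrite truncnS_gt.
      by exists n; lra.
have [q [q1 q2 q3 q4]] : exists q : nat -> R, [/\ forall n, I (q n), forall n, x0 < q n,
    forall n, q n <= q n.+1 & forall x, I x -> exists n, x < q n].
  case: (Ix0) => ax xb; case Eb : b xb Ip => [r||//] xb Ip.
  - have rx : 0 < (r - x0) / 2 by rewrite lte_fin in xb; lra.
    have [d [d1 d2 d3]] := vanishing_sequence rx.
    exists (fun n => r - d n); split => [n|n|n|x].
    + have /andP[h1 h2] := d1 n; split; last by rewrite lte_fin; lra.
      by apply: lt_le_trans ax _; rewrite lee_fin; lra.
    + by have /andP[h1 h2] := d1 n; lra.
    + by rewrite lerD2l lerN2.
    + rewrite /oint /= lte_fin => -[_ rx1].
      have rx2 : 0 < r - x by lra.
      by have [n hn] := d3 _ rx2; exists n; lra.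
  - exists (fun n => x0 + n.+1%:R); split => [n|n|n|x _].
    + split; last by rewrite ltry.
      by apply: lt_le_trans ax _; rewrite lee_fin lerDl ler0n.
    + by rewrite ltrDl ltr0n.
    + by rewrite lerD2l ler_nat.
    + have [n hn] : exists n : nat, x - x0 < n.+1%:R.
        exists (Num.truncn `|x - x0|); apply: le_lt_trans (ler_norm _) _.
        by rewrite truncnS_gt.
      by exists n; lra.
exists p, q; split => // [n|x Ix]; first exact: lt_trans (p2 n) (q2 n).
have [n1 h1] := p4 x Ix; have [n2 h2] := q4 x Ix.
have /nonincreasing_seqP pm := p3; have /nondecreasing_seqP qm := q3.
exists (maxn n1 n2); rewrite (le_lt_trans (pm _ _ (leq_maxl n1 n2)) h1).
exact: lt_le_trans h2 (qm _ _ (leq_maxr n1 n2)).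
Qed.

Lemma compact_oint (K : set R) : I !=set0 -> compact K -> K `<=` I ->
  exists s t, [/\ I s, I t, s <= t & K `<=` `[s, t]].
Proof.
move=> [x0 Ix0] cK KI; have [K0|/set0P K0] := eqVneq K set0.
  by exists x0, x0; split => //; rewrite K0.
have cid : {within K, continuous (id : R -> R)}.
  by apply: continuous_subspaceT => x; exact: cvg_id.
have [t Kt ht] := compact_EVT_max K0 cK cid.
have [s Ks hs] := compact_EVT_min K0 cK cid.
exists s, t; split; [exact/KI/set_mem|exact/KI/set_mem|by apply: hs|].
by move=> x Kx /=; rewrite in_itv /= (hs _ (mem_set Kx)) (ht _ (mem_set Kx)).
Qed.

Lemma itv_rcborel (s t : R) (B : set R) : I s -> I t -> measurable B -> B `<=` `[s, t] -> rcborel a b B.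
Proof.
move=> Is It mB Bst; split => //; exists `[s, t]%classic; split => //.
  exact: segment_compact.
by move=> x; rewrite /= in_itv /=; exact: oint_conv.
Qed.

End OpenInterval.

(** * One-sided limits of functions of bounded variation *)

Section OneSidedLimits.
Context (R : realType).
Implicit Types (g : R -> R) (s : R).

Lemma right_limitP g s (L : R) : g x @[x --> s^'+] --> L <->
  forall e : R, 0 < e -> exists2 r : R, 0 < r & forall y, s < y -> y < s + r -> `|g y - L| <= e.
Proof.
split=> [/cvgrPdist_le h e e0|h].
  have [r /= r0 hr] := h _ e0; exists r => // y sy yr.
  rewrite distrC; apply: hr => //=; rewrite distrC ger0_norm ?subr_ge0 ?ltW//; lra.
apply/cvgrPdist_le => e e0; have [r r0 hr] := h _ e0.
near=> y; rewrite distrC; apply: hr; near: y; first exact: nbhs_right_gt.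
by apply: nbhs_right_lt; lra.
Unshelve. all: by end_near.
Qed.

Lemma left_limitP g s (L : R) : g x @[x --> s^'-] --> L <->
  forall e : R, 0 < e -> exists2 r : R, 0 < r & forall y, y < s -> s - r < y -> `|g y - L| <= e.
Proof.
split=> [/cvgrPdist_le h e e0|h].
  have [r /= r0 hr] := h _ e0; exists r => // y sy yr.
  rewrite distrC; apply: hr => //=; rewrite ger0_norm ?subr_ge0 ?ltW//; lra.
apply/cvgrPdist_le => e e0; have [r r0 hr] := h _ e0.
near=> y; rewrite distrC; apply: hr; near: y; first exact: nbhs_left_lt.
by apply: nbhs_left_gt; lra.
Unshelve. all: by end_near.
Qed.

End OneSidedLimits.

Section BoundedVariation.
Context (R : realType).
Implicit Types (g : R -> R) (c d s : R).

(** The negative variations are constant beyond the end points after clipping, which makes the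
two parts monotone on the whole line. *)
Lemma bounded_variation_decomposition c d g : c <= d -> bounded_variation c d g ->
  exists P N : R -> R, [/\ {homo P : x y / x <= y}, {homo N : x y / x <= y} &
    forall x, c <= x <= d -> g x = P x - N x].
Proof.
move=> cd bv.
pose clip x := Num.max c (Num.min d x).
have cl x : clip x \in `[c, d].
  by rewrite in_itv /= /clip le_max lexx /= ge_max cd ge_min lexx.
have clm : {homo clip : x y / x <= y}.
  move=> x y xy; rewrite /clip ge_max le_max lexx /= le_max; apply/orP; right.
  by rewrite le_min !ge_min lexx xy orbT.
have clid x : c <= x <= d -> clip x = x.
  by move=> /andP[cx xd]; rewrite /clip (min_r xd) (max_r cx).
have bvN : bounded_variation c d (\- g) by exact: bounded_variationN.
exists (fun x => fine (neg_tv c (\- g) (clip x))), (fun x => fine (neg_tv c g (clip x))).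
split => [x y xy|x y xy|x cxd].
- exact: (fine_neg_tv_nondecreasing bvN (cl x) (cl y) (clm _ _ xy)).
- exact: (fine_neg_tv_nondecreasing bv (cl x) (cl y) (clm _ _ xy)).
- rewrite -{1}(clid x cxd); exact: (bounded_variation_pos_neg_tvE bv (cl x)).
Qed.

Lemma bounded_variation_measurable c d g : bounded_variation c d g -> measurable_fun `[c, d] g.
Proof.
move=> bv; have [cd|dc] := leP c d; last first.
  by rewrite set_itv_ge ?bnd_simp -?ltNge//; exact: measurable_fun_set0.
have [P [N [hP hN gE]]] := bounded_variation_decomposition cd bv.
apply: (eq_measurable_fun (fun x => P x - N x)) => [x|].
  by rewrite inE /= in_itv /= => /gE ->.
by apply: measurable_funB; apply: nondecreasing_measurable.
Qed.

Lemma bounded_variation_bounded c d g : bounded_variation c d g ->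
  exists M, forall x, c <= x <= d -> `|g x| <= M.
Proof.
move=> bv; have [cd|dc] := leP c d; last first.
  by exists 0 => x /andP[cx xd]; move: (lt_le_trans dc cx); rewrite ltNge xd.
have [P [N [hP hN gE]]] := bounded_variation_decomposition cd bv.
exists (`|P c| + `|P d| + (`|N c| + `|N d|)) => x cxd; rewrite gE//.
move: cxd => /andP[cx xd].
have bd (F : R -> R) : {homo F : x y / x <= y} -> `|F x| <= `|F c| + `|F d|.
  move=> hF; have h1 := hF _ _ cx; have h2 := hF _ _ xd.
  have := ler_norm (F d); have := ler_norm (- F c); rewrite normrN => h3 h4.
  have := normr_ge0 (F c); have := normr_ge0 (F d) => h5 h6.
  by rewrite ler_norml; apply/andP; split; lra.
by apply: (le_trans (ler_normB _ _)); apply: lerD; exact: bd.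
Qed.

Lemma nondecreasing_limit_right (F : R -> R) s : {homo F : x y / x <= y} ->
  exists L : R, F x @[x --> s^'+] --> L.
Proof.
move=> hF; eexists; apply: (@nondecreasing_at_right_cvgr _ _ _ (BLeft (s + 1))).
- by rewrite bnd_simp ltrDl.
- by move=> x y _ _ xy; exact: hF.
- by exists (F s) => _ [x + <-]; rewrite /= in_itv /= => /andP[/ltW sx _]; exact: hF.
Qed.

Lemma nondecreasing_limit_left (F : R -> R) s : {homo F : x y / x <= y} ->
  exists L : R, F x @[x --> s^'-] --> L.
Proof.
move=> hF; apply/cvg_ex; apply: nondecreasing_at_left_is_cvgr.
- by apply: nearW => x y w _ _ yw; exact: hF.
- apply: nearW => x; exists (F s) => _ [y + <-]; rewrite /= in_itv /= => /andP[_ /ltW ys].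
  exact: hF.
Qed.

Lemma bounded_variation_limit_right c d g s : bounded_variation c d g -> c <= s -> s < d ->
  exists L : R, g x @[x --> s^'+] --> L.
Proof.
move=> bv cs sd; have cd : c <= d by rewrite (le_trans cs) ?ltW.
have [P [N [hP hN gE]]] := bounded_variation_decomposition cd bv.
have [LP /right_limitP hLP] := nondecreasing_limit_right s hP.
have [LN /right_limitP hLN] := nondecreasing_limit_right s hN.
exists (LP - LN); apply/right_limitP => e e0.
have e2 : 0 < e / 2 by lra.
have [r1 r10 h1] := hLP _ e2; have [r2 r20 h2] := hLN _ e2.
exists (Num.min (Num.min r1 r2) (d - s)); first by rewrite !lt_min r10 r20 subr_gt0.
move=> y sy; rewrite -ltrBlDl !lt_min => /andP[/andP[y1 y2] yd].
rewrite gE; last by apply/andP; split; lra.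
have := h1 y sy ltac:(lra); have := h2 y sy ltac:(lra); rewrite !ler_norml.
by move=> /andP[p1 p2] /andP[p3 p4]; apply/andP; split; lra.
Qed.

Lemma bounded_variation_limit_left c d g s : bounded_variation c d g -> c < s -> s <= d ->
  exists L : R, g x @[x --> s^'-] --> L.
Proof.
move=> bv cs sd; have cd : c <= d by rewrite (le_trans _ sd) ?ltW.
have [P [N [hP hN gE]]] := bounded_variation_decomposition cd bv.
have [LP /left_limitP hLP] := nondecreasing_limit_left s hP.
have [LN /left_limitP hLN] := nondecreasing_limit_left s hN.
exists (LP - LN); apply/left_limitP => e e0.
have e2 : 0 < e / 2 by lra.
have [r1 r10 h1] := hLP _ e2; have [r2 r20 h2] := hLN _ e2.
exists (Num.min (Num.min r1 r2) (s - c)); first by rewrite !lt_min r10 r20 subr_gt0.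
move=> y sy; rewrite ltrBlDr -ltrBlDl !lt_min => /andP[/andP[y1 y2] yd].
rewrite gE; last by apply/andP; split; lra.
have := h1 y sy ltac:(lra); have := h2 y sy ltac:(lra); rewrite !ler_norml.
by move=> /andP[p1 p2] /andP[p3 p4]; apply/andP; split; lra.
Qed.

End BoundedVariation.

(** * Distributional derivatives of primitives *)

Section TestFunctions.
Context (R : realType) (a b : \bar R).
Local Notation I := (oint a b).
Local Notation leb := (@lebesgue_measure R).
Local Notation test := (@test_fun R a b).
Implicit Types (phi D : R -> R) (s t p r : R).

Lemma test_fun_derivable phi x : test phi -> I x -> derivable phi x 1.
Proof. by move=> [h _] Ix; exact: (h 0%N). Qed.

Lemma test_fun_continuous phi x : test phi -> I x -> {for x, continuous phi}.
Proof.
by move=> h Ix; apply/differentiable_continuous/derivable1_diffP; exact: test_fun_derivable.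
Qed.

Lemma test_fun_derive_continuous phi x : test phi -> I x ->
  {for x, continuous (derive1 phi)}.
Proof.
by move=> [h _] Ix; apply/differentiable_continuous/derivable1_diffP; exact: (h 1%N).
Qed.

(** The compact support lies in some segment; a slightly larger open interval also carries the
derivative. *)
Lemma test_fun_support phi : I !=set0 -> test phi -> exists s t,
  [/\ I s, I t, s < t, forall x, I x -> ~ (s < x < t) -> phi x = 0 &
      forall x, I x -> ~ (s < x < t) -> derive1 phi x = 0].
Proof.
move=> I0 [_ [K [cK KI phi0]]].
have [s0 [t0 [Is0 It0 st Kst]]] := compact_oint I0 cK KI.
have [e1 e10 [Is _]] := oint_open Is0; have [e2 e20 [_ It]] := oint_open It0.
have z x : I x -> ~ (s0 <= x <= t0) -> phi x = 0.
  by move=> Ix h; apply: phi0 => // /Kst; rewrite /= in_itv.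
exists (s0 - e1), (t0 + e2); split => //; first by lra.
  by move=> x Ix h; apply: z => // /andP[h1 h2]; apply: h; apply/andP; split; lra.
move=> x Ix h; have : x < s0 \/ t0 < x.
  have [xs|xs] := ltP x s0; first by left.
  by right; rewrite ltNge; apply/negP => xt; apply: h; apply/andP; split; lra.
have [e e0 [Im Ip]] := oint_open Ix.
move=> hx; have [r r0 hr] : exists2 r : R, 0 < r & forall y, x - r < y -> y < x + r -> ~ (s0 <= y <= t0).
  case: hx => hx; [exists (s0 - x)|exists (x - t0)]; try lra.
    by move=> y _ y2 /andP[]; lra.
  by move=> y y1 _ /andP[]; lra.
rewrite derive1E (@near_eq_derive _ _ _ _ (cst 0)) ?derive_cst//.
near=> y; rewrite z//.
  apply: (oint_conv Im Ip); apply/andP; split; apply: ltW; near: y.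
    by apply: lt_nbhsr; lra.
  by apply: lt_nbhsl; lra.
by apply: hr; near: y; [apply: lt_nbhsr|apply: lt_nbhsl]; lra.
Unshelve. all: by end_near.
Qed.

Lemma test_fun_FTC phi s t : test phi -> I s -> I t -> s <= t ->
  rintegrable leb `[s, t] (derive1 phi) /\
  \int[leb]_(x in `]s, t[) derive1 phi x = phi t - phi s.
Proof.
move=> hphi Is It st.
have Ist x : s <= x <= t -> I x by exact: oint_conv.
have cphi' : {within `[s, t], continuous (derive1 phi)}.
  apply: continuous_in_subspaceT => x; rewrite inE /= in_itv /= => xst.
  by apply: test_fun_derive_continuous => //; exact: Ist.
have ii : rintegrable leb `[s, t] (derive1 phi).
  by apply: continuous_compact_integrable => //; exact: segment_compact.
split => //; move: st; rewrite le_eqVlt => /predU1P[<-|st].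
  by rewrite set_itv_ge ?bnd_simp// Rintegral_set0 subrr.
have cphi x : s <= x <= t -> {for x, continuous phi}.
  by move=> xst; apply: test_fun_continuous => //; exact: Ist.
have F := @continuous_FTC2 _ (derive1 phi) phi s t st cphi' _ _.
rewrite /Rintegral -(integral_itv_bndoo true false); last first.
  by apply/measurable_EFinP; apply: measurable_funS (rintegrable_measurable ii) => //;
    exact: subset_itv_oo_cc.
rewrite F//; split.
- move=> x; rewrite in_itv /= => /andP[h1 h2]; apply: test_fun_derivable => //.
  by apply: Ist; rewrite !ltW.
- by apply: cvg_at_right_filter; apply: cphi; rewrite lexx ltW.
- by apply: cvg_at_left_filter; apply: cphi; rewrite lexx ltW.
Qed.

(** Weak form of the derivative of a primitive. The primitive is an integral of h against the half
sign kernel; exchanging the integrals leaves the integral of phi' against that kernel, which is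
- phi by the fundamental theorem of calculus. *)
Lemma cut_primitive_weak (lam : {sigma_finite_measure set R -> \bar R}) h z phi :
  I !=set0 -> loc_rintegrable lam I h -> cut_primitive lam I h z -> test phi ->
  \int[leb]_(x in I) (derive1 phi x * cut_mean z x) = - \int[lam]_(x in I) (phi x * h x).
Proof.
move=> I0 ih hz hphi.
have [s [t [Is It st phi0 dphi0]]] := test_fun_support I0 hphi.
have [ii _] := test_fun_FTC hphi Is It (ltW st).
set D := [set` Interval (BRight s) (BLeft t)].
have mD : measurable D by exact: measurable_itv.
have DE x : D x <-> s < x < t by rewrite /D /= in_itv.
have DI x : D x -> I x.
  by move=> /DE /andP[h1 h2]; apply: (oint_conv Is It); rewrite (ltW h1) (ltW h2).
have ihD : rintegrable lam setT (h \_ D).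
  by rewrite -rintegrable_mkcond//; exact: (loc_rintegrable_cuts ih (Is : cut_in I (BRight s)) (It : cut_in I (BLeft t))).
have idD : rintegrable leb setT (derive1 phi \_ D).
  rewrite -rintegrable_mkcond//; apply: rintegrableS ii => //; exact: subset_itv_oo_cc.
have p0 : point = 0 :> R by [].
have -> : \int[leb]_(x in I) (derive1 phi x * cut_mean z x) =
    \int[leb]_x ((derive1 phi \_ D) x * ((z (BRight s) + z (BLeft t)) / 2 +
      \int[lam]_y (half_sign y x * (h \_ D) y))).
  rewrite Rintegral_mkcond; apply: eq_Rintegral => x _; rewrite !patchE.
  case: (boolP (x \in D)) => [/set_mem Dx|].
    rewrite mem_set; last exact: DI.
    by rewrite (cut_primitive_mean (@oint_conv _ _ _) ih hz (c := BRight s) (d := BLeft t)).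
  move/negP; rewrite inE => Dx; rewrite p0 mul0r; case: ifPn => // /set_mem Ix.
  by rewrite dphi0 ?mul0r// => /DE.
have i1 := rintegrableZ ((z (BRight s) + z (BLeft t)) / 2) measurableT idD.
under eq_Rintegral do rewrite mulrDr mulrC.
pose T : measurableType _ := measurableTypeR R.
have msg : measurable_fun (setT : set (R * T)%type) (fun q => half_sign (q.1 : R) (q.2 : R)).
  exact: (@half_sign_measurable R).
have sgn (q : R * T) : `|half_sign (q.1 : R) (q.2 : R)| <= 2^-1 by exact: half_sign_norm.
have i2 : rintegrable leb setT (fun x => (derive1 phi \_ D) x *
    \int[lam]_y (half_sign y x * (h \_ D) y)).
  have := rintegrable_bndl measurableT (kernel_integral_measurable msg ihD)
    (fun y _ => kernel_integral_le msg sgn y ihD) idD.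
  by apply: eq_rintegrable => // x _; rewrite mulrC.
rewrite RintegralD// RintegralZl// -(Rintegral_mkcond leb D).
have [_ ->] := test_fun_FTC hphi Is It (ltW st).
have -> : phi t = 0 by apply: phi0 => //; rewrite ltxx andbF.
have -> : phi s = 0 by apply: phi0 => //; rewrite ltxx.
rewrite subrr mulr0 add0r (kernel_Fubini msg sgn ihD idD).
have key x : D x -> \int[leb]_y (half_sign x y * (derive1 phi \_ D) y) = - phi x.
  move=> Dx; have Ix := DI x Dx; have /andP[sx xt] := (DE x).1 Dx.
  have [ixt Fxt] := test_fun_FTC hphi Ix It (ltW xt).
  have [isx Fsx] := test_fun_FTC hphi Is Ix (ltW sx).
  have j1 : rintegrable leb setT (derive1 phi \_ `]x, t[).
    by rewrite -rintegrable_mkcond//; apply: rintegrableS ixt => //; exact: subset_itv_oo_cc.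
  have j2 : rintegrable leb setT (derive1 phi \_ `]s, x[).
    by rewrite -rintegrable_mkcond//; apply: rintegrableS isx => //; exact: subset_itv_oo_cc.
  transitivity (\int[leb]_y (2^-1 * (derive1 phi \_ `]x, t[) y - 2^-1 * (derive1 phi \_ `]s, x[) y)).
    apply: eq_Rintegral => y _; rewrite !patchE /D.
    have E c d : (y \in [set` Interval c d]) = (c <= BLeft y)%O && (BRight y <= d)%O.
      by apply/idP/idP; rewrite inE /= itv_boundlr.
    rewrite !E !bnd_simp /half_sign /cut_step !bnd_simp p0.
    case: (ltgtP x y) => [xy|yx|<-] /=.
    - by rewrite (lt_trans sx xy) /=; case: ifP => _; rewrite ?andbF; lra.
    - by rewrite (lt_trans yx xt) andbT /=; case: ifP => _; lra.
    - by rewrite andbF sx xt /=; lra.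
  rewrite RintegralB//; [|exact: rintegrableZ..].
  rewrite !RintegralZl// -!Rintegral_mkcond Fxt Fsx.
  have -> : phi t = 0 by apply: phi0 => //; rewrite ltxx andbF.
  have -> : phi s = 0 by apply: phi0 => //; rewrite ltxx.
  by field.
have iph : rintegrable lam setT (fun x => phi x * (h \_ D) x).
  have msg' : measurable_fun (setT : set (T * R)%type) (fun q => half_sign (q.2 : R) (q.1 : R)).
    have -> : (fun q : T * R => half_sign (q.2 : R) (q.1 : R)) = (fun q => - half_sign (q.1 : R) (q.2 : R)).
      by apply/funext => q; rewrite half_signC.
    apply: measurableT_comp => //; exact: (@half_sign_measurable R).
  have sgn' (q : T * R) : `|half_sign (q.2 : R) (q.1 : R)| <= 2^-1 by exact: half_sign_norm.
  have := rintegrable_bndl measurableT (kernel_integral_measurable msg' idD)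
    (fun y _ => kernel_integral_le msg' sgn' y idD) ihD.
  move=> /(rintegrableN measurableT); apply: eq_rintegrable => // x _ /=; rewrite [in RHS]patchE.
  rewrite patchE; case: (boolP (x \in D)) => [/set_mem Dx|Dx]; last by rewrite p0 !mulr0 oppr0.
  by rewrite key// mulNr opprK.
rewrite (Rintegral_mkcond lam I) -RintegralN//.
  apply: eq_Rintegral => x _; rewrite !patchE.
  case: (boolP (x \in D)) => [/set_mem Dx|].
    by rewrite key// (mem_set (DI x Dx)); ring.
  move/negP; rewrite inE => Dx; rewrite p0 mul0r; case: ifPn => [/set_mem Ix|_]; last by rewrite ?p0 oppr0.
  by rewrite phi0 ?mul0r ?oppr0// => /DE.
apply: (eq_rintegrable measurableT) iph => x _; rewrite !patchE.
case: (boolP (x \in D)) => [/set_mem Dx|]; first by rewrite (mem_set (DI x Dx)).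
move/negP; rewrite inE => Dx; rewrite p0 mulr0; case: ifPn => [/set_mem Ix|_]; last by rewrite ?p0.
by rewrite phi0 ?mul0r// => /DE.
Qed.

End TestFunctions.

(** * Functions with a given distributional derivative *)

Section ScalarBridge.
Context (R : realType) (a b : \bar R).
Local Notation I := (oint a b).
Local Notation leb := (@lebesgue_measure R).
Local Notation test := (@test_fun R a b).
Local Notation loc_bv := (@loc_bv R a b).
Local Notation balanced := (@balanced R a b).
Implicit Types (phi D g u : R -> R) (s t p r : R).
Variable lam : {sigma_finite_measure set R -> \bar R}.
Local Notation lint := (loc_rintegrable lam I).
Local Notation prim := (cut_primitive lam I).
Hypothesis I0 : I !=set0.

Lemma loc_bvB f g : loc_bv f -> loc_bv g -> loc_bv (fun x => f x - g x).
Proof.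
move=> hf hg c d cdI; case: (ltgtP c d) => [cd|dc|<-].
- by apply: (bounded_variationD cd (hf c d cdI)); exact/bounded_variationN/hg.
- apply: nondecreasing_bounded_variation => x y; rewrite in_itv /= => /andP[cx xd].
  by move: (lt_le_trans dc cx); rewrite ltNge xd.
- exact: bounded_variationxx.
Qed.

Lemma test_fun_bv_rintegrable phi D : test phi -> loc_bv D ->
  rintegrable leb I (fun x => derive1 phi x * D x).
Proof.
move=> hphi bvD; have [s [t [Is It st phi0 dphi0]]] := test_fun_support I0 hphi.
have [ii _] := test_fun_FTC hphi Is It (ltW st).
have stI : `[s, t] `<=` I by move=> x; rewrite /= in_itv /=; exact: oint_conv.
have [M hM] := bounded_variation_bounded (bvD _ _ stI).
have h : rintegrable leb `[s, t] (fun x => D x * derive1 phi x).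
  apply: (rintegrable_bndl (M := M)) => //.
  exact: (bounded_variation_measurable (bvD _ _ stI)).
have {}h : rintegrable leb (I `&` `[s, t]) (fun x => D x * derive1 phi x).
  by rewrite (setIidr stI).
move: h; rewrite rintegrable_restrict //; last exact: oint_measurable.
apply: eq_rintegrable; first exact: oint_measurable.
move=> x /set_mem Ix; rewrite patchE mulrC; case: ifPn => // /negP; rewrite inE /= in_itv /= => xst.
by rewrite dphi0 ?mul0r// => /andP[h1 h2]; apply: xst; rewrite !ltW.
Qed.

Lemma cut_primitive_exists h : lint h -> exists z, prim h z.
Proof.
move=> ih; have [x0 Ix0] := I0; pose c0 := BLeft x0 : itv_bound R.
have Ic0 : cut_in I c0 by [].
pose J c d := \int[lam]_(x in [set` Interval c d]) h x.
have Jadd c d e : cut_in I c -> cut_in I d -> cut_in I e -> (c <= d)%O -> (d <= e)%O ->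
    J c e = J c d + J d e.
  move=> Ic Id Ie cd de; rewrite /J.
  have E : [set` Interval c e] = [set` Interval c d] `|` [set` Interval d e].
    exact: itv_bndbnd_setU.
  rewrite E Rintegral_setU//.
  - by rewrite -E; exact: (loc_rintegrable_cuts ih Ic Ie).
  - apply/disj_setPS => x [] /=; rewrite !itv_boundlr => /andP[_ h1] /andP[h2 _].
    by move: h2; rewrite cut_lr h1.
exists (fun c => if (c0 <= c)%O then J c0 c else - J c c0) => c d Ic Id cd.
case: (boolP (c0 <= c)%O) => h1.
  by rewrite (le_trans h1 cd) (Jadd c0 c d) => //; rewrite -/(J c d); ring.
move: h1; rewrite -ltNge => /ltW cc0; case: (boolP (c0 <= d)%O) => h2.
  by rewrite -/(J c d) (Jadd c c0 d) => //; ring.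
by move: h2; rewrite -ltNge => /ltW dc0; rewrite -/(J c d) (Jadd c d c0) => //; ring.
Qed.

Lemma loc_rintegrable_sub h1 h2 : lint h1 -> lint h2 -> lint (fun x => h1 x - h2 x).
Proof. by move=> i1 i2 s t Is It; apply: rintegrableB; auto. Qed.

(** The balanced representative of a primitive has locally bounded variation: the primitive of the
positive part of the density, and its difference with z, are both nondecreasing. *)
Lemma cut_mean_loc_bv h z : lint h -> prim h z -> loc_bv (cut_mean z).
Proof.
move=> ih hz c d cdI.
(* The difference of zp and z is a primitive of the negative part of h. *)
pose hp x := Num.max (h x) 0.
have ip : lint hp.
  move=> s t Is It; have i := ih s t Is It.
  apply: (le_rintegrable (g := fun x => `|h x|)) => //; last exact: rintegrable_norm.
    by apply: measurable_maxr => //; exact: rintegrable_measurable i.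
  by move=> x _; rewrite /hp; case: (leP (h x) 0) => hx; rewrite ?normr0.
have [zp hzp] := cut_primitive_exists ip.
have mono k y : lint k -> prim k y -> (forall x, 0 <= k x) ->
    {in `[c, d] &, {homo cut_mean y : u v / u <= v}}.
  move=> ik hy k0 u v uI vI; have Iu := cdI _ uI; have Iv := cdI _ vI.
  rewrite le_eqVlt => /predU1P[->//|uv].
  have m f e : y (BSide f u) <= y (BSide e v).
    rewrite -subr_ge0 hy//; last by case: f; case: e; rewrite bnd_simp ?ltW.
    by apply: Rintegral_ge0 => x _.
  by rewrite /cut_mean ler_pM2r ?invr_gt0// lerD.
have hzn : prim (fun x => hp x - h x) (fun c => zp c - z c).
  move=> k e Ig Ie ge; rewrite RintegralB//; [|exact: (loc_rintegrable_cuts ip Ig Ie)|exact: (loc_rintegrable_cuts ih Ig Ie)].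
  by rewrite -hzp// -hz//; ring.
have bp : bounded_variation c d (cut_mean zp).
  by apply: nondecreasing_bounded_variation; apply: (mono hp) => // x; rewrite le_max lexx orbT.
have bn : bounded_variation c d (cut_mean (fun c => zp c - z c)).
  apply: nondecreasing_bounded_variation; apply: (mono _ _ _ hzn).
    exact: loc_rintegrable_sub.
  by move=> x; rewrite subr_ge0 le_max lexx.
have -> : cut_mean z = (fun x => cut_mean zp x - cut_mean (fun c => zp c - z c) x).
  by apply/funext => x; rewrite /cut_mean; field.
case: (ltgtP c d) => [cd|dc|<-].
- by apply: (bounded_variationD cd bp); exact/bounded_variationN.
- apply: nondecreasing_bounded_variation => x y; rewrite in_itv /= => /andP[cx xd].
  by move: (lt_le_trans dc cx); rewrite ltNge xd.
- exact: bounded_variationxx.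
Qed.

Lemma cut_mean_balanced h z : lint h -> prim h z -> balanced (cut_mean z).
Proof.
move=> ih hz x Ix.
have -> : lim (cut_mean z y @[y --> x^'+]) = z (BRight x).
  apply: cvg_lim; first exact: Rhausdorff.
  apply/right_limitP => eps e0.
  have [r r0 hr] := cut_mean_limit_right (@oint_conv _ _ _) (@oint_open _ _ _) ih hz Ix e0.
  by exists r => // y xy yr; case: (hr y xy yr).
have -> : lim (cut_mean z y @[y --> x^'-]) = z (BLeft x).
  apply: cvg_lim; first exact: Rhausdorff.
  apply/left_limitP => eps e0.
  have [r r0 hr] := cut_mean_limit_left (@oint_conv _ _ _) (@oint_open _ _ _) ih hz Ix e0.
  by exists r => // y xy yr; case: (hr y xy yr).
by rewrite /cut_mean addrC.
Qed.

(** A test function that rises from 0 on [p, p + r] and falls back to 0 on [p', p' + r]; its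
derivative approximates a difference of point masses at p and p'. *)
Definition plateau p p' r x : R := smooth_step (r^-1 * x + - (r^-1 * p)) +
  (-1) * smooth_step (r^-1 * x + - (r^-1 * p')).

Lemma derive1_plateau p p' r x : derive1 (plateau p p' r) x =
  r^-1 * bump (r^-1 * (x - p)) - r^-1 * bump (r^-1 * (x - p')).
Proof.
have d q : is_derive x 1 (fun x => smooth_step (r^-1 * x + - (r^-1 * q))) (r^-1 * bump (r^-1 * (x - q))).
  have [h1 h2] := smooth_step_derive (r^-1 * x + - (r^-1 * q)).
  by have := is_derive_affine h1; rewrite h2 mulrBr.
have d' := is_deriveM (is_derive_cst (-1 : R) x 1) (d p').
have := is_deriveD (d p) d'.
rewrite derive1E => h; rewrite (@derive_val _ _ _ _ _ _ _ h) /= scaler0 addr0.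
by rewrite scaleN1r.
Qed.

Lemma plateau_test p p' r : 0 < r -> I p -> p < p' -> I (p' + r) -> test (plateau p p' r).
Proof.
move=> r0 Ip pp' Ip'; split.
  move=> k x _; apply: derive1n_derivable => {}k.
  apply: differentiable_uptoD.
    exact/differentiable_upto_affine/differentiable_upto_smooth_step.
  apply: differentiable_uptoM; first exact: differentiable_upto_cst.
  exact/differentiable_upto_affine/differentiable_upto_smooth_step.
exists `[p, p' + r]%classic; split; first exact: segment_compact.
  by move=> x; rewrite /= in_itv /=; exact: oint_conv.
move=> x _ /=; rewrite in_itv /= => /negP; rewrite negb_and -!ltNge /plateau -!mulrBr => /orP[xp|px].
  by rewrite !smooth_step_le0 ?mulr0 ?addr0// pmulr_rle0 ?invr_gt0//; lra.
rewrite !(@smooth_step_ge1 _ (r^-1 * _)) ?mulN1r ?subrr//; rewrite mulrC ler_pdivlMr//; lra.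
Qed.

Lemma test_fun_average phi D s t (L sg eps : R) : test phi -> loc_bv D -> I s -> I t -> s <= t ->
  (forall x, s < x < t -> `|derive1 phi x| = sg * derive1 phi x /\ `|D x - L| <= eps) ->
  `|\int[leb]_(x in `]s, t[) (derive1 phi x * D x) - L * (phi t - phi s)| <=
    eps * (sg * (phi t - phi s)).
Proof.
move=> hphi bvD Is It st h; have [ii F] := test_fun_FTC hphi Is It st.
have sub : `]s, t[ `<=` I.
  by move=> x; rewrite /= in_itv /= => /andP[h1 h2]; apply: (oint_conv Is It); rewrite !ltW.
have i1 : rintegrable leb `]s, t[ (derive1 phi).
  by apply: rintegrableS ii => //; exact: subset_itv_oo_cc.
have i2 : rintegrable leb `]s, t[ (fun x => derive1 phi x * D x).
  by apply: rintegrableS (test_fun_bv_rintegrable hphi bvD) => //; exact: oint_measurable.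
have i3 : rintegrable leb `]s, t[ (fun x => L * derive1 phi x) by exact: rintegrableZ.
rewrite -F -!RintegralZl//; last exact: rintegrableZ.
rewrite -RintegralB//; apply: le_norm_Rintegral => //.
- by apply: rintegrable_measurable; exact: (rintegrableB _ i2 i3).
- move=> x; rewrite /= in_itv /= => /h[h1 h2].
  by rewrite mulrC -mulrBl normrM h1 ler_wpM2r// -h1.
- exact/rintegrableZ/rintegrableZ.
Qed.

(** As the ramps of the plateau become steeper, the integral of D against its derivative tends to
a multiple of the difference of the right limits of D. *)
Lemma weakly_constant_right_limit D p p' (L L' : R) : loc_bv D ->
  (forall phi, test phi -> \int[leb]_(x in I) (derive1 phi x * D x) = 0) ->
  I p -> I p' -> p < p' -> D x @[x --> p^'+] --> L -> D x @[x --> p'^'+] --> L' -> L = L'.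
Proof.
move=> bvD weak Ip Ip' pp' /right_limitP hL /right_limitP hL'.
have S0 := @smooth_step1_gt0 R.
apply/eqP; rewrite -subr_eq0 -normr_eq0 eq_le normr_ge0 andbT; apply/ler_addgt0Pr => eps e0.
have e2 : 0 < eps / 2 by lra.
have [r1 r10 h1] := hL _ e2; have [r2 r20 h2] := hL' _ e2; have [e3 e30 [_ Ie]] := oint_open Ip'.
pose r := Num.min (Num.min r1 r2) (Num.min e3 (p' - p)).
have r0 : 0 < r by rewrite !lt_min r10 r20 e30 subr_gt0.
have [rr1 rr2 re3 rpp] : [/\ r <= r1, r <= r2, r <= e3 & r <= p' - p].
  by split; rewrite /r !ge_min lexx ?orbT.
have Ipr' : I (p' + r) by apply: (oint_conv Ip' Ie); lra.
have Ipr : I (p + r) by apply: (oint_conv Ip Ip'); lra.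
have hphi := plateau_test r0 Ip pp' Ipr'.
set phi := plateau p p' r in hphi.
have bz q x : ~ (q < x < q + r) -> bump (r^-1 * (x - q)) = 0.
  move=> hx; apply: bump_out => /andP[k1 k2]; apply: hx.
  move: k1 k2; rewrite pmulr_rgt0 ?invr_gt0// mulrC ltr_pdivrMr// mul1r => *; lra.
have bge q x : 0 <= r^-1 * bump (r^-1 * (x - q)).
  by rewrite mulr_ge0 ?bump_ge0// invr_ge0 ltW.
have dphi1 x : p < x < p + r -> `|derive1 phi x| = 1 * derive1 phi x.
  move=> /andP[k1 k2]; rewrite mul1r ger0_norm// derive1_plateau (bz p'); last by lra.
  by rewrite mulr0 subr0.
have dphi2 x : p' < x < p' + r -> `|derive1 phi x| = -1 * derive1 phi x.
  move=> /andP[k1 k2]; rewrite mulN1r ler0_norm// derive1_plateau (bz p); last by lra.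
  by rewrite mulr0 sub0r oppr_le0.
have P1 : phi p = 0.
  by rewrite /phi /plateau -!mulrBr !smooth_step_le0 ?mulr0 ?addr0// pmulr_rle0 ?invr_gt0//; lra.
have P2 : phi (p + r) = smooth_step 1.
  rewrite /phi /plateau -!mulrBr (smooth_step_le0 (x := _ * (_ - p'))); last first.
    by rewrite pmulr_rle0 ?invr_gt0//; lra.
  by rewrite mulr0 addr0 addrAC subrr add0r mulVf ?gt_eqF.
have P3 : phi p' = smooth_step 1.
  rewrite /phi /plateau -!mulrBr subrr mulr0 (smooth_step_le0 (x := 0))// mulr0 addr0.
  by apply: smooth_step_ge1; rewrite mulrC ler_pdivlMr//; lra.
have P4 : phi (p' + r) = 0.
  rewrite /phi /plateau -!mulrBr !(@smooth_step_ge1 _ (r^-1 * _)) ?mulN1r ?subrr// mulrC ler_pdivlMr//; lra.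
have A1 := @test_fun_average phi D p (p + r) L 1 (eps / 2) hphi bvD Ip Ipr _ _.
have A2 := @test_fun_average phi D p' (p' + r) L' (-1) (eps / 2) hphi bvD Ip' Ipr' _ _.
have {}A1 := A1 ltac:(lra) (fun x hx => conj (dphi1 x hx) (h1 x ltac:(lra) ltac:(lra))).
have {}A2 := A2 ltac:(lra) (fun x hx => conj (dphi2 x hx) (h2 x ltac:(lra) ltac:(lra))).
move: A1 A2; rewrite P1 P2 P3 P4 subr0 sub0r mul1r mulN1r opprK.
have E : \int[leb]_(x in `]p, p + r[) (derive1 phi x * D x) +
    \int[leb]_(x in `]p', p' + r[) (derive1 phi x * D x) = 0.
  rewrite -(weak _ hphi) -Rintegral_setU//.
  - rewrite Rintegral_mkcond [RHS]Rintegral_mkcond; apply: eq_Rintegral => x _.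
    rewrite !patchE; case: ifPn => [/set_mem xA|].
      rewrite mem_set//; case: xA; rewrite /= in_itv /= => /andP[k1 k2].
        by apply: (oint_conv Ip Ipr); lra.
      by apply: (oint_conv Ip' Ipr'); lra.
    move=> /negP; rewrite inE /= !in_itv /= => /not_orP[n1 n2]; case: ifPn => // _.
    by rewrite derive1_plateau !bz// mulr0 subrr mul0r.
  - apply: rintegrableS (test_fun_bv_rintegrable hphi bvD) => //.
    + exact: oint_measurable.
    + exact: measurableU.
    move=> x []; rewrite /= in_itv /= => /andP[k1 k2].
      by apply: (oint_conv Ip Ipr); lra.
    by apply: (oint_conv Ip' Ipr'); lra.
  - by apply/disj_setPS => x []; rewrite /= !in_itv /= => /andP[k1 k2] /andP[k3 k4]; lra.
move: (Rintegral _ _ _) (Rintegral _ _ _) E => X Y E.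
have {E}-> : Y = - X by lra.
set S1 := smooth_step 1 in S0 *.
rewrite add0r mulrN opprK => A1 A2.
have : `|L - L'| * S1 <= eps * S1.
  rewrite -[X in _ * X <= _](ger0_norm (ltW S0)) -normrM.
  have -> : (L - L') * S1 = - ((- X - L * S1) + (X + L' * S1)) by ring.
  by rewrite normrN; apply: (le_trans (ler_normD _ _)); lra.
by rewrite ler_pM2r.
Qed.

(** A balanced function with vanishing distributional derivative is constant: all right limits agree,
and a left limit is a limit of right limits. *)
Lemma weakly_constant D : loc_bv D -> balanced D ->
  (forall phi, test phi -> \int[leb]_(x in I) (derive1 phi x * D x) = 0) ->
  exists c, forall x, I x -> D x = c.
Proof.
move=> bvD balD weak; have [x0 Ix0] := I0.
have rl x : I x -> exists L : R, D y @[y --> x^'+] --> L.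
  move=> Ix; have [e e0 [_ Ie]] := oint_open Ix.
  apply: (bounded_variation_limit_right (c := x) (d := x + e)) => //; last by rewrite ltrDl.
  by apply: bvD => y; rewrite /= in_itv /=; exact: oint_conv.
have ll x : I x -> exists L : R, D y @[y --> x^'-] --> L.
  move=> Ix; have [e e0 [Ie _]] := oint_open Ix.
  apply: (bounded_variation_limit_left (c := x - e) (d := x)) => //; last by rewrite gtrBl.
  by apply: bvD => y; rewrite /= in_itv /=; exact: oint_conv.
have [c hc] := rl _ Ix0; exists c => x Ix.
have rc y : I y -> D w @[w --> y^'+] --> c.
  move=> Iy; have [L hL] := rl _ Iy; suff <- : L = c by [].
  case: (ltgtP y x0) => [yx|xy|yx].
  - exact: (weakly_constant_right_limit bvD weak Iy Ix0 yx hL hc).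
  - by apply/esym; exact: (weakly_constant_right_limit bvD weak Ix0 Iy xy hc hL).
  - by rewrite yx in hL; rewrite -(cvg_lim (@Rhausdorff R) hL) (cvg_lim (@Rhausdorff R) hc).
have lc : D w @[w --> x^'-] --> c.
  have [L hL] := ll _ Ix; suff <- : L = c by [].
  apply/eqP; rewrite -subr_eq0 -normr_eq0 eq_le normr_ge0 andbT; apply/ler_addgt0Pr => eps e0.
  have e2 : 0 < eps / 2 by lra.
  have [r1 r10 h1] := (left_limitP _ _ _).1 hL _ e2; have [e3 e30 [Ie _]] := oint_open Ix.
  pose r := Num.min r1 e3; have r0 : 0 < r by rewrite lt_min r10.
  have [rr1 rr3] : r <= r1 /\ r <= e3 by split; rewrite /r ge_min lexx ?orbT.
  have Iy : I (x - r / 2) by apply: (oint_conv Ie Ix); lra.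
  have [r2 r20 h2] := (right_limitP _ _ _).1 (rc _ Iy) _ e2.
  pose m := Num.min (r2 / 2) (r / 4); have m0 : 0 < m by rewrite lt_min !divr_gt0.
  have [m1 m2] : m <= r2 / 2 /\ m <= r / 4 by split; rewrite /m ge_min lexx ?orbT.
  have := h1 (x - r / 2 + m) ltac:(lra) ltac:(lra).
  have := h2 (x - r / 2 + m) ltac:(lra) ltac:(lra).
  by rewrite !ler_norml => /andP[p1 p2] /andP[p3 p4]; apply/andP; split; lra.
rewrite balD// (cvg_lim (@Rhausdorff R) lc) (cvg_lim (@Rhausdorff R) (rc _ Ix)); lra.
Qed.

Lemma balancedB f g : loc_bv f -> loc_bv g -> balanced f -> balanced g ->
  balanced (fun x => f x - g x).
Proof.
move=> bvf bvg hf hg x Ix; have [e e0 [Im Ip]] := oint_open Ix.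
have sub s t : I s -> I t -> `[s, t] `<=` I.
  by move=> Is It y; rewrite /= in_itv /=; exact: oint_conv.
have xp : x < x + e by rewrite ltrDl.
have xm : x - e < x by rewrite gtrBl.
have [Lf hLf] := bounded_variation_limit_right (bvf _ _ (sub _ _ Ix Ip)) (lexx _) xp.
have [Lg hLg] := bounded_variation_limit_right (bvg _ _ (sub _ _ Ix Ip)) (lexx _) xp.
have [Mf hMf] := bounded_variation_limit_left (bvf _ _ (sub _ _ Im Ix)) xm (lexx _).
have [Mg hMg] := bounded_variation_limit_left (bvg _ _ (sub _ _ Im Ix)) xm (lexx _).
rewrite (cvg_lim (@Rhausdorff R) (cvgB hLf hLg)) (cvg_lim (@Rhausdorff R) (cvgB hMf hMg)).
rewrite hf// hg// (cvg_lim (@Rhausdorff R) hLf) (cvg_lim (@Rhausdorff R) hLg).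
by rewrite (cvg_lim (@Rhausdorff R) hMf) (cvg_lim (@Rhausdorff R) hMg); field.
Qed.

(** A balanced function whose distributional derivative is the measure with density h differs by a
constant from the balanced representative of any primitive of that measure. *)
Lemma weak_derivative_cut_primitive u h : loc_bv u -> balanced u -> lint h ->
  (forall phi, test phi -> \int[leb]_(x in I) (derive1 phi x * u x) =
    - \int[lam]_(x in I) (phi x * h x)) ->
  exists z, prim h z /\ forall y, I y -> u y = cut_mean z y.
Proof.
move=> bvu balu ih weak; have [z hz] := cut_primitive_exists ih.
have bvz := cut_mean_loc_bv ih hz; have balz := cut_mean_balanced ih hz.
have [phi hphi|c hc] := weakly_constant (loc_bvB bvu bvz) (balancedB bvu bvz balu balz).
  under eq_Rintegral do rewrite mulrBr.
  rewrite RintegralB//.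
  - by rewrite weak// (cut_primitive_weak I0 ih hz hphi) subrr.
  - exact: oint_measurable.
  - exact: test_fun_bv_rintegrable.
  - exact: test_fun_bv_rintegrable.
exists (fun e => z e + c); split => [d e Id Ie de|y Iy].
  by rewrite -hz//; ring.
by have := hc y Iy; rewrite /cut_mean => /eqP; rewrite subr_eq => /eqP ->; field.
Qed.

End ScalarBridge.

(** * Local charges and their densities *)

Section LocalChargeRestriction.
Context (R : realType) (a b : \bar R) (m : loc_charge a b) (s t : R).
Local Notation I := (oint a b).
Hypotheses (Is : I s) (It : I t).

(** The local charge cut off outside [s, t]. The proofs that the end points lie in the interval are
parameters because additivity depends on them. *)
Definition charge_on (Is : I s) (It : I t) (B : set R) : \bar R := (m (B `&` `[s, t]))%:E.
Local Notation mu := (charge_on Is It).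

Let charge_on0 : mu set0 = 0%E.
Proof. by rewrite /charge_on set0I lcharge0. Qed.

Let charge_on_fin x : measurable x -> mu x \is a fin_num.
Proof. by []. Qed.

Let charge_on_additive : semi_sigma_additive mu.
Proof.
move=> F mF tF mUF; rewrite /charge_on.
have -> : (fun n => (\sum_(0 <= i < n) (m (F i `&` `[s, t]))%:E)%E) =
    EFin \o series (m \o (fun i => F i `&` `[s, t])).
  by apply/funext => n; rewrite /series /= sumEFin.
rewrite setI_bigcupl; apply: cvg_EFin; first exact: nearW.
apply: lchargeP.
- by move=> k; apply: measurableI.
- exact: trivIset_setIr.
- by apply: (itv_rcborel Is It) => [|x [n _ [_]//]]; apply: bigcupT_measurable => k; apply: measurableI.
Qed.

HB.instance Definition _ := isCharge.Build _ _ _ mu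
  charge_on0 charge_on_fin charge_on_additive.

(** The positive set of a Hahn decomposition carries the largest value of the charge. *)
Lemma pos_part_finite : (pos_part m `[s, t] < +oo)%E.
Proof.
have [P [N [[mP hP] [mN hN] PN1 PN0]]] := Hahn_decomposition mu.
apply: (@le_lt_trans _ _ (mu P)); last by rewrite /charge_on ltry.
apply: ge_ereal_sup => _ [B [[mB _] Bst] <-].
have BE : (m B)%:E = mu B by rewrite /charge_on (setIidl Bst).
have NE : N = ~` P.
  apply/seteqP; split => [x Nx Px|x nP]; first by rewrite -[False]/(set0 x) -PN0.
  by have : [set: R] x by []; rewrite -PN1 => -[].
rewrite BE (chargeDI mu mB mP).
have -> : mu P = (mu (P `\` B) + mu (P `&` B))%E by exact: chargeDI.
rewrite setIC leeD2r//; apply: (@le_trans _ _ 0%E); [apply: hN|apply: hP].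
- exact: measurableD.
- by rewrite NE => x [].
- exact: measurableD.
- by move=> x [].
Qed.

End LocalChargeRestriction.

Section Domination.
Context (R : realType) (a b : \bar R).
Local Notation I := (oint a b).
Implicit Types (m : loc_charge a b).

Lemma pos_part_out m B : B `&` I = set0 -> pos_part m B = 0%E.
Proof.
move=> BI; apply/eqP; rewrite eq_le measure_ge0 andbT.
apply: ge_ereal_sup => _ [C [[_ [K [_ KI CK]]] CB] <-].
suff -> : C = set0 by rewrite lcharge0.
by apply/seteqP; split => // x Cx; rewrite -BI; split; [exact: CB|apply: KI; exact: CK].
Qed.

Implicit Types (ab : (a < b)%E).

(** The sum of the positive parts of finitely many local charges; it is finite on compact sets and
so sigma-finite. *)
Definition dominating ab (ms : nat -> loc_charge a b) (N : nat) : set R -> \bar R :=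
  msum (fun k => pos_part (ms k)) N.

HB.instance Definition _ ab ms N := Measure.on (dominating ab ms N).

Lemma dominating_finite ab ms N s t : I s -> I t -> (dominating ab ms N `[s, t] < +oo)%E.
Proof. by move=> Is It; rewrite /dominating /msum lte_sum_pinfty// => k _; exact: pos_part_finite. Qed.

Lemma dominating_out ab ms N B : B `&` I = set0 -> dominating ab ms N B = 0%E.
Proof. by move=> BI; rewrite /dominating /msum big1// => k _; exact: pos_part_out. Qed.

Lemma le_dominating ab ms N k B : (k < N)%N -> (pos_part (ms k) B <= dominating ab ms N B)%E.
Proof. by move=> kN; rewrite /dominating /msum (bigD1 (Ordinal kN))//= leeDl// sume_ge0. Qed.

Let dominating_sigma_finite ab ms N : sigma_finite setT (dominating ab ms N).
Proof.
have [p [q [Ipq pq mono exh]]] := oint_exhaustion ab.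
exists (fun n => ~` I `|` `[p n, q n]).
  apply/seteqP; split => // x _; have [Ix|nIx] := pselect (I x).
    by have [n /andP[h1 h2]] := exh x Ix; exists n => //; right; rewrite /= in_itv /= !ltW.
  by exists 0%N => //; left.
move=> n; have mI : measurable (~` I) by apply: measurableC; exact: oint_measurable.
split; first exact: measurableU.
apply: (@le_lt_trans _ _ (dominating ab ms N (~` I) + dominating ab ms N `[p n, q n])%E).
  exact: measureU2.
rewrite dominating_out ?add0e; last by rewrite setICl.
by apply: dominating_finite; [exact: (Ipq n).1|exact: (Ipq n).2].
Qed.

HB.instance Definition _ ab ms N :=
  Measure_isSigmaFinite.Build _ _ _ (dominating ab ms N) (dominating_sigma_finite ab ms N).

End Domination.

(** Radon-Nikodym for a charge that is finite only on the compact subsets of the interval: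
the densities on the shells of an exhaustion are glued. *)
Section LocalDensity.
Context (R : realType) (a b : \bar R) (lam : {sigma_finite_measure set R -> \bar R}).
Local Notation I := (oint a b).
Implicit Types (m : loc_charge a b).

Definition loc_density m (D : R -> R) := measurable_fun setT D /\
  forall B, rcborel a b B -> rintegrable lam B D /\ m B = \int[lam]_(x in B) D x.

Hypothesis ab : (a < b)%E.

(** Radon-Nikodym for a charge that is finite only on the compact subsets of the interval: the
densities on the shells of an exhaustion are glued. *)
Lemma loc_density_exists m : (forall B, rcborel a b B -> lam B = 0%E -> m B = 0) ->
  exists D, loc_density m D.
Proof.
move=> dom; have [p [q [Ipq pq mono exh]]] := oint_exhaustion ab.
have RN s t : I s -> I t -> exists D : R -> R, rintegrable lam setT D /\
    forall B, measurable B -> B `<=` `[s, t] -> m B = \int[lam]_(x in B) D x.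
  move=> Is It; pose nu := charge_on m Is It.
  have nulam : nu `<< lam.
    apply/null_content_dominatesP => B mB B0; rewrite /nu /charge_on dom//.
      by apply: (itv_rcborel Is It) => //; apply: measurableI.
    by apply/eqP; rewrite -measure_le0 -B0 le_measure// inE//; apply: measurableI.
  exists (fun x => fine (Radon_Nikodym nu lam x)).
  have E : EFin \o (fun x => fine (Radon_Nikodym nu lam x)) = Radon_Nikodym nu lam.
    by apply/funext => x /=; rewrite fineK// Radon_Nikodym_fin_num.
  split; first by rewrite /rintegrable E; exact: Radon_Nikodym_integrable.
  move=> B mB Bst; have := Radon_Nikodym_integral nulam mB.
  rewrite /Rintegral -[Radon_Nikodym _ _]E => <-.
  by rewrite /nu /charge_on /= (setIidl Bst).
pose A n := `[p n, q n]%classic.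
pose shell n := seqD A n.
have mA n : measurable (A n) by exact: measurable_itv.
have mS n : measurable (shell n) by case: n => [|n]; rewrite /shell /seqD //; exact: measurableD.
have SA n : shell n `<=` A n by case: n => [|n]; rewrite /shell /seqD // => x [].
have AA n : A n `<=` A n.+1.
  move=> x; rewrite /A /= !in_itv /= => /andP[h1 h2]; have [h3 h4] := mono n.
  by rewrite (le_trans h3 h1) (le_trans h2 h4).
have [Ds hDs] := choice (fun n => RN _ _ (Ipq n).1 (Ipq n).2).
pose E k x := (Ds k \_ (shell k)) x.
pose S n x := \sum_(k < n) E k x.
have p0 : point = 0 :> R by [].
have E0 k n x : A n x -> (n < k)%N -> E k x = 0.
  move=> Anx nk; rewrite /E patchE memNset ?p0//; case: k nk => [//|k]; rewrite ltnS => nk [_].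
  apply; elim: k nk => [|k ih]; first by rewrite leqn0 => /eqP <-.
  by rewrite leq_eqVlt => /predU1P[<-//|]; rewrite ltnS => /ih/AA.
have SE n k x : A n x -> (n < k)%N -> S k x = S n.+1 x.
  move=> Anx; elim: k => [//|k ih]; rewrite ltnS leq_eqVlt => /predU1P[<-//|nk].
  by rewrite /S big_ord_recr /= (E0 _ n)// addr0; exact: ih.
have mE k : rintegrable lam setT (E k).
  by rewrite -rintegrable_mkcond//; exact: rintegrableS (hDs k).1.
have cvS x : I x -> exists2 n, A n x & S^~ x @ \oo --> S n.+1 x.
  move=> Ix; have [n /andP[h1 h2]] := exh x Ix.
  have Anx : A n x by rewrite /A /= in_itv /= !ltW.
  exists n => //; apply: cvg_near_cst; exists n.+1 => // k /= nk; exact: SE.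
pose D x := lim (S^~ x @ \oo).
have DE n x : A n x -> D x = S n.+1 x.
  move=> Anx; apply/cvg_lim; first exact: Rhausdorff.
  by apply: cvg_near_cst; exists n.+1 => // k /= nk; exact: SE.
have mbig n B : rcborel a b B -> m (B `&` A n) = \sum_(k < n.+1) m (B `&` shell k).
  move=> rB; elim: n => [|n ih]; first by rewrite big_ord_recr big_ord0 /= add0r.
  rewrite big_ord_recr /= -ih -lcharge_setU.
  - congr (m _); apply/seteqP; split => x.
      move=> [Bx Ax]; have [An|nAn] := pselect (A n x); [by left|by right].
    by case=> -[Bx h]; split => //; [exact: (AA _ _ h)|exact: h.1].
  - by apply: (measurable_rcborel rB) => [|x []//]; apply: measurableI => //; exact: rB.1.
  - by apply: (measurable_rcborel rB) => [|x []//]; apply: measurableI; [exact: rB.1|exact: (mS n.+1)].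
  - by apply/seteqP; split => // x [[_ Ax] [_ [_ nA]]].
have mI := oint_measurable a b.
have mSn n : measurable_fun setT (S n).
  by apply: measurable_sum => k; exact: rintegrable_measurable (mE k).
have mD : measurable_fun I D.
  apply: (measurable_fun_cvg (h := S)) => [n|x Ix]; first exact: measurable_funS (mSn n).
  by have [n Anx h] := cvS x Ix; rewrite (DE n).
exists (D \_ I); split; first exact/(measurable_restrictT _ mI).
move=> B rB; have [mB [K [cK KI BK]]] := rB.
have [n Bn] : exists n, B `<=` A n.
  have [x0|nI] := pselect (I !=set0); last first.
    by exists 0%N => x /BK/KI Ix; exfalso; apply: nI; exists x.
  have [s [t [Is It st Kst]]] := compact_oint x0 cK KI.
  have [n1 /andP[h1 h2]] := exh s Is; have [n2 /andP[h3 h4]] := exh t It.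
  have le12 k1 k2 x : (k1 <= k2)%N -> A k1 x -> A k2 x.
    elim: k2 => [|k2 ih]; first by rewrite leqn0 => /eqP ->.
    by rewrite leq_eqVlt => /predU1P[->//|]; rewrite ltnS => h /(ih h)/AA.
  have As : A (maxn n1 n2) s.
    by apply: (le12 n1); rewrite ?leq_maxl// /A /= in_itv /= !ltW.
  have At : A (maxn n1 n2) t.
    by apply: (le12 n2); rewrite ?leq_maxr// /A /= in_itv /= !ltW.
  exists (maxn n1 n2) => x /BK/Kst; rewrite /= in_itv /= => /andP[sx xt].
  move: As At; rewrite /A /= !in_itv /= => /andP[k1 _] /andP[_ k4].
  by rewrite (le_trans k1 sx) (le_trans xt k4).
have BI : B `<=` I by move=> x /BK/KI.
have eqD : {in B, S n.+1 =1 D \_ I}.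
  by move=> x /set_mem Bx; rewrite patchE mem_set ?(DE n)//; [exact: Bn|exact: BI].
have iS : rintegrable lam B (S n.+1).
  by apply: rintegrable_sum => // k; exact: rintegrableS (mE k).
split; first exact: eq_rintegrable eqD iS.
rewrite (@eq_Rintegral _ _ _ lam B (S n.+1)); last by move=> x Bx; rewrite eqD.
rewrite /S.
rewrite Rintegral_sum//; last by move=> k; exact: rintegrableS (mE k).
rewrite -[in LHS](setIidl Bn) mbig//; apply: eq_bigr => k _.
rewrite (hDs k).2 ?Rintegral_mkcondr//; first exact: measurableI.
by move=> x [_]; exact: SA.
Qed.

End LocalDensity.

(** * Change of measure *)

Section ChangeOfMeasure.
Import finmap.finmap.
Context d (T : measurableType d) (R : realType) (nu mu : {measure set T -> \bar R}).
Variables (E : set T) (th : T -> R).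
Hypotheses (mE : measurable E) (mth : measurable_fun E th) (th0 : forall x, 0 <= th x).
Hypothesis nuE : forall A, measurable A -> A `<=` E -> nu A = (\int[mu]_(x in A) (th x)%:E)%E.

(** Monotone approximation by simple functions. *)
Lemma ge0_change_of_measure (f : T -> \bar R) : (forall x, 0 <= f x)%E -> measurable_fun E f ->
  (\int[nu]_(x in E) f x = \int[mu]_(x in E) (f x * (th x)%:E))%E.
Proof.
move=> f0 mf; pose h := nnsfun_approx mE mf.
have mEth : measurable_fun E (fun x => (th x)%:E) by exact/measurable_EFinP.
have ch x : E x -> (EFin \o h ^~ x) @ \oo --> f x.
  by move=> Ex; apply: cvg_nnsfun_approx => // y _; exact: f0.
have lim1 : (\int[nu]_(x in E) f x = limn (fun n => \int[nu]_(x in E) (h n x)%:E))%E.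
  rewrite -monotone_convergence//.
  - by apply: eq_integral => x /set_mem Ex; apply/esym/cvg_lim => //; exact: ch.
  - by move=> n; apply/measurable_EFinP; apply: measurable_funTS.
  - by move=> n x _; rewrite lee_fin.
  - by move=> x _ i j ij; rewrite lee_fin; exact/lefP/nd_nnsfun_approx.
have lim2 : (\int[mu]_(x in E) (f x * (th x)%:E) =
    limn (fun n => \int[mu]_(x in E) ((h n x)%:E * (th x)%:E)))%E.
  rewrite -monotone_convergence//.
  - apply: eq_integral => x /set_mem Ex; apply/esym/cvg_lim => //.
    by apply: cvgeZr => //; exact: ch.
  - move=> n; apply: emeasurable_funM => //.
    by apply/measurable_EFinP; apply: measurable_funTS.
  - by move=> n x _; rewrite mule_ge0 ?lee_fin.
  - by move=> x _ i j ij; rewrite lee_wpmul2r ?lee_fin//; exact/lefP/nd_nnsfun_approx.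
rewrite lim1 lim2; congr (limn _); apply/funext => n.
pose s := fset_set (range (h n)).
have s0 i : (i < #|`s|%fset)%N -> 0 <= s`_i.
  move=> /(mem_nth 0); rewrite in_fset_set; last exact: fimfunP.
  by move=> /set_mem[x _ <-].
have mA i : measurable (h n @^-1` [set s`_i]) by exact: measurable_sfunP.
have mI i : measurable_fun E (fun x => (s`_i * \1_(h n @^-1` [set s`_i]) x)%:E).
  by apply/measurable_EFinP; apply: measurable_funM => //; exact: measurable_funTS.
transitivity (\sum_(i < #|`s|%fset) \int[nu]_(x in E) (s`_i * \1_(h n @^-1` [set s`_i]) x)%:E)%E.
  rewrite -ge0_integral_sum//.
    by apply: eq_integral => x _; rewrite sumEFin -fimfunEord.
  by move=> i x _; rewrite lee_fin mulr_ge0 ?s0.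
transitivity (\sum_(i < #|`s|%fset) \int[mu]_(x in E)
    ((s`_i * \1_(h n @^-1` [set s`_i]) x)%:E * (th x)%:E))%E; last first.
  rewrite -ge0_integral_sum//.
  - by apply: eq_integral => x _; rewrite -ge0_sume_distrl ?sumEFin -?fimfunEord// => i _;
      rewrite lee_fin mulr_ge0 ?s0.
  - by move=> i; exact: emeasurable_funM.
  - by move=> i x _; rewrite mule_ge0 ?lee_fin ?mulr_ge0 ?s0.
apply: eq_bigr => i _.
under eq_integral do rewrite EFinM.
under [RHS]eq_integral do rewrite EFinM -muleA.
have mi1 : measurable_fun E (fun x => (\1_(h n @^-1` [set s`_i]) x : R)%:E).
  by apply/measurable_EFinP; apply: measurable_funTS.
rewrite !ge0_integralZl ?lee_fin ?s0//.
- congr (_ * _)%E; rewrite integral_indic// nuE//; [|exact: measurableI].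
  rewrite setIC integral_mkcondr; apply: eq_integral => x _.
  by rewrite epatch_indic muleC.
- exact: emeasurable_funM.
- by move=> x _; rewrite mule_ge0 ?lee_fin.
Qed.

Lemma integral_change_of_measure (f : T -> R) : measurable_fun E f ->
  (\int[nu]_(x in E) (f x)%:E = \int[mu]_(x in E) (f x * th x)%:E)%E.
Proof.
move=> mf; have mfE : measurable_fun E (EFin \o f) by exact/measurable_EFinP.
rewrite integralE [RHS]integralE !ge0_change_of_measure//; first last.
- exact: measurable_funepos.
- exact: measurable_funeneg.
congr (_ - _)%E; apply: eq_integral => x _.
  by rewrite !funeposE /= -!EFin_max -EFinM maxr_pMl// mul0r.
by rewrite !funenegE /= -?EFinN -!EFin_max -EFinM maxr_pMl// mul0r mulNr.
Qed.

Lemma change_of_measure (f : T -> R) : measurable_fun E f ->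
  \int[nu]_(x in E) f x = \int[mu]_(x in E) (f x * th x).
Proof. by move=> mf; rewrite /Rintegral integral_change_of_measure. Qed.

Lemma rintegrable_change_of_measure (f : T -> R) : measurable_fun E f ->
  rintegrable nu E f <-> rintegrable mu E (fun x => f x * th x).
Proof.
move=> mf; have mfE : measurable_fun E (EFin \o f) by exact/measurable_EFinP.
have h : (\int[nu]_(x in E) `|(f x)%:E| = \int[mu]_(x in E) `|(f x * th x)%:E|)%E.
  rewrite ge0_change_of_measure//; last exact: measurableT_comp.
  by apply: eq_integral => x _; rewrite EFinM abseM (gee0_abs (x := (th x)%:E)) ?lee_fin.
split => /integrableP[_ hi]; apply/integrableP; split => //.
- by apply/measurable_EFinP; exact: measurable_funM.
- by rewrite /= -h.
- by rewrite /= h.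
Qed.

End ChangeOfMeasure.

Section PosPartDensity.
Context (R : realType) (a b : \bar R) (lam : {sigma_finite_measure set R -> \bar R}).
Local Notation I := (oint a b).
Hypothesis ab : (a < b)%E.
Implicit Types (m : loc_charge a b) (D f : R -> R).

Lemma loc_densityN m D : loc_density lam m D -> loc_density lam (lcharge_opp m) (fun x => - D x).
Proof.
move=> [mD hD]; split; first exact: measurableT_comp.
move=> B rB; have [iB mB] := hD B rB.
by split; [apply: rintegrableN => //; exact: rB.1|rewrite RintegralN//= ?mB//; exact: rB.1].
Qed.

(** The supremum that defines the positive part is approached by the sets where the density is
positive, cut off by an exhaustion. *)
Lemma pos_part_density m D A : loc_density lam m D -> measurable A -> A `<=` I ->
  pos_part m A = (\int[lam]_(x in A) (Num.max (D x) 0)%:E)%E.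
Proof.
move=> [mD hD] mA AI; have mP : measurable_fun setT (fun x => (Num.max (D x) 0)%:E).
  by apply/measurable_EFinP; exact: measurable_maxr.
have P0 x : (0 <= (Num.max (D x) 0)%:E)%E by rewrite lee_fin le_max lexx orbT.
apply/eqP; rewrite eq_le; apply/andP; split.
  apply: ge_ereal_sup => _ [B [rB BA] <-]; have [iB ->] := hD B rB; have mB := rB.1.
  rewrite EFin_Rintegral//; apply: (@le_trans _ _ (\int[lam]_(x in B) (Num.max (D x) 0)%:E)%E).
    apply: le_integral => //.
      apply: (le_rintegrable (f := fun x => Num.max (D x) 0) mB _ _ (rintegrable_norm mB iB)).
        by apply: measurable_funTS; exact: measurable_maxr.
      move=> x _; case: (leP (D x) 0) => h; rewrite ?normr0 ?normr_ge0//.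
    by move=> x _; rewrite lee_fin le_max lexx.
  by apply: ge0_subset_integral => //; exact: measurable_funTS.
have [p [q [Ipq pq mono exh]]] := oint_exhaustion ab.
pose F n := A `&` `[p n, q n].
have mF n : measurable (F n) by apply: measurableI.
have AE : A = \bigcup_n F n.
  apply/seteqP; split => [x Ax|x [n _ []//]]; have [n /andP[h1 h2]] := exh x (AI x Ax).
  by exists n => //; split => //; rewrite /= in_itv /= !ltW.
have ndF : nondecreasing_seq F.
  apply/nondecreasing_seqP => n; rewrite subsetEset => x [Ax].
  rewrite /= in_itv /= => /andP[h1 h2]; split => //; have [h3 h4] := mono n.
  by rewrite /= in_itv /= (le_trans h3 h1) (le_trans h2 h4).
have cv := @ge0_nondecreasing_set_cvg_integral _ _ _ F _ lam ndF mF
  (fun i => measurable_funTS mP) (fun i x _ => P0 x).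
rewrite [leLHS](_ : _ = \int[lam]_(x in \bigcup_i F i) (Num.max (D x) 0)%:E)%E; last by rewrite -AE.
rewrite -(cvg_lim _ cv)//; apply: lime_le; first by apply/cvg_ex; eexists; exact: cv.
apply: nearW => n; pose C := F n `&` [set x | 0 <= D x].
have mC : measurable C.
  apply: measurableI => //; rewrite -[X in measurable X]setTI.
  by apply: measurable_fun_le => //.
have rC : rcborel a b C.
  by apply: (itv_rcborel (Ipq n).1 (Ipq n).2 mC) => x [[]].
have [iC mCE] := hD C rC.
apply: (@le_trans _ _ (m C)%:E); last first.
  by apply: le_pos_part => // x [[]].
rewrite mCE EFin_Rintegral// [leRHS]integral_mkcond integral_mkcond le_eqVlt; apply/orP; left.
apply/eqP/eq_integral => x _; rewrite !patchE.
case: (boolP (x \in F n)) => [/set_mem Fx|Fx].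
  have [D0|D0] := leP 0 (D x); first by rewrite mem_set.
  by rewrite memNset// => -[_ /=]; rewrite leNgt D0.
by rewrite memNset// => -[] /mem_set; rewrite (negbTE Fx).
Qed.

Lemma Rintegral_pos_part m D f : loc_density lam m D -> measurable_fun I f ->
  \int[pos_part m]_(x in I) f x = \int[lam]_(x in I) (f x * Num.max (D x) 0).
Proof.
move=> hD mf; have mI := oint_measurable a b; apply: change_of_measure => //.
- by apply: measurable_funTS; apply: measurable_maxr => //; exact: hD.1.
- by move=> x; rewrite le_max lexx orbT.
- by move=> A mA AI; exact: pos_part_density.
Qed.

(** The integral against a local charge was defined by its positive and negative parts; with a
density at hand it is one integral. *)
Lemma Rint_charge_density m D f : loc_density lam m D -> measurable_fun I f ->
  rintegrable lam I (fun x => f x * D x) ->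
  Rint_charge m f = \int[lam]_(x in I) (f x * D x).
Proof.
move=> hD mf i; have mI := oint_measurable a b; have mD := hD.1.
have part (s : R) : `|s| = 1 -> rintegrable lam I (fun x => f x * Num.max (s * D x) 0).
  move=> s1; apply: (le_rintegrable mI _ _ (rintegrable_norm mI i)).
    apply: measurable_funM => //; apply: measurable_funTS; apply: measurable_maxr => //.
    exact: measurable_funM.
  move=> x _; rewrite !normrM ler_wpM2l// -[leRHS]mul1r -s1 -normrM.
  by case: (leP (s * D x) 0) => h; rewrite ?normr0.
have ip := part 1 (normr1 _); have im := part (-1) (normrN1 _).
rewrite /Rint_charge (Rintegral_pos_part hD mf) (Rintegral_pos_part (loc_densityN hD) mf).
rewrite -RintegralB//.
- apply: eq_Rintegral => x _; rewrite -mulrBr; congr (_ * _).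
  by case: (leP (D x) 0) => h1; case: (leP (- D x) 0) => h2; lra.
- by under eq_fun do rewrite -[D _]mul1r.
- by under eq_fun do rewrite -mulN1r.
Qed.

End PosPartDensity.

(** * Signs and quadratic forms of densities *)

Section QuadraticForm.
Context (R : realType) (K : finType).
Implicit Types (M : K -> K -> R) (c e : K -> R).

Definition quad M c := \sum_k c k * \sum_l M k l * c l.

(** Continuity of the quadratic form, with an explicit modulus. *)
Lemma quad_rational M : (forall r : {ffun K -> rat}, 0 <= quad M (fun k => ratr (r k))) ->
  forall c, 0 <= quad M c.
Proof.
move=> hr c; pose B := \sum_k \sum_l `|M k l| * (`|c k| + `|c l| + 1).
have B0 : 0 <= B by apply: sumr_ge0 => k _; apply: sumr_ge0 => l _; rewrite mulr_ge0 ?addr_ge0.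
apply/ler_addgt0Pr => eps e0.
pose dl := Num.min 1 (eps / (B + 1)).
have B1 : 0 < B + 1 by lra.
have d0 : 0 < dl by rewrite lt_min ltr01 divr_gt0.
have d1 : dl <= 1 by rewrite ge_min lexx.
have dB : dl * B <= eps.
  apply: (@le_trans _ _ (eps / (B + 1) * B)).
    by rewrite ler_wpM2r// ge_min lexx orbT.
  rewrite mulrAC ler_pdivrMr// ler_pM2l//; lra.
have [r hr'] : exists r : K -> rat, forall k, c k < ratr (r k) < c k + dl.
  have h k : exists q : rat, c k < ratr q < c k + dl.
    have [q] := @rat_in_itvoo R (c k) (c k + dl) ltac:(lra).
    by rewrite in_itv /= => hq; exists q.
  by have [r hr1] := choice h; exists r.
pose rc k : R := ratr (r k).
have := hr [ffun k => r k].
under [X in quad _ X]eq_fun do rewrite ffunE.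
rewrite -/rc => q0.
have h i : `|rc i - c i| <= dl.
  by have /andP[h1 h2] := hr' i; rewrite /rc ger0_norm; lra.
clearbody rc.
have : `|quad M rc - quad M c| <= dl * B.
  rewrite /quad -sumrB /B mulr_sumr; apply: (le_trans (ler_norm_sum _ _ _)).
  apply: ler_sum => k _; rewrite !mulr_sumr -sumrB.
  apply: (le_trans (ler_norm_sum _ _ _)); apply: ler_sum => l _.
  have -> : rc k * (M k l * rc l) - c k * (M k l * c l) =
    M k l * (rc k * (rc l - c l) + c l * (rc k - c k)) by ring.
  rewrite normrM [leRHS]mulrCA ler_wpM2l//.
  apply: (le_trans (ler_normD _ _)); rewrite !normrM.
  have rk : `|rc k| <= `|c k| + 1.
    have := ler_normD (rc k - c k) (c k); rewrite subrK => h1; have := h k; lra.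
  have h1 : `|rc k| * `|rc l - c l| <= (`|c k| + 1) * dl by apply: ler_pM.
  have h2 : `|c l| * `|rc k - c k| <= `|c l| * dl by rewrite ler_wpM2l.
  lra.
rewrite ler_norml => /andP[_ h3]; lra.
Qed.

End QuadraticForm.

Section AlmostEverywhere.
Context (R : realType) (a b : \bar R) (lam : {sigma_finite_measure set R -> \bar R}).
Local Notation I := (oint a b).
Hypothesis ab : (a < b)%E.
Implicit Types (D : R -> R).

Lemma ae_ge0_of_integrals D : measurable_fun setT D ->
  (forall B, rcborel a b B -> rintegrable lam B D /\ 0 <= \int[lam]_(x in B) D x) ->
  {ae lam, forall x, I x -> 0 <= D x}.
Proof.
move=> mD hD; have [p [q [Ipq pq mono exh]]] := oint_exhaustion ab.
pose C n := `[p n, q n] `&` [set x | D x < 0].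
have mC n : measurable (C n).
  apply: measurableI => //.
  have -> : [set x | D x < 0] = setT `&` D @^-1` `]-oo, 0[.
    by apply/seteqP; split => x /=; rewrite in_itv //= => -[].
  exact: mD.
have ae n : {ae lam, forall x, `[p n, q n]%classic x -> 0 <= D x}.
  have rC : rcborel a b (C n) by apply: (itv_rcborel (Ipq n).1 (Ipq n).2 (mC n)) => x [].
  have [iC C0] := hD _ rC.
  have h : {ae lam, forall x, C n x -> - D x = 0}.
    apply: Rintegral_eq0_ae => //.
    - exact: rintegrableN.
    - by move=> x [_ /= /ltW]; rewrite oppr_ge0.
    - apply/eqP; rewrite eq_le Rintegral_ge0 ?andbT; last by move=> x [_ /= /ltW]; rewrite oppr_ge0.
      by rewrite RintegralN// oppr_le0.
  apply: (filterS _ h) => x hx pqx; rewrite leNgt; apply/negP => Dx.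
  by have := hx (conj pqx Dx); move=> /eqP; rewrite oppr_eq0 => /eqP D0; rewrite D0 ltxx in Dx.
have := ae_foralln ae.
apply: filterS => x hx Ix; have [n /andP[h1 h2]] := exh x Ix.
by apply: (hx n); rewrite /= in_itv /= !ltW.
Qed.

Lemma loc_density_ae_eq (m : loc_charge a b) D E : loc_density lam m D -> loc_density lam m E ->
  {ae lam, forall x, I x -> D x = E x}.
Proof.
move=> [mD hD] [mE hE].
have h1 : {ae lam, forall x, I x -> 0 <= D x - E x}.
  apply: ae_ge0_of_integrals => [|B rB]; first exact: measurable_funB.
  have [iD DE] := hD B rB; have [iE EE] := hE B rB; have mB := rB.1.
  by split; [exact: rintegrableB|rewrite RintegralB// -DE -EE subrr].
have h2 : {ae lam, forall x, I x -> 0 <= E x - D x}.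
  apply: ae_ge0_of_integrals => [|B rB]; first exact: measurable_funB.
  have [iD DE] := hD B rB; have [iE EE] := hE B rB; have mB := rB.1.
  by split; [exact: rintegrableB|rewrite RintegralB// -DE -EE subrr].
apply: (filterS2 _ _ h1 h2) => x k1 k2 Ix; have := k1 Ix; have := k2 Ix; lra.
Qed.

(** Rational vectors suffice, so that only countably many null sets are involved. *)
Lemma psd_density_ae (K : finType) (c : K -> K -> loc_charge a b) (D : K -> K -> R -> R) :
  (forall k l, loc_density lam (c k l) (D k l)) ->
  (forall B, rcborel a b B -> forall v, 0 <= quad (fun k l => c k l B) v) ->
  {ae lam, forall x, I x -> forall v, 0 <= quad (fun k l => D k l x) v}.
Proof.
move=> hD psd.
have one v : {ae lam, forall x, I x -> 0 <= quad (fun k l => D k l x) v}.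
  apply: (ae_ge0_of_integrals (D := fun x => quad (fun k l => D k l x) v)).
    apply: measurable_sum => k; apply: measurable_funM => //; apply: measurable_sum => l.
    by apply: measurable_funM => //; exact: (hD k l).1.
  move=> B rB; have mB := rB.1.
  have i1 k l : rintegrable lam B (fun x => D k l x * v l).
    by under eq_fun do rewrite mulrC; apply: rintegrableZ => //; exact: ((hD k l).2 B rB).1.
  have i2 k : rintegrable lam B (fun x => \sum_l D k l x * v l) by exact: rintegrable_sum.
  have i3 k : rintegrable lam B (fun x => v k * \sum_l D k l x * v l) by exact: rintegrableZ.
  split; first exact: rintegrable_sum.
  rewrite /quad Rintegral_sum//; apply: le_trans (psd B rB v) _; rewrite /quad le_eqVlt.
  apply/orP; left; apply/eqP/eq_bigr => k _;
  rewrite (RintegralZl _ mB (i2 k)); congr (_ * _).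
  rewrite Rintegral_sum//; apply: eq_bigr => l _.
  have [il ->] := (hD k l).2 B rB.
  by rewrite -RintegralZr//.
have h : {ae lam, forall x, forall n, I x -> forall r : {ffun K -> rat}, unpickle n = Some r ->
    0 <= quad (fun k l => D k l x) (fun k => ratr (r k))}.
  apply: ae_foralln => n; case: (unpickle n) => [r|]; last exact: nearW.
  by apply: (filterS _ (one (fun k => ratr (r k)))) => x hx Ix _ [<-]; exact: hx.
apply: (filterS _ h) => x hx Ix; apply: quad_rational => r.
exact: (hx (pickle r) Ix r (pickleK r)).
Qed.

End AlmostEverywhere.

Section CommonDensity.
Context (R : realType) (a b : \bar R).
Local Notation I := (oint a b).

(** A finite family of local charges has densities with respect to one measure, the sum of the
positive and negative parts of its members. *)
Lemma common_density (X : finType) (F : X -> loc_charge a b) : (a < b)%E ->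
  exists lam : {sigma_finite_measure set R -> \bar R},
    forall x, exists D, loc_density lam (F x) D.
Proof.
move=> ab.
pose z0 : loc_charge a b := lcharge_sum (fun i : 'I_0 => match i with Ordinal _ h => F (match notF h with end) end).
pose ms k := match unpickle k./2 with
  | Some x => if odd k then lcharge_opp (F x) else F x | None => z0 end.
pose N := (\max_(x : X) pickle x)%N.*2.+2.
have kN (x : X) : ((pickle x).*2.+1 < N)%N.
  by rewrite ltnS ltnS leq_double; exact: leq_bigmax.
(* Even indices enumerate the charges and odd indices their opposites. *)
exists (dominating ab ms N) => x; apply: loc_density_exists => // B rB B0.
have le0 (m : loc_charge a b) : (pos_part m B <= dominating ab ms N B)%E -> m B <= 0.
  move=> h; have {}h : (pos_part m B <= 0)%E by rewrite -B0.
  by rewrite -lee_fin; apply: le_trans h; exact: le_pos_part.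
have h1 : F x B <= 0.
  apply: le0; have -> : F x = ms (pickle x).*2.
    by rewrite /ms doubleK pickleK odd_double.
  by apply: le_dominating; apply: leq_ltn_trans (kN x).
have h2 : - F x B <= 0.
  apply: (le0 (lcharge_opp (F x))); have -> : lcharge_opp (F x) = ms (pickle x).*2.+1.
    by rewrite /ms /= uphalf_double pickleK odd_double.
  exact: le_dominating.
by apply/eqP; rewrite eq_le h1 -oppr_le0 h2.
Qed.

End CommonDensity.

Local Open Scope complex_scope.
Local Open Scope sesquilinear_scope.
Local Notation Re := complex.Re.
Local Notation Im := complex.Im.

(** * Complex matrices in real coordinates *)

Section Realification.
Context (R : realType) (n : nat).
Local Notation C := R[i].
Local Notation K := ('I_n * bool)%type.
Implicit Types (M N : 'M[C]_n) (u v : 'cV[C]_n) (k l : K).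

Lemma sum_coordinates (V : nmodType) (F : K -> V) :
  \sum_k F k = \sum_i (F (i, false) + F (i, true)).
Proof.
transitivity (\sum_i \sum_e F (i, e)).
  by rewrite pair_bigA; apply: eq_bigr => -[].
by apply: eq_bigr => i _; rewrite big_bool addrC.
Qed.

(** The real coordinates of a complex vector; the boolean selects the imaginary part. *)
Definition coordinates u k : R := if k.2 then Im (u k.1 0) else Re (u k.1 0).

(** The real matrix of the map u |-> M u in these coordinates. *)
Definition realmx M k l : R := match k.2, l.2 with
  | false, true => - Im (M k.1 l.1)
  | true, false => Im (M k.1 l.1)
  | _, _ => Re (M k.1 l.1)
  end.

(** Multiplication by the imaginary unit in real coordinates. It expresses imaginary parts of inner
products by real parts. *)
Definition quarter_turn (c : K -> R) k : R := if k.2 then c (k.1, false) else - c (k.1, true).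

Lemma Re_mul (x y : C) : Re (x * y) = Re x * Re y - Im x * Im y.
Proof. by case: x => ? ?; case: y. Qed.

Lemma Im_mul (x y : C) : Im (x * y) = Re x * Im y + Im x * Re y.
Proof. by case: x => ? ?; case: y. Qed.

Lemma Re_scale (r : R) (x : C) : Re (r%:C * x) = r * Re x.
Proof. by rewrite Re_mul /= mul0r subr0. Qed.

Lemma Im_scale (r : R) (x : C) : Im (r%:C * x) = r * Im x.
Proof. by rewrite Im_mul /= mul0r addr0. Qed.

Lemma Re_conjugate (x : C) : Re x^* = Re x. Proof. by case: x. Qed.
Lemma Im_conjugate (x : C) : Im x^* = - Im x. Proof. by case: x. Qed.

Lemma Re_sum (T : Type) (s : seq T) (F : T -> C) : Re (\sum_(i <- s) F i) = \sum_(i <- s) Re (F i).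
Proof. by elim/big_rec2: _ => // i _ y _ <-; case: (F i) => ? ?; case: y. Qed.

Lemma Im_sum (T : Type) (s : seq T) (F : T -> C) : Im (\sum_(i <- s) F i) = \sum_(i <- s) Im (F i).
Proof. by elim/big_rec2: _ => // i _ y _ <-; case: (F i) => ? ?; case: y. Qed.

Lemma coordinates_mulmx M u k :
  coordinates (M *m u) k = \sum_l realmx M k l * coordinates u l.
Proof.
rewrite sum_coordinates /coordinates /realmx !mxE; case: k => i [] /=.
  by rewrite Im_sum; apply: eq_bigr => j _; rewrite Im_mul /=; ring.
by rewrite Re_sum; apply: eq_bigr => j _; rewrite Re_mul /=; ring.
Qed.

Lemma realmx_mulmx M N k l : realmx (M *m N) k l = \sum_m realmx M k m * realmx N m l.
Proof.
rewrite sum_coordinates /realmx !mxE; case: k => i []; case: l => j [] /=;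
  rewrite ?Im_sum ?Re_sum -?sumrN; apply: eq_bigr => m _; rewrite ?Im_mul ?Re_mul; ring.
Qed.

Lemma realmx1 k l : realmx 1%:M k l = (k == l)%:R.
Proof.
rewrite /realmx !mxE; case: k => i []; case: l => j []; rewrite -pair_eqE /pair_eq /= ?andbT ?andbF;
  by case: (i == j) => //=; rewrite ?oppr0.
Qed.

Lemma realmx_adj M k l : realmx (M^t* ) k l = realmx M l k.
Proof.
rewrite /realmx !mxE; case: k => i []; case: l => j [] /=; rewrite ?Re_conjugate ?Im_conjugate ?opprK //.
Qed.

Lemma realmxN M k l : realmx (- M) k l = - realmx M k l.
Proof.
rewrite /realmx !mxE; case: k => i []; case: l => j [] /=; by case: (M i j).
Qed.

Lemma Re_dot u v : Re ((u^t* *m v) 0 0) = \sum_k coordinates u k * coordinates v k.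
Proof.
rewrite sum_coordinates mxE Re_sum; apply: eq_bigr => i _.
by rewrite !mxE Re_mul Re_conjugate Im_conjugate /coordinates /=; ring.
Qed.

Lemma Im_dot u v : Im ((u^t* *m v) 0 0) =
  \sum_k quarter_turn (coordinates u) k * coordinates v k.
Proof.
rewrite sum_coordinates mxE Im_sum; apply: eq_bigr => i _.
by rewrite !mxE Im_mul Re_conjugate Im_conjugate /quarter_turn /coordinates /=; ring.
Qed.

Lemma Re_form M u : Re ((u^t* *m M *m u) 0 0) = quad (realmx M) (coordinates u).
Proof.
by rewrite -mulmxA Re_dot /quad; apply: eq_bigr => k _; rewrite coordinates_mulmx.
Qed.

Definition of_coordinates (c : K -> R) : 'cV[C]_n := \col_i (c (i, false) +i* c (i, true)).

Lemma of_coordinatesK c k : coordinates (of_coordinates c) k = c k.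
Proof. by rewrite /coordinates !mxE; case: k => i []. Qed.

Lemma coordinatesK u : of_coordinates (coordinates u) = u.
Proof. by apply/colP => i; rewrite !mxE /coordinates /=; case: (u i 0). Qed.

(** A matrix with real quadratic form on complex vectors is Hermitian, by polarization. *)
Lemma psd_hermitian M : (forall v : 'cV[C]_n, 0 <= (v^t* *m M *m v) 0 0) ->
  forall i j, M i j = (M j i)^*.
Proof.
move=> psd i j.
pose f (u v : 'cV[C]_n) := (u^t* *m M *m v) 0 0.
pose e (r : 'I_n) : 'cV[C]_n := \col_s (s == r)%:R.
have fD u v : f (u + v) (u + v) = f u u + f v v + (f u v + f v u).
  have E : (u + v)^t* = u^t* + v^t* by apply/matrixP => ? ?; rewrite !mxE rmorphD.
  by rewrite /f E !mulmxDl !mulmxDr !mxE; ring.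
have fe (c d : C) (r s : 'I_n) : f (c *: e r) (d *: e s) = c^* * d * M r s.
  rewrite /f mxE (bigD1 s)//= big1 => [|m /negbTE ml]; last by rewrite !mxE ml !mulr0.
  rewrite !mxE eqxx mulr1 addr0 (bigD1 r)//= big1 => [|m /negbTE mk].
    by rewrite !mxE eqxx mulr1 addr0; ring.
  by rewrite !mxE mk mulr0 rmorph0 !mul0r.
have im u : Im (f u u) = 0 by have := psd u; rewrite lecE => /andP[/eqP].
have key u v : Im (f u v + f v u) = 0.
  have := im (u + v); rewrite fD 2!raddfD /= !im !add0r.
  by [].
have h1 := key (1 *: e i) (1 *: e j); have h2 := key (1 *: e i) ('i *: e j).
move: h1 h2; rewrite !fe.
case: (M i j) => x y; case: (M j i) => x' y' /=.
move=> h1 h2; have -> : x = x' by lra.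
by have -> : y = - y' by lra.
Qed.

End Realification.

Section LocDensity.
Context (R : realType) (a b : \bar R) (lam : {sigma_finite_measure set R -> \bar R}).
Implicit Types (m : loc_charge a b) (D : R -> R).

Lemma loc_density_ext m m' D : (forall B, rcborel a b B -> m B = m' B) ->
  loc_density lam m D -> loc_density lam m' D.
Proof.
by move=> mm [mD hD]; split => // B rB; have [iD <-] := hD B rB; rewrite mm.
Qed.

Lemma loc_density_mean m D E : loc_density lam m D -> loc_density lam m E ->
  loc_density lam m (fun x => 2^-1 * (D x + E x)).
Proof.
move=> [mD hD] [mE hE]; split; first by apply: measurable_funM => //; exact: measurable_funD.
move=> B rB; have mB := rB.1; have [iD DE] := hD B rB; have [iE EE] := hE B rB.
have iS : rintegrable lam B (fun x => D x + E x) by exact: rintegrableD.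
split; first exact: rintegrableZ.
by rewrite RintegralZl// RintegralD// -DE -EE; field.
Qed.

End LocDensity.

Section MatrixDensities.
Context (R : realType) (a b : \bar R) (n : nat).
Local Notation I := (oint a b).
Local Notation C := R[i].
Local Notation K := ('I_n * bool)%type.
Implicit Types (q w : 'M[dist0 a b]_n).

Definition value w (B : set R) : 'M[C]_n := \matrix_(i, j) w i j B.

Lemma nonneg_hermitian w : dist0_nonneg w -> dist0_hermitian w.
Proof.
move=> nn i j B rB; have := psd_hermitian (fun z => nn B rB z) i j.
by rewrite !mxE.
Qed.

Lemma value_adj w B : dist0_hermitian w -> rcborel a b B -> (value w B)^t* = value w B.
Proof. by move=> hw rB; apply/matrixP => i j; rewrite !mxE; exact/esym/hw. Qed.

Lemma value_psd w B : dist0_nonneg w -> rcborel a b B ->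
  forall c, 0 <= quad (realmx (value w B)) c.
Proof.
move=> nn rB c; have := nn B rB (of_coordinates c).
rewrite lecE => /andP[_]; rewrite Re_form /quad /=.
by under eq_bigr do (rewrite of_coordinatesK; under eq_bigr do rewrite of_coordinatesK).
Qed.

(** A positive semidefinite matrix with zero trace is zero. *)
Lemma trace_dominates w i j B : dist0_nonneg w -> rcborel a b B ->
  trace_measure w B = 0%E -> w i j B = 0.
Proof.
move=> nn rB B0; pose W k l (_ : unit) := realmx (value w B) k l.
have Wsym k l x : W k l x = W l k x.
  by rewrite /W -realmx_adj value_adj//; exact: nonneg_hermitian.
have Wpsd x c : 0 <= \sum_k c k * \sum_l W k l x * c l by exact: value_psd.
have d0 k : 0 <= W k k tt.
  by have := Wpsd tt (fun l => (l == k)%:R); rewrite -[X in _ <= X]/(wpair W (fun l _ => (l == k)%:R) (fun l _ => (l == k)%:R) tt) wpair_delta weighted_delta.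
have dii l : W (l, false) (l, false) tt = 0.
  have tr : \sum_l W (l, false) (l, false) tt <= 0.
    rewrite -lee_fin -[X in (_ <= X)%E]/(0%E) -B0 /trace_measure.
    have := @le_pos_part _ _ _ (lcharge_sum (fun i => Re_charge (w i i))) B B rB (fun x h => h).
    by congr (_ <= _)%E; congr EFin; apply: eq_bigr => r _; rewrite /W /realmx /= mxE.
  apply/eqP; rewrite eq_le d0 andbT; apply: le_trans tr.
  by rewrite (bigD1 l)//= lerDl sumr_ge0.
have W0 k r e : W k (r, e) tt = 0.
  have dd : W (r, e) (r, e) tt = 0 by case: e; [exact: dii r|exact: dii r].
  have pz : wpair W (fun l _ => (l == (r, e))%:R) (fun l _ => (l == (r, e))%:R) tt = 0.
    by rewrite wpair_delta weighted_delta.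
  have := weighted_eq0 Wsym Wpsd pz k.
  rewrite /weighted (bigD1 (r, e))//= eqxx mulr1 big1 ?addr0// => l /negbTE ->.
  by rewrite mulr0.
have := W0 (i, false) j false; have := W0 (i, true) j false.
by rewrite /W /realmx /= mxE; case: (w i j B) => x y /= -> ->.
Qed.

(** By Radon-Nikodym, since the trace of a non-negative w dominates its entries. *)
Lemma density_exists w : (a < b)%E -> dist0_nonneg w -> is_density w (density w).
Proof.
move=> ab nn; pose tr := lcharge_sum (fun i => Re_charge (w i i)).
pose lam : {sigma_finite_measure set R -> \bar R} := dominating ab (fun=> tr) 1.
have lamE A : lam A = trace_measure w A by rewrite /lam /= /dominating /msum big_ord1.
have ex (m : 'I_n -> 'I_n -> loc_charge a b) :
    (forall i j B, rcborel a b B -> trace_measure w B = 0%E -> m i j B = 0) ->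
    exists D : 'I_n -> 'I_n -> R -> R, forall i j, loc_density lam (m i j) (D i j).
  move=> h; have /choice[D hD] : forall ij : 'I_n * 'I_n, exists D, loc_density lam (m ij.1 ij.2) D.
    by move=> [i j]; apply: loc_density_exists => // B rB; rewrite lamE; exact: h.
  by exists (fun i j => D (i, j)) => i j; exact: (hD (i, j)).
have [D hD] := ex (fun i j => Re_charge (w i j)) (fun i j B rB B0 =>
  ltac:(by rewrite /= (trace_dominates _ _ nn rB B0))).
have [E hE] := ex (fun i j => Im_charge (w i j)) (fun i j B rB B0 =>
  ltac:(by rewrite /= (trace_dominates _ _ nn rB B0))).
have tr_lam (f : R -> R) B : measurable B -> rintegrable lam B f ->
    rintegrable (trace_measure w) B f /\
    \int[trace_measure w]_(x in B) f x = \int[lam]_(x in B) f x.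
  move=> mB i; have mf := rintegrable_measurable i.
  have nuE A : measurable A -> A `<=` B -> trace_measure w A = (\int[lam]_(x in A) (1 : R)%:E)%E.
    by move=> mA _; rewrite integral_cst// mul1e -lamE.
  have th0 (x : R) : 0 <= (1 : R) by [].
  split.
    apply/(rintegrable_change_of_measure mB _ th0 nuE mf) => //.
    by under eq_fun do rewrite mulr1.
  rewrite (change_of_measure mB _ th0 nuE mf)//.
  by apply: eq_Rintegral => x _; rewrite mulr1.
suff h : is_density w (fun x => \matrix_(i, j) (D i j x +i* E i j x)).
  by rewrite /density; apply: (@xgetPex _ (fun=> 0) [set wt | is_density w wt]); eexists; exact: h.
move=> i j; split.
- have -> : (fun x => Re ((\matrix_(i, j) (D i j x +i* E i j x)) i j)) = D i j.
    by apply/funext => x; rewrite mxE.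
  exact: measurable_funTS (hD i j).1.
- have -> : (fun x => Im ((\matrix_(i, j) (D i j x +i* E i j x)) i j)) = E i j.
    by apply/funext => x; rewrite mxE.
  exact: measurable_funTS (hE i j).1.
move=> B rB; have mB := rB.1.
have [iD DE] := (hD i j).2 B rB; have [iE EE] := (hE i j).2 B rB.
have [jD DE'] := tr_lam _ _ mB iD; have [jE EE'] := tr_lam _ _ mB iE.
split.
- by under eq_fun do rewrite mxE.
- by under eq_fun do rewrite mxE.
- transitivity ((\int[trace_measure w]_(x in B) D i j x) +i* (\int[trace_measure w]_(x in B) E i j x)).
    by rewrite DE' EE' -DE -EE /=; case: (w i j B).
  by rewrite /Cintegral; congr (_ +i* _); apply: eq_Rintegral => x _; rewrite mxE.
Qed.

End MatrixDensities.

(** * Densities with respect to one measure *)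

Section CommonDensities.
Context (R : realType) (a b : \bar R) (n : nat).
Local Notation I := (oint a b).
Local Notation C := R[i].
Local Notation K := ('I_n * bool)%type.
Implicit Types (q w : 'M[dist0 a b]_n) (lam : {sigma_finite_measure set R -> \bar R}).

Lemma loc_density_ae lam (m : loc_charge a b) D E : loc_density lam m D ->
  measurable_fun setT E -> {ae lam, forall x, I x -> E x = D x} -> loc_density lam m E.
Proof.
move=> [mD hD] mE DE; split => // B rB; have mB := rB.1; have [iD mDE] := hD B rB.
have [_ [L [_ LI BL]]] := rB.
have {}DE : {ae lam, forall x, B x -> D x = E x}.
  by apply: (filterS _ DE) => x h Bx; rewrite h//; exact/LI/BL.
have mD' := measurable_funTS mD : measurable_fun B D.
have mE' := measurable_funTS mE : measurable_fun B E.
split; first exact: (ae_rintegrable mB mD' mE' DE).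
by rewrite mDE; exact: ae_eq_Rintegral.
Qed.

(** The coefficients q and w and the trace of w expressed by densities with respect to one
measure, corrected on a null set so that the symmetries hold at every point. *)
Record common_densities q w lam (t : R -> R) (Q W : R -> 'M[C]_n) : Prop := CommonDensities {
  cd_t : measurable_fun setT t;
  cd_t0 : forall x, 0 <= t x;
  cd_trace : forall A, measurable A -> A `<=` I ->
    trace_measure w A = (\int[lam]_(x in A) (t x)%:E)%E;
  cd_QRe : forall i j, loc_density lam (Re_charge (q i j)) (fun x => Re (Q x i j));
  cd_QIm : forall i j, loc_density lam (Im_charge (q i j)) (fun x => Im (Q x i j));
  cd_Qadj : forall x, (Q x)^t* = Q x;
  cd_WRe : forall i j, loc_density lam (Re_charge (w i j)) (fun x => Re (W x i j));
  cd_WIm : forall i j, loc_density lam (Im_charge (w i j)) (fun x => Im (W x i j));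
  cd_Wadj : forall x, (W x)^t* = W x;
  cd_Wpsd : forall x c, 0 <= quad (realmx (W x)) c;
  cd_Wae : {ae lam, forall x, I x -> W x = (t x)%:C *: density w x} }.

(** Every symmetry of q and w at the level of charges holds for the densities almost everywhere.
For q it is restored everywhere by averaging; for w, whose density is already determined by the
inner product, the exceptional null set is removed. *)
Lemma common_densities_exist q w : (a < b)%E -> dist0_hermitian q -> dist0_nonneg w ->
  exists lam t Q W, common_densities q w lam t Q W.
Proof.
move=> ab hq nn; have mI := oint_measurable a b.
have dw := density_exists ab nn; have hw := nonneg_hermitian nn.
pose tr := lcharge_sum (fun i => Re_charge (w i i)).
pose F (x : option ('I_n * 'I_n * bool)) := match x with
  | None => tr | Some (i, j, true) => Im_charge (q i j) | Some (i, j, false) => Re_charge (q i j) end.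
have [lam hlam] := common_density F ab; have [D hD] := choice hlam.
pose t x := Num.max (D None x) 0.
have t0 x : 0 <= t x by rewrite le_max lexx orbT.
have mt : measurable_fun setT t by apply: measurable_maxr => //; exact: (hD None).1.
have trE A : measurable A -> A `<=` I -> trace_measure w A = (\int[lam]_(x in A) (t x)%:E)%E.
  by move=> mA AI; exact: (pos_part_density ab (hD None)).
pose DR i j := D (Some (i, j, false)); pose DI i j := D (Some (i, j, true)).
pose Q x : 'M[C]_n := \matrix_(i, j)
  ((2^-1 * (DR i j x + DR j i x)) +i* (2^-1 * (DI i j x + - DI j i x))).
pose P i j := (fun x => Re (density w x i j) * t x) \_ I.
pose S i j := (fun x => Im (density w x i j) * t x) \_ I.
have p0 : point = 0 :> R by [].
have dens (m : loc_charge a b) (f : R -> R) : measurable_fun I f ->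
    (forall B, rcborel a b B -> rintegrable (trace_measure w) B f /\
      m B = \int[trace_measure w]_(x in B) f x) -> loc_density lam m ((fun x => f x * t x) \_ I).
  move=> mf hf; split.
    apply/(measurable_restrictT _ mI); apply: measurable_funM => //; exact: measurable_funTS.
  move=> B rB; have mB := rB.1; have [_ [L [_ LI BL]]] := rB.
  have BI : B `<=` I by move=> x /BL /LI.
  have E : {in B, (fun x => f x * t x) =1 (fun x => f x * t x) \_ I}.
    by move=> x /set_mem Bx; rewrite patchE mem_set//; exact: BI.
  have mfB : measurable_fun B f by exact: measurable_funS mf.
  have mtB : measurable_fun B t by exact: measurable_funTS.
  have trB A : measurable A -> A `<=` B -> trace_measure w A = (\int[lam]_(x in A) (t x)%:E)%E.
    by move=> mA AB; apply: trE => // x /AB /BI.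
  have [i mBE] := hf B rB; split.
    apply: (eq_rintegrable mB E); exact/(rintegrable_change_of_measure mB mtB t0 trB mfB).
  by rewrite mBE (change_of_measure mB mtB t0 trB mfB); apply: eq_Rintegral => x /E.
have hP i j : loc_density lam (Re_charge (w i j)) (P i j).
  have [mR _ h] := dw i j; apply: dens => // B rB; have [iR iI E] := h B rB; split => //.
  by rewrite /Re_charge /= E.
have hS i j : loc_density lam (Im_charge (w i j)) (S i j).
  have [_ mR h] := dw i j; apply: dens => // B rB; have [iR iI E] := h B rB; split => //.
  by rewrite /Im_charge /= E.
have hP' i j : loc_density lam (Re_charge (w i j)) (P j i).
  by apply: loc_density_ext (hP j i) => B rB; rewrite /= (hw i j)// Re_conjugate.
have hS' i j : loc_density lam (Im_charge (w i j)) (fun x => - S j i x).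
  by apply: loc_density_ext (loc_densityN (hS j i)) => B rB; rewrite /= (hw i j)// Im_conjugate.
pose V x : 'M[C]_n := \matrix_(i, j) (P i j x +i* S i j x).
have adjV : {ae lam, forall x, I x -> (V x)^t* = V x}.
  have h1 : {ae lam, forall x, forall ij : 'I_n * 'I_n, I x -> P ij.1 ij.2 x = P ij.2 ij.1 x}.
    by apply: filter_forall => -[i j]; exact: (loc_density_ae_eq ab (hP i j) (hP' i j)).
  have h2 : {ae lam, forall x, forall ij : 'I_n * 'I_n, I x -> S ij.1 ij.2 x = - S ij.2 ij.1 x}.
    by apply: filter_forall => -[i j]; exact: (loc_density_ae_eq ab (hS i j) (hS' i j)).
  apply: (filterS2 _ _ h1 h2) => x k1 k2 Ix; apply/matrixP => i j; rewrite !mxE.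
  by rewrite (k1 (i, j) Ix) (k2 (i, j) Ix).
pose rc k l : loc_charge a b := match k.2, l.2 with
  | false, true => lcharge_opp (Im_charge (w k.1 l.1))
  | true, false => Im_charge (w k.1 l.1)
  | _, _ => Re_charge (w k.1 l.1) end.
have psdV : {ae lam, forall x, I x -> forall c, 0 <= quad (realmx (V x)) c}.
  apply: (psd_density_ae ab (c := rc) (D := fun k l x => realmx (V x) k l)).
    move=> [i e] [j e']; rewrite /rc /realmx /=.
    case: e; case: e'.
    - by under [X in loc_density _ _ X]eq_fun do rewrite mxE; exact: hP.
    - by under [X in loc_density _ _ X]eq_fun do rewrite mxE; exact: hS.
    - by under [X in loc_density _ _ X]eq_fun do rewrite mxE; exact: loc_densityN.
    - by under [X in loc_density _ _ X]eq_fun do rewrite mxE; exact: hP.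
  move=> B rB c; have := value_psd nn rB c; congr (_ <= _).
  rewrite /quad; apply: eq_bigr => -[i e] _; congr (_ * _); apply: eq_bigr => -[j e'] _.
  by congr (_ * _); rewrite /rc /realmx /value /= !mxE; case: e; case: e'.
have good : {ae lam, forall x, (V x)^t* = V x /\ forall c, 0 <= quad (realmx (V x)) c}.
  apply: (filterS2 _ _ adjV psdV) => x k1 k2; have [Ix|nI] := pselect (I x).
    by split; [exact: k1|exact: k2].
  have V0 : V x = 0.
    by apply/matrixP => i j; rewrite !mxE /P /S !patchE memNset.
  rewrite V0; split; first by apply/matrixP => i j; rewrite !mxE rmorph0.
  by move=> c; rewrite /quad big1// => k _; rewrite big1 ?mulr0// => l _; rewrite /realmx !mxE /= oppr0; case: k.2; case: l.2; rewrite mul0r.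
have [A [mA A0 Agood]] := good.
pose W x : 'M[C]_n := if x \in A then 0 else V x.
have WV : {ae lam, forall x, W x = V x}.
  by exists A; split => // x /= h; apply: contrapT => nA; apply: h; rewrite /W memNset.
have mW (f : R -> R) : measurable_fun setT f ->
    measurable_fun setT (fun x => if x \in A then 0 else f x).
  move=> mf; have -> : (fun x => if x \in A then 0 else f x) = f \_ (~` A).
    by apply/funext => x; rewrite patchE in_setC; case: (x \in A).
  by apply/(measurable_restrictT _ (measurableC mA)); exact: measurable_funTS.
exists lam, t, Q, W; split => //.
- move=> i j; under [X in loc_density _ _ X]eq_fun do rewrite mxE /=.
  apply: loc_density_mean; first exact: hD.
  by apply: (loc_density_ext _ (hD (Some (j, i, false)))) => B rB; rewrite /= (hq i j)// Re_conjugate.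
- move=> i j; under [X in loc_density _ _ X]eq_fun do rewrite mxE /=.
  apply: loc_density_mean; first exact: hD.
  by apply: (loc_density_ext _ (loc_densityN (hD (Some (j, i, true))))) => B rB; rewrite /= (hq i j)// Im_conjugate.
- move=> x; apply/matrixP => i j; rewrite !mxE; congr (_ +i* _); first by rewrite addrC.
  by rewrite -mulrN opprD opprK addrC.
- move=> i j; apply: (loc_density_ae (hP i j)).
    have -> : (fun x => Re (W x i j)) = (fun x => if x \in A then 0 else P i j x).
      by apply/funext => x; rewrite /W; case: ifP => _; rewrite mxE.
    exact: mW (hP i j).1.
  by apply: (filterS _ WV) => x -> _; rewrite mxE.
- move=> i j; apply: (loc_density_ae (hS i j)).
    have -> : (fun x => Im (W x i j)) = (fun x => if x \in A then 0 else S i j x).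
      by apply/funext => x; rewrite /W; case: ifP => _; rewrite mxE.
    exact: mW (hS i j).1.
  by apply: (filterS _ WV) => x -> _; rewrite mxE.
- move=> x; rewrite /W; case: ifPn => [_|xA]; first by apply/matrixP => i j; rewrite !mxE rmorph0.
  by apply: contrapT => h; move/negP: xA; apply; apply/mem_set/Agood => -[].
- move=> x c; rewrite /W; case: ifPn => [_|xA]; last first.
    by apply: contrapT => h; move/negP: xA; apply; apply/mem_set/Agood => -[].
  by rewrite /quad big1// => k _; rewrite big1 ?mulr0// => l _; rewrite /realmx !mxE /= oppr0; case: k.2; case: l.2; rewrite mul0r.
- apply: (filterS _ WV) => x -> Ix; apply/matrixP => i j; rewrite !mxE /P /S !patchE mem_set//.
  by case: (density w x i j) => r s; apply/eqP; rewrite eq_complex /=; apply/andP; split; apply/eqP; ring.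
Qed.

End CommonDensities.

(** * The equation in coordinates *)

Section LocalFunctions.
Context (R : realType) (a b : \bar R).
Local Notation I := (oint a b).
Local Notation leb := (@lebesgue_measure R).
Local Notation test := (@test_fun R a b).

Lemma open_oint : open I.
Proof.
rewrite openE => x Ix; have [e e0 [Im Ip]] := oint_open Ix.
apply/nbhs_ballP; exists e => //= y; rewrite /ball /= => xy.
apply: (oint_conv Im Ip); move: xy; rewrite ltr_norml => /andP[h1 h2].
by apply/andP; split; lra.
Qed.

Lemma test_fun_measurable phi : test phi -> measurable_fun I phi.
Proof.
move=> hphi; apply: open_continuous_measurable_fun; first exact: open_oint.
by move=> x /set_mem Ix; exact: (test_fun_continuous hphi Ix).
Qed.

Lemma test_fun_mul_rintegrable (lam : {sigma_finite_measure set R -> \bar R}) phi h :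
  I !=set0 -> test phi -> loc_rintegrable lam I h -> rintegrable lam I (fun x => phi x * h x).
Proof.
move=> I0 hphi ih; have [s [t [Is It st phi0 _]]] := test_fun_support I0 hphi.
have [ii _] := test_fun_FTC hphi Is It (ltW st).
have stI : `[s, t] `<=` I by move=> x; rewrite /= in_itv /=; exact: oint_conv.
have phis : phi s = 0 by apply: phi0 => //; rewrite ltxx.
pose M := \int[leb]_(x in `[s, t]) `|derive1 phi x|.
have bd x : `[s, t]%classic x -> `|phi x| <= M.
  rewrite /= in_itv /= => /andP[sx xt]; have Ix : I x by apply: (oint_conv Is It); rewrite sx.
  have [ix Fx] := test_fun_FTC hphi Is Ix sx.
  rewrite -[phi x]subr0 -phis -Fx.
  have sub : `]s, x[ `<=` `[s, t].
    by move=> y; rewrite /= !in_itv /= => /andP[h1 h2]; rewrite (ltW h1) (le_trans (ltW h2) xt).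
  apply: (@le_trans _ _ (\int[leb]_(y in `]s, x[) `|derive1 phi y|)).
    by apply: le_normr_Rintegral => //; exact: rintegrableS ii.
  apply: Rintegral_restrict_ge0 => //.
  exact: rintegrable_norm.
have h1 : rintegrable lam (`[s, t]) (fun x => phi x * h x).
  apply: (rintegrable_bndl (M := M)) => //; last exact: ih.
  by apply: measurable_funS (test_fun_measurable hphi) => //; exact: oint_measurable.
have mI := oint_measurable a b.
have h2 : rintegrable lam (I `&` `[s, t]) (fun x => phi x * h x) by rewrite (setIidr stI).
move: h2; rewrite rintegrable_restrict//.
apply: eq_rintegrable => // x /set_mem Ix.
rewrite patchE; case: ifPn => // /negP; rewrite inE /= in_itv /= => xst.
by rewrite phi0 ?mul0r// => /andP[k1 k2]; apply: xst; rewrite !ltW.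
Qed.

Lemma loc_bv_measurable g : (a < b)%E -> @loc_bv R a b g -> measurable_fun I g.
Proof.
move=> ab bv; have [p [q [Ipq pq mono exh]]] := oint_exhaustion ab.
have IE : I = \bigcup_n `[p n, q n]%classic.
  apply/seteqP; split => [x Ix|x [n _]]; last first.
    by rewrite /= in_itv /=; exact: (oint_conv (Ipq n).1 (Ipq n).2).
  by have [n /andP[h1 h2]] := exh x Ix; exists n => //; rewrite /= in_itv /= !ltW.
rewrite IE; apply/measurable_fun_bigcup => // n; apply: bounded_variation_measurable.
by apply: bv => x; rewrite /= in_itv /=; exact: (oint_conv (Ipq n).1 (Ipq n).2).
Qed.

Lemma loc_bv_bounded g s t : @loc_bv R a b g -> I s -> I t ->
  exists M, forall x, s <= x <= t -> `|g x| <= M.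
Proof.
move=> bv Is It; apply: bounded_variation_bounded; apply: bv => x.
by rewrite /= in_itv /=; exact: oint_conv.
Qed.

End LocalFunctions.

Section Coordinates.
Context (R : realType) (a b : \bar R) (n : nat).
Local Notation I := (oint a b).
Local Notation C := R[i].
Local Notation K := ('I_n * bool)%type.
Implicit Types (u v f g : R -> 'cV[C]_n) (k l : K).

(** Values outside of the interval are irrelevant; 0 makes these functions measurable on the
whole line. *)
Definition components u k : R -> R := (fun x => coordinates (u x) k) \_ I.

Lemma componentsE u k x : I x -> components u k x = coordinates (u x) k.
Proof. by move=> Ix; rewrite /components patchE mem_set. Qed.

Lemma coordinates_measurable u k : @vmeasurable R a b n u ->
  measurable_fun I (fun x => coordinates (u x) k).
Proof. by case: k => i [] /(_ i)[h1 h2]; rewrite /coordinates /=. Qed.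

Lemma vmeasurable_coordinates u : (forall k, measurable_fun I (fun x => coordinates (u x) k)) ->
  @vmeasurable R a b n u.
Proof. by move=> h i; split; [exact: (h (i, false))|exact: (h (i, true))]. Qed.

Lemma components_measurable u k : @vmeasurable R a b n u -> measurable_fun setT (components u k).
Proof.
move=> mu; apply/(measurable_restrictT _ (oint_measurable a b)).
exact: coordinates_measurable.
Qed.

Lemma balanced_loc_bv_coordinates u : @balanced_loc_bv R a b n u <->
  forall k, @loc_bv R a b (fun x => coordinates (u x) k) /\
    @balanced R a b (fun x => coordinates (u x) k).
Proof.
split=> [h [i []]|h i]; first by have [_ _ h1 h2] := h i.
  by have [h1 h2 _ _] := h i.
have [h1 h2] := h (i, false); have [h3 h4] := h (i, true).
by split.
Qed.

Lemma ddistr_coordinates u phi k : coordinates (@ddistr R a b n u phi) k =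
  - \int[lebesgue_measure]_(x in I) (derive1 phi x * coordinates (u x) k).
Proof.
rewrite /coordinates /ddistr !mxE /Cintegral; case: k => i [] /=; congr (- _);
  by apply: eq_Rintegral => x _; rewrite ?Re_scale ?Im_scale.
Qed.

End Coordinates.

Section Bridge.
Context (R : realType) (a b : \bar R) (n : nat).
Local Notation I := (oint a b).
Local Notation C := R[i].
Local Notation K := ('I_n * bool)%type.
Variables (J : 'M[C]_n) (q w : 'M[dist0 a b]_n).
Variables (lam : {sigma_finite_measure set R -> \bar R}) (t : R -> R) (Q W : R -> 'M[C]_n).
Hypotheses (ab : (a < b)%E) (nn : dist0_nonneg w) (H : common_densities q w lam t Q W).
Hypotheses (Junit : J \in unitmx) (Jadj : J^t* = - J).
Implicit Types (u v f g : R -> 'cV[C]_n) (k l : K).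

Definition Jr := realmx J.
Definition Jri := realmx (invmx J).
Definition Qr k l x := realmx (Q x) k l.
Definition Wr k l x := realmx (W x) k l.
Local Notation comp u := (components a b u).
Local Notation lint := (loc_rintegrable lam I).
Let mI := oint_measurable a b.
Let I0 : I !=set0 := oint_nonempty ab.

Lemma Jr_skew k l : Jr k l = - Jr l k.
Proof. by rewrite /Jr -realmxN -Jadj realmx_adj. Qed.
Lemma Jr_Jri k m : \sum_l Jr k l * Jri l m = (k == m)%:R.
Proof. by rewrite -realmx_mulmx mulmxV// realmx1. Qed.
Lemma Jri_Jr k m : \sum_l Jri k l * Jr l m = (k == m)%:R.
Proof. by rewrite -realmx_mulmx mulVmx// realmx1. Qed.
Lemma Qr_sym k l x : Qr k l x = Qr l k x.
Proof. by rewrite /Qr -{1}(cd_Qadj H) realmx_adj. Qed.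
Lemma Wr_sym k l x : Wr k l x = Wr l k x.
Proof. by rewrite /Wr -{1}(cd_Wadj H) realmx_adj. Qed.
Lemma Wr_psd x (c : K -> R) : 0 <= \sum_k c k * \sum_l Wr k l x * c l.
Proof. exact: (cd_Wpsd H x c). Qed.

Let realmx_dens (M : R -> 'M[C]_n) (m1 m2 : 'I_n -> 'I_n -> loc_charge a b) :
  (forall i j, loc_density lam (m1 i j) (fun x => Re (M x i j))) ->
  (forall i j, loc_density lam (m2 i j) (fun x => Im (M x i j))) -> forall k l,
  measurable_fun setT (fun x => realmx (M x) k l) /\ lint (fun x => realmx (M x) k l).
Proof.
move=> h1 h2 k l; have [m hm] : exists m, @loc_density R a b lam m (fun x => realmx (M x) k l).
  rewrite /realmx; case: k => i []; case: l => j [] /=; try by exists (m1 i j).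
    by exists (m2 i j).
  by exists (lcharge_opp (m2 i j)); exact: loc_densityN.
split; first exact: hm.1.
by move=> s r Is Ir; apply: (hm.2 _ _).1; exact: (itv_rcborel Is Ir).
Qed.

Lemma Qr_measurable k l : measurable_fun setT (Qr k l).
Proof. exact: (realmx_dens (cd_QRe H) (cd_QIm H) k l).1. Qed.
Lemma Qr_rintegrable k l : lint (Qr k l).
Proof. exact: (realmx_dens (cd_QRe H) (cd_QIm H) k l).2. Qed.
Lemma Wr_measurable k l : measurable_fun setT (Wr k l).
Proof. exact: (realmx_dens (cd_WRe H) (cd_WIm H) k l).1. Qed.
Lemma Wr_rintegrable k l : lint (Wr k l).
Proof. exact: (realmx_dens (cd_WRe H) (cd_WIm H) k l).2. Qed.

Let Wae : {ae lam, forall x, I x -> forall k l, Wr k l x = realmx (density w x) k l * t x}.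
Proof.
apply: (filterS _ (cd_Wae H)) => x h Ix k l; rewrite /Wr h// /realmx !mxE.
by case: k => i []; case: l => j []; rewrite /= ?Re_scale ?Im_scale; ring.
Qed.

Let dens_measurable k l : measurable_fun I (fun x => realmx (density w x) k l).
Proof.
have dw := density_exists ab nn; rewrite /realmx.
case: k => i []; case: l => j [] /=; have [h1 h2 _] := dw i j => //.
exact: measurableT_comp.
Qed.

Let trace_integral (g h : R -> R) : measurable_fun I g -> measurable_fun I h ->
  {ae lam, forall x, I x -> g x * t x = h x} ->
  (\int[trace_measure w]_(x in I) (g x)%:E = \int[lam]_(x in I) (h x)%:E)%E.
Proof.
move=> mg mh gh; have mt := measurable_funTS (cd_t H) : measurable_fun I t.
rewrite (integral_change_of_measure mI mt (cd_t0 H) (fun A mA AI => cd_trace H mA AI) mg).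
apply: ae_eq_integral => //.
- by apply/measurable_EFinP; exact: measurable_funM.
- exact/measurable_EFinP.
- by apply: (filterS _ gh) => x hx Ix /=; rewrite hx.
Qed.

Let form M (c d : K -> R) := \sum_k c k * \sum_l realmx M k l * d l.

Let wpair_trace u v : @vmeasurable R a b n u -> @vmeasurable R a b n v ->
  (\int[trace_measure w]_(x in I) (form (density w x) (coordinates (u x)) (coordinates (v x)))%:E
   = \int[lam]_(x in I) (wpair Wr (comp u) (comp v) x)%:E)%E.
Proof.
move=> mu mv; apply: trace_integral.
- apply: measurable_sum => k; apply: measurable_funM; first exact: coordinates_measurable.
  apply: measurable_sum => l; apply: measurable_funM; last exact: coordinates_measurable.
  exact: dens_measurable.
- apply: measurable_funTS; apply: (wpair_measurable Wr_measurable) => k; exact: components_measurable.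
- apply: (filterS _ Wae) => x h Ix; rewrite /form mulr_suml; apply: eq_bigr => k _.
  rewrite componentsE// -mulrA mulr_suml; congr (_ * _); apply: eq_bigr => l _.
  by rewrite componentsE// h//; ring.
Qed.

Lemma sqnormE f : @vmeasurable R a b n f ->
  (sqnorm w f = \int[lam]_(x in I) (wpair Wr (comp f) (comp f) x)%:E)%E.
Proof.
by move=> mf; rewrite -wpair_trace//; apply: eq_integral => x _; rewrite Re_form.
Qed.

Definition turn u x := (0 +i* 1 : C) *: u x.

Lemma coordinates_turn u x : coordinates (turn u x) = quarter_turn (coordinates (u x)).
Proof.
apply/funext => -[i e]; rewrite /coordinates /quarter_turn /turn /= !mxE.
have hI (z : C) : Im ((0 +i* 1) * z) = Re z by rewrite Im_mul /= mul0r add0r mul1r.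
have hR (z : C) : Re ((0 +i* 1) * z) = - Im z by rewrite Re_mul /= mul0r sub0r mul1r.
by case: e; rewrite ?hI ?hR.
Qed.

Lemma turn_vmeasurable u : @vmeasurable R a b n u -> @vmeasurable R a b n (turn u).
Proof.
move=> mu; apply: vmeasurable_coordinates => k.
under eq_fun do rewrite coordinates_turn.
case: k => i []; rewrite /quarter_turn /=; first exact: coordinates_measurable.
by apply: measurableT_comp => //; exact: coordinates_measurable.
Qed.

(** The imaginary part of the inner product is the real part of the one with a turned argument. *)
Lemma innerE u v : @vmeasurable R a b n u -> @vmeasurable R a b n v -> inner w u v =
  (\int[lam]_(x in I) wpair Wr (comp u) (comp v) x) +i*
  (\int[lam]_(x in I) wpair Wr (comp (turn u)) (comp v) x).
Proof.
move=> mu mv; rewrite /inner /Cintegral /Rintegral -!wpair_trace//; last exact: turn_vmeasurable.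
congr (_ +i* _); congr fine; apply: eq_integral => x _; congr EFin.
  by rewrite -mulmxA Re_dot; apply: eq_bigr => k _; rewrite coordinates_mulmx.
by rewrite -mulmxA Im_dot coordinates_turn; apply: eq_bigr => k _; rewrite coordinates_mulmx.
Qed.

Lemma wdistr_coordinates f phi k : @test_fun R a b phi -> @vmeasurable R a b n f ->
  coordinates (wdistr w f phi) k =
  \int[lam]_(x in I) (phi x * weighted Wr (comp f) k x).
Proof.
move=> hphi mf.
have -> : coordinates (wdistr w f phi) k = \int[trace_measure w]_(x in I)
    (phi x * \sum_l realmx (density w x) k l * coordinates (f x) l).
  under eq_Rintegral do rewrite -coordinates_mulmx.
  rewrite /coordinates /wdistr !mxE /Cintegral; case: k => i [] /=;
    by apply: eq_Rintegral => x _; rewrite ?Re_scale ?Im_scale.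
rewrite /Rintegral; congr fine; apply: trace_integral.
- apply: measurable_funM; first exact: test_fun_measurable.
  apply: measurable_sum => l; apply: measurable_funM; last exact: coordinates_measurable.
  exact: dens_measurable.
- apply: measurable_funM; first exact: test_fun_measurable.
  apply: measurable_funTS; apply: weighted_measurable => l; last exact: components_measurable.
  exact: Wr_measurable.
- apply: (filterS _ Wae) => x h Ix; rewrite -mulrA mulr_suml; congr (_ * _).
  by apply: eq_bigr => l _; rewrite componentsE// h//; ring.
Qed.

End Bridge.

(** * Distributional solutions and solutions on cuts *)

Section SolutionBridge.
Context (R : realType) (a b : \bar R) (n : nat).
Local Notation I := (oint a b).
Local Notation C := R[i].
Local Notation K := ('I_n * bool)%type.
Variables (J : 'M[C]_n) (q w : 'M[dist0 a b]_n).
Variables (lam : {sigma_finite_measure set R -> \bar R}) (t : R -> R) (Q W : R -> 'M[C]_n).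
Hypotheses (ab : (a < b)%E) (nn : dist0_nonneg w) (H : common_densities q w lam t Q W).
Hypotheses (Junit : J \in unitmx) (Jadj : J^t* = - J).
Implicit Types (u v f g : R -> 'cV[C]_n) (k l : K).
Local Notation Jr := (Jr J).
Local Notation Jri := (Jri J).
Local Notation Qr := (Qr Q).
Local Notation Wr := (Wr W).
Local Notation comp u := (components a b u).
Local Notation lint := (loc_rintegrable lam I).
Local Notation bv u := (@balanced_loc_bv R a b n u).
Local Notation sl u f := (slope Jri Qr Wr (comp u) (comp f)).
Let mI := oint_measurable a b.
Let I0 : I !=set0 := oint_nonempty ab.

Lemma bv_vmeasurable u : bv u -> @vmeasurable R a b n u.
Proof.
move=> /balanced_loc_bv_coordinates h; apply: vmeasurable_coordinates => k.
exact: loc_bv_measurable ab (h k).1.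
Qed.

Lemma components_bounded u s r : bv u -> I s -> I r ->
  exists M, forall k x, `[s, r]%classic x -> `|comp u k x| <= M.
Proof.
move=> /balanced_loc_bv_coordinates h Is Ir.
have [M hM] := choice (fun k => loc_bv_bounded (h k).1 Is Ir).
exists (\sum_k `|M k|) => k x; rewrite /= in_itv /= => xsr.
rewrite componentsE; last exact: (oint_conv Is Ir).
apply: (le_trans (hM k x xsr)); apply: (le_trans (ler_norm _)).
by rewrite (bigD1 k)//= lerDl sumr_ge0.
Qed.

Lemma lint_components D u k : bv u -> lint D -> lint (fun x => D x * comp u k x).
Proof.
move=> bvu iD s r Is Ir; have [M hM] := components_bounded bvu Is Ir.
have m := components_measurable k (bv_vmeasurable bvu).
have := rintegrable_bndl (measurable_itv _) (measurable_funTS m) (hM k) (iD s r Is Ir).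
by apply: eq_rintegrable => // x _; rewrite mulrC.
Qed.

Lemma lint_sum (X : finType) (F : X -> R -> R) : (forall i, lint (F i)) ->
  lint (fun x => \sum_i F i x).
Proof. by move=> h s r Is Ir; apply: rintegrable_sum => // i; exact: h. Qed.

Lemma potential_lint u k : bv u -> lint (potential Qr (comp u) k).
Proof.
move=> bvu; apply: lint_sum => l; apply: lint_components => //; exact: (Qr_rintegrable H).
Qed.

Lemma wpair_L2 f : L2fun w f -> rintegrable lam I (wpair Wr (comp f) (comp f)).
Proof.
move=> [mf]; rewrite (sqnormE ab nn H mf) => h; apply/integrableP; split.
  apply/measurable_EFinP; apply: measurable_funTS; apply: (wpair_measurable (Wr_measurable H)).
    by move=> k; exact: components_measurable.
  by move=> k; exact: components_measurable.
under eq_integral do rewrite /= ger0_norm ?(wpair_ge0 (Wr_psd H))//.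
exact: h.
Qed.

Lemma weighted_lint f k : L2fun w f -> lint (weighted Wr (comp f) k).
Proof.
move=> hf s r Is Ir; have mf := hf.1.
apply: (weighted_rintegrable (Wr_measurable H) (Wr_sym H) (Wr_psd H)) => //.
- by move=> l; exact: components_measurable.
- by move=> l m; exact: (Wr_rintegrable H).
- apply: rintegrableS (wpair_L2 hf) => // x; rewrite /= in_itv /=; exact: oint_conv.
Qed.

Lemma slope_lint u f k : bv u -> L2fun w f -> lint (sl u f k).
Proof.
move=> bvu hf s r Is Ir; apply: rintegrable_sum => // l; apply: rintegrableZ => //.
by apply: rintegrableB => //; [exact: weighted_lint|exact: potential_lint].
Qed.

Lemma coordinatesD (x y : 'cV[C]_n) k : coordinates (x + y) k = coordinates x k + coordinates y k.
Proof. by rewrite /coordinates !mxE; case: k.2; case: (x _ _) => ? ?; case: (y _ _). Qed.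

Lemma coordinates_inj (x y : 'cV[C]_n) : coordinates x =1 coordinates y -> x = y.
Proof.
by move=> h; rewrite -[x]coordinatesK -[y]coordinatesK; congr of_coordinates; apply/funext.
Qed.

Let charge_term (m : loc_charge a b) D u phi l : loc_density lam m D -> bv u ->
  @test_fun R a b phi ->
  rintegrable lam I (fun x => phi x * (D x * comp u l x)) /\
  Rint_charge m (fun x => phi x * coordinates (u x) l) =
    \int[lam]_(x in I) (phi x * (D x * comp u l x)).
Proof.
move=> hD bvu hphi; have mu := bv_vmeasurable bvu.
have iD : lint D by move=> s r Is Ir; apply: (hD.2 _ _).1; exact: (itv_rcborel Is Ir).
have i := test_fun_mul_rintegrable I0 hphi (lint_components l bvu iD); split => //.
have E : {in I, (fun x => phi x * (D x * comp u l x)) =1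
    (fun x => phi x * coordinates (u x) l * D x)}.
  by move=> x /set_mem Ix; rewrite componentsE//; ring.
rewrite (Rint_charge_density ab hD).
- by apply: eq_Rintegral => x /E.
- apply: measurable_funM; first exact: test_fun_measurable.
  exact: coordinates_measurable.
- exact: (eq_rintegrable mI E).
Qed.

Lemma qdistr_coordinates u phi k : bv u -> @test_fun R a b phi ->
  coordinates (qdistr q u phi) k = \int[lam]_(x in I) (phi x * potential Qr (comp u) k x).
Proof.
move=> bvu hphi.
have iQ l : rintegrable lam I (fun x => phi x * (Qr k l x * comp u l x)).
  apply: test_fun_mul_rintegrable => //; apply: lint_components => //; exact: (Qr_rintegrable H).
under eq_Rintegral do rewrite /potential mulr_sumr.
rewrite Rintegral_sum// sum_coordinates.
have T i j := charge_term _ (cd_QRe H i j) bvu hphi.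
have S i j := charge_term _ (cd_QIm H i j) bvu hphi.
have R1 (m : loc_charge a b) j : Rint_charge m (fun x => Re ((phi x)%:C * u x j 0)) =
    Rint_charge m (fun x => phi x * coordinates (u x) (j, false)).
  by congr Rint_charge; apply/funext => x; rewrite Re_scale.
have R2 (m : loc_charge a b) j : Rint_charge m (fun x => Im ((phi x)%:C * u x j 0)) =
    Rint_charge m (fun x => phi x * coordinates (u x) (j, true)).
  by congr Rint_charge; apply/funext => x; rewrite Im_scale.
rewrite /coordinates /qdistr !mxE; case: k iQ => i [] iQ /=.
  rewrite Im_sum; apply: eq_bigr => j _; rewrite /dist0_int /= R1 R2.
  by rewrite (T (j, true) i j).2 (S (j, false) i j).2 addrC.
rewrite Re_sum; apply: eq_bigr => j _; rewrite /dist0_int /= R1 R2.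
rewrite (T (j, false) i j).2 (S (j, true) i j).2; congr (_ + _).
rewrite -RintegralN//; last exact: (S (j, true) i j).1.
by apply: eq_Rintegral => x _; rewrite /Qr /realmx /=; ring.
Qed.

(** Testing the equation against phi amounts, coordinate by coordinate, to testing u' against
the slope. *)
Let weak_form u f phi : bv u -> L2fun w f -> @test_fun R a b phi ->
  (J *m @ddistr R a b n u phi + qdistr q u phi = wdistr w f phi) <->
  forall k, \int[lebesgue_measure]_(x in I) (derive1 phi x * coordinates (u x) k) =
    - \int[lam]_(x in I) (phi x * sl u f k x).
Proof.
move=> bvu hf hphi; have mf := hf.1.
pose U k := - \int[lebesgue_measure]_(x in I) (derive1 phi x * coordinates (u x) k).
pose P k := \int[lam]_(x in I) (phi x * potential Qr (comp u) k x).
pose F k := \int[lam]_(x in I) (phi x * weighted Wr (comp f) k x).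
pose S k := \int[lam]_(x in I) (phi x * sl u f k x).
have iP k : rintegrable lam I (fun x => phi x * potential Qr (comp u) k x).
  by apply: test_fun_mul_rintegrable => //; exact: potential_lint.
have iF k : rintegrable lam I (fun x => phi x * weighted Wr (comp f) k x).
  by apply: test_fun_mul_rintegrable => //; exact: weighted_lint.
have SE k : S k = \sum_l Jri k l * (F l - P l).
  transitivity (\int[lam]_(x in I) \sum_l Jri k l *
      (phi x * weighted Wr (comp f) l x - phi x * potential Qr (comp u) l x)).
    by apply: eq_Rintegral => x _; rewrite /slope mulr_sumr; apply: eq_bigr => l _; ring.
  have iB l := rintegrableB mI (iF l) (iP l).
  rewrite Rintegral_sum//; last by move=> l; exact: (rintegrableZ (Jri k l) mI (iB l)).
  by apply: eq_bigr => l _; rewrite (RintegralZl _ mI (iB l)) (RintegralB mI (iF l) (iP l)).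
have inv (M N : K -> K -> R) (x y : K -> R) : (forall k m, \sum_l M k l * N l m = (k == m)%:R) ->
    (forall l, x l = \sum_m N l m * y m) -> forall k, \sum_l M k l * x l = y k.
  move=> MN xy k; under eq_bigr do rewrite xy mulr_sumr.
  rewrite exchange_big /= (bigD1 k)//= [X in _ + X]big1 ?addr0.
    by under eq_bigr do rewrite mulrA; rewrite -mulr_suml MN eqxx mul1r.
  move=> m /negbTE mk; under eq_bigr do rewrite mulrA.
  by rewrite -mulr_suml MN eq_sym mk mul0r.
have E k : coordinates (J *m @ddistr R a b n u phi + qdistr q u phi) k = \sum_l Jr k l * U l + P k.
  rewrite coordinatesD coordinates_mulmx qdistr_coordinates//; congr (_ + _).
  by apply: eq_bigr => l _; rewrite ddistr_coordinates.
have EF k : coordinates (wdistr w f phi) k = F k by rewrite (wdistr_coordinates ab nn H).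
split=> [h k|h].
  have h1 l : F l - P l = \sum_m Jr l m * U m by rewrite -EF -h E addrK.
  by rewrite -[LHS]opprK -/(S k) SE (inv _ _ _ _ (Jri_Jr Junit) h1).
apply: coordinates_inj => k; rewrite E EF.
have h1 l : U l = \sum_m Jri l m * (F m - P m) by rewrite -SE /U h opprK.
by rewrite (inv _ _ _ _ (Jr_Jri Junit) h1) subrK.
Qed.

Theorem solution_cut u f : L2fun w f -> solution J q w f u ->
  bv u /\ cut_solution lam I Jri Qr Wr (comp u) (comp f).
Proof.
move=> hf [bvu eq]; split => //.
have h k : exists z, cut_primitive lam I (sl u f k) z /\
    forall y, I y -> coordinates (u y) k = cut_mean z y.
  have [h1 h2] : @loc_bv R a b (fun x => coordinates (u x) k) /\ @balanced R a b (fun x => coordinates (u x) k).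
    by move: bvu => /balanced_loc_bv_coordinates; exact.
  apply: (weak_derivative_cut_primitive I0 h1 h2 (slope_lint k bvu hf)) => phi hphi.
  exact: (weak_form bvu hf hphi).1 (eq phi hphi) k.
have [z hz] := choice h; exists z; split => [k y Iy|k]; last exact: (hz k).1.
by rewrite componentsE//; exact: (hz k).2.
Qed.

(** The mean of the one-sided values defines the solution also outside of the interval, so that it
has bounded variation as a function on the line. *)
Theorem solution_of_cut (v : K -> R -> R) f : L2fun w f ->
  cut_solution lam I Jri Qr Wr v (comp f) ->
  (forall k, lint (slope Jri Qr Wr v (comp f) k)) ->
  exists u, solution J q w f u /\ forall x k, I x -> coordinates (u x) k = v k x.
Proof.
move=> hf [z [vz hz]] iv; pose u x := of_coordinates (fun k => cut_mean (z k) x).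
have uE x k : coordinates (u x) k = cut_mean (z k) x by rewrite of_coordinatesK.
have bvu : bv u.
  apply/balanced_loc_bv_coordinates => k; under eq_fun do rewrite uE.
  by split; [exact: (cut_mean_loc_bv I0 (iv k) (hz k))|exact: (cut_mean_balanced (iv k) (hz k))].
have slE k x : I x -> sl u f k x = slope Jri Qr Wr v (comp f) k x.
  move=> Ix; apply: eq_bigr => l _; congr (_ * (_ - _)); apply: eq_bigr => m _.
  by rewrite componentsE// uE vz.
exists u; split => [|x k Ix]; last by rewrite uE vz.
split=> // phi hphi; apply/(weak_form bvu hf hphi) => k.
under eq_Rintegral do rewrite uE.
rewrite (cut_primitive_weak I0 (iv k) (hz k) hphi); congr (- _).
by apply: eq_Rintegral => x /set_mem Ix; rewrite slE.
Qed.

End SolutionBridge.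

(** * The maximal and minimal relations *)

Section Relations.
Context (R : realType) (a b : \bar R) (n : nat).
Local Notation I := (oint a b).
Local Notation C := R[i].
Local Notation K := ('I_n * bool)%type.
Variables (J : 'M[C]_n) (q w : 'M[dist0 a b]_n).
Variables (lam : {sigma_finite_measure set R -> \bar R}) (t : R -> R) (Q W : R -> 'M[C]_n).
Hypotheses (ab : (a < b)%E) (nn : dist0_nonneg w) (H : common_densities q w lam t Q W).
Hypotheses (Junit : J \in unitmx) (Jadj : J^t* = - J).
Implicit Types (u v f g : R -> 'cV[C]_n) (k l : K) (U V : L2 w).
Local Notation Jr := (Jr J).
Local Notation Jri := (Jri J).
Local Notation Qr := (Qr Q).
Local Notation Wr := (Wr W).
Local Notation comp u := (components a b u).
Local Notation lint := (loc_rintegrable lam I).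
Local Notation vm u := (@vmeasurable R a b n u).
Local Notation sl := (slope Jri Qr Wr).
Let mI := oint_measurable a b.
Let I0 : I !=set0 := oint_nonempty ab.
Let Ws := Wr_sym H.
Let Wp := Wr_psd H.
Let mW := Wr_measurable H.

(** Equality in L2, expressed by the weighted vectors: u and v themselves may differ in the kernel
of W. *)
Definition weighted_ae_eq u v := {ae lam, forall x, I x ->
  forall k, weighted Wr (comp u) k x = weighted Wr (comp v) k x}.

Lemma wpair_congr (c c' d d' : K -> R -> R) x :
  (forall k, weighted Wr c k x = weighted Wr c' k x) ->
  (forall k, weighted Wr d k x = weighted Wr d' k x) -> wpair Wr c d x = wpair Wr c' d' x.
Proof.
move=> hc hd; transitivity (wpair Wr c d' x); first by apply: eq_bigr => k _; rewrite hd.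
by rewrite !(wpairC Ws _ d'); apply: eq_bigr => k _; rewrite hc.
Qed.

Let wpair_mI u v : vm u -> vm v -> measurable_fun I (wpair Wr (comp u) (comp v)).
Proof.
move=> mu mv; apply: measurable_funTS; apply: (wpair_measurable mW) => k;
  exact: components_measurable.
Qed.

Lemma vmeasurableB u v : vm u -> vm v -> vm (fun x => u x - v x).
Proof.
move=> mu mv i; have [h1 h2] := mu i; have [h3 h4] := mv i; split.
  apply: (eq_measurable_fun (fun x => Re (u x i 0) - Re (v x i 0))); last exact: measurable_funB.
  by move=> x _; rewrite !mxE; case: (u x i 0); case: (v x i 0).
apply: (eq_measurable_fun (fun x => Im (u x i 0) - Im (v x i 0))); last exact: measurable_funB.
by move=> x _; rewrite !mxE; case: (u x i 0); case: (v x i 0).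
Qed.

Lemma componentsB u v : comp (fun x => u x - v x) = fun k x => comp u k x - comp v k x.
Proof.
apply/funext => k; apply/funext => x; have [Ix|nI] := pselect (I x).
  rewrite !componentsE// /coordinates !mxE.
  by case: k.2; case: (u x _ _) => ? ?; case: (v x _ _).
have p0 : point = 0 :> R by [].
by rewrite /components !patchE memNset// p0 subrr.
Qed.

Lemma sqnorm_fin f : vm f -> rintegrable lam I (wpair Wr (comp f) (comp f)) -> (sqnorm w f < +oo)%E.
Proof.
move=> mf /integrableP[_]; rewrite (sqnormE ab nn H mf).
by under eq_integral do rewrite /= ger0_norm ?(wpair_ge0 Wp)//.
Qed.

Lemma sqnorm_eq0 u v : vm u -> vm v ->
  sqnorm w (fun x => u x - v x) = 0%E <-> weighted_ae_eq u v.
Proof.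
move=> mu mv; have md := vmeasurableB mu mv; split=> [h|h].
  have i : rintegrable lam I (wpair Wr (comp (fun x => u x - v x)) (comp (fun x => u x - v x))).
    apply/integrableP; split; first by apply/measurable_EFinP; exact: wpair_mI.
    under eq_integral do rewrite /= ger0_norm ?(wpair_ge0 Wp)//.
    by rewrite -(sqnormE ab nn H md) h.
  have z : \int[lam]_(x in I) wpair Wr (comp (fun x => u x - v x)) (comp (fun x => u x - v x)) x = 0.
    by rewrite /Rintegral -(sqnormE ab nn H md) h.
  apply: (filterS _ (Rintegral_eq0_ae mI i (fun x _ => wpair_ge0 Wp _ x) z)) => x hx Ix k.
  have := weighted_eq0 Ws Wp (hx Ix) k; rewrite componentsB weightedB.
  by move=> /eqP; rewrite subr_eq0 => /eqP.
rewrite (sqnormE ab nn H md) -[RHS](integral0 lam I); apply: ae_eq_integral => //.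
  by apply/measurable_EFinP; exact: wpair_mI.
apply: (filterS _ h) => x hx Ix; rewrite /wpair /= big1// => k _.
by rewrite componentsB weightedB hx// subrr mulr0.
Qed.

Lemma wpair_ae_eq u u' v v' : vm u -> vm u' -> vm v -> vm v' ->
  weighted_ae_eq u u' -> weighted_ae_eq v v' ->
  (\int[lam]_(x in I) (wpair Wr (comp u) (comp v) x)%:E =
   \int[lam]_(x in I) (wpair Wr (comp u') (comp v') x)%:E)%E.
Proof.
move=> mu mu' mv mv' hu hv; apply: ae_eq_integral => //; try by apply/measurable_EFinP; exact: wpair_mI.
apply: (filterS2 _ _ hu hv) => x k1 k2 Ix /=; congr EFin.
by apply: wpair_congr => k; [exact: k1|exact: k2].
Qed.

Lemma weighted_quarter_turn (M : 'M[C]_n) (c : K -> R) k :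
  \sum_l realmx M k l * quarter_turn c l = quarter_turn (fun k => \sum_l realmx M k l * c l) k.
Proof.
rewrite /quarter_turn sum_coordinates /=; case: k => i [] /=; rewrite sum_coordinates -?sumrN;
  by apply: eq_bigr => j _; rewrite /realmx /=; ring.
Qed.

Lemma components_turn u x : (fun k => comp (turn u) k x) = quarter_turn (fun k => comp u k x).
Proof.
apply/funext => k; have [Ix|nI] := pselect (I x).
  rewrite componentsE// coordinates_turn /quarter_turn.
  by case: ifP => _; rewrite componentsE.
have p0 : point = 0 :> R by [].
by rewrite /quarter_turn /components !patchE memNset// p0 oppr0; case: ifP.
Qed.

Lemma weighted_turn u k x :
  weighted Wr (comp (turn u)) k x = quarter_turn (fun k => weighted Wr (comp u) k x) k.
Proof.
rewrite /weighted -weighted_quarter_turn; apply: eq_bigr => l _; congr (_ * _).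
by rewrite -components_turn.
Qed.

(** The equation is complex linear: a turned solution solves the turned equation. *)
Lemma slope_turn u f k x :
  sl (comp (turn u)) (comp (turn f)) k x = quarter_turn (fun k => sl (comp u) (comp f) k x) k.
Proof.
rewrite /slope -weighted_quarter_turn; apply: eq_bigr => l _; congr (_ * _).
have P : potential Qr (comp (turn u)) l x = quarter_turn (fun k => potential Qr (comp u) k x) l.
  rewrite /potential -weighted_quarter_turn; apply: eq_bigr => m _; congr (_ * _).
  by rewrite -components_turn.
by rewrite weighted_turn P /quarter_turn; case: ifP => _; ring.
Qed.

Lemma weighted_ae_eq_turn u v : weighted_ae_eq u v -> weighted_ae_eq (turn u) (turn v).
Proof.
move=> h; apply: (filterS _ h) => x hx Ix k; rewrite !weighted_turn /quarter_turn.
by case: ifP => _; rewrite hx.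
Qed.

Lemma inner_ae_eq u u' v v' : vm u -> vm u' -> vm v -> vm v' ->
  weighted_ae_eq u u' -> weighted_ae_eq v v' -> inner w u v = inner w u' v'.
Proof.
move=> mu mu' mv mv' hu hv; rewrite !(innerE ab nn H)//; congr (_ +i* _); congr fine.
  exact: wpair_ae_eq.
apply: wpair_ae_eq => //; try exact: turn_vmeasurable.
exact: weighted_ae_eq_turn.
Qed.

Lemma L2_reprP U : L2fun w (L2_repr U) /\ sval U = L2class w (L2_repr U).
Proof. by rewrite /L2_repr; case: (cid2 _) => f /= h1 h2. Qed.

Lemma L2_memP U u : sval U u <-> L2fun w u /\ weighted_ae_eq (L2_repr U) u.
Proof.
have [hr ->] := L2_reprP U; split=> -[h1 h2]; split => //.
  by apply/sqnorm_eq0 => //; [exact: hr.1|exact: h1.1].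
by apply/sqnorm_eq0 => //; [exact: hr.1|exact: h1.1].
Qed.

Lemma L2_repr_mem U : sval U (L2_repr U).
Proof.
apply/L2_memP; have [h _] := L2_reprP U; split => //.
by apply: nearW => x.
Qed.

Lemma L2_innerE U V u v : sval U u -> sval V v -> L2_inner U V = inner w u v.
Proof.
move=> /L2_memP[[mu _] hu] /L2_memP[[mv _] hv]; apply: inner_ae_eq => //.
  exact: (L2_reprP U).1.1.
exact: (L2_reprP V).1.1.
Qed.

Definition mkL2 f (hf : L2fun w f) : L2 w := exist _ (L2class w f) (ex_intro2 _ _ f hf erefl).

Lemma mkL2_mem f (hf : L2fun w f) : sval (mkL2 hf) f.
Proof.
split=> //; apply/sqnorm_eq0; [exact: hf.1|exact: hf.1|].
by apply: nearW => x.
Qed.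

Let Qm := Qr_measurable H.
Let Qi := Qr_rintegrable H.
Let Wi := Wr_rintegrable H.
Let Js := Jr_skew Jadj.
Let JJ1 := Jr_Jri Junit.
Let JJ2 := Jri_Jr Junit.

Let Green u v f g : L2fun w u -> L2fun w v -> L2fun w f -> L2fun w g ->
  (forall k, lint (sl (comp u) (comp f) k)) -> (forall k, lint (sl (comp v) (comp g) k)) ->
  cut_solution lam I Jri Qr Wr (comp u) (comp f) ->
  cut_solution lam I Jri Qr Wr (comp v) (comp g) -> @compact_support R a b _ u ->
  \int[lam]_(x in I) wpair Wr (comp v) (comp f) x = \int[lam]_(x in I) wpair Wr (comp g) (comp u) x.
Proof.
move=> hu hv hf hg iu iv su sv [L [cL LI u0]].
have [s [r [Is Ir sr Lsr]]] := compact_oint I0 cL LI.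
have [p [q' [Ipq pq mono exh]]] := oint_exhaustion ab.
have iw f1 f2 : L2fun w f1 -> L2fun w f2 -> rintegrable lam I (wpair Wr (comp f1) (comp f2)).
  move=> h1 h2; apply: (wpair_rintegrable mW Ws Wp) => //.
  - by move=> k; apply: components_measurable; exact: h1.1.
  - by move=> k; apply: components_measurable; exact: h2.1.
  - exact: (wpair_L2 ab nn H).
  - exact: (wpair_L2 ab nn H).
apply: (Green_symmetric (@oint_conv _ a b) (@oint_open _ a b) Ws (Qr_sym H) Js JJ1 Is Ir sr Ipq mono exh mI su sv iu iv).
- move=> k x Ix hx; rewrite componentsE// u0//; last by move=> /Lsr; rewrite /= in_itv.
  by rewrite /coordinates !mxE; case: k.2.
- exact: iw.
- exact: iw.
Qed.

(** Green's formula gives the real parts; applied to the turned pair it gives the imaginary parts. *)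
Lemma Tmax_sub_adjoint : Tmax J q w `<=` adjoint (Tmin J q w).
Proof.
move=> [V G] [v [g [/= Vv Gg hvg]]] [U F] [u [f [/= Uu Ff huf cu]]].
have [hu _] := (L2_memP _ _).1 Uu; have [hv _] := (L2_memP _ _).1 Vv.
have [hf _] := (L2_memP _ _).1 Ff; have [hg _] := (L2_memP _ _).1 Gg.
rewrite (L2_innerE Gg Uu) (L2_innerE Vv Ff).
have [bvu su] := solution_cut ab nn H Junit hf huf.
have [bvv sv] := solution_cut ab nn H Junit hg hvg.
have iu k := slope_lint J ab nn H k bvu hf; have iv k := slope_lint J ab nn H k bvv hg.
rewrite (innerE ab nn H hg.1 hu.1) (innerE ab nn H hv.1 hf.1); congr (_ +i* _).
  by apply/esym; apply: Green.
(* Turning is an isometry. *)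
have tL2 h : L2fun w h -> L2fun w (turn h).
  move=> hh; have mh := turn_vmeasurable hh.1; split => //; apply: sqnorm_fin => //.
  apply: (eq_rintegrable mI) (wpair_L2 ab nn H hh) => x _.
  rewrite /wpair !sum_coordinates; apply: eq_bigr => i _.
  have E k : comp (turn h) k x = quarter_turn (fun k => comp h k x) k by rewrite -components_turn.
  by rewrite !E !weighted_turn /quarter_turn /=; ring.
have itv k : lint (sl (comp (turn v)) (comp (turn g)) k).
  move=> s r Is Ir.
  have E e i : rintegrable lam `[s, r] (sl (comp v) (comp g) (i, e)) by exact: iv.
  apply: (eq_rintegrable (f := fun x => quarter_turn (fun k => sl (comp v) (comp g) k x) k)) => //.
    by move=> x _; rewrite slope_turn.
  by case: k => i []; rewrite /quarter_turn /=; [exact: E|apply: rintegrableN => //; exact: E].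
have stv : cut_solution lam I Jri Qr Wr (comp (turn v)) (comp (turn g)).
  have [z [vz hz]] := sv; exists (fun k c => quarter_turn (fun k => z k c) k); split.
    move=> k y Iy; have -> : comp (turn v) k y = quarter_turn (fun k => comp v k y) k.
      by rewrite -components_turn.
    by rewrite /quarter_turn /cut_mean; case: ifP => _; rewrite vz// /cut_mean; field.
  move=> k c d Ic Id cd; under eq_Rintegral do rewrite slope_turn.
  case: k => i [] /=; rewrite /quarter_turn /=; first exact: hz.
  rewrite RintegralN//; last exact: (loc_rintegrable_cuts (iv _) Ic Id).
  by rewrite -(hz (i, true) c d)//; ring.
by apply/esym; apply: Green => //; apply: tL2.
Qed.

(** Real test pairs are turned into elements of Tmin, and the real part of the orthogonality
relation is used. *)
Lemma adjoint_sub_Tmax : adjoint (Tmin J q w) `<=` Tmax J q w.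
Proof.
move=> [V G] adj; set v := L2_repr V; set g := L2_repr G.
have Vv : sval V v := L2_repr_mem V; have Gg : sval G g := L2_repr_mem G.
have [hv _] := (L2_memP _ _).1 Vv; have [hg _] := (L2_memP _ _).1 Gg.
have stI s r : I s -> I r -> `[s, r] `<=` I.
  by move=> Is Ir x; rewrite /= in_itv /=; exact: oint_conv.
have iloc h : L2fun w h -> forall s r, I s -> I r -> rintegrable lam `[s, r] (wpair Wr (comp h) (comp h)).
  by move=> hh s r Is Ir; apply: rintegrableS (wpair_L2 ab nn H hh) => //; exact: stI.
have orth (u psi : K -> R -> R) s r : I s -> I r -> test_pair lam Wr s r u psi ->
    cut_solution lam I Jri Qr Wr u psi ->
    \int[lam]_x wpair Wr (comp g) u x = \int[lam]_x wpair Wr (comp v) psi x.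
  move=> Is Ir [[mu [M uM] u0] [mpsi psi0 ipsi]] sup.
  have out x : ~ I x -> ~ (s <= x <= r) by move=> nI /(oint_conv Is Ir).
  have p0 : point = 0 :> R by [].
  pose f x : 'cV[C]_n := of_coordinates (fun k => psi k x).
  have fE : comp f = psi.
    apply/funext => k; apply/funext => x; have [Ix|nI] := pselect (I x).
      by rewrite componentsE// of_coordinatesK.
    by rewrite /components patchE memNset// p0 psi0//; exact: out.
  have mf : vm f.
    by apply: vmeasurable_coordinates => k; under eq_fun do rewrite of_coordinatesK; exact: measurable_funTS.
  have hf : L2fun w f.
    by split => //; apply: sqnorm_fin => //; rewrite fE; exact: rintegrableS ipsi.
  have iu k : lint (sl u (comp f) k).
    move=> s1 r1 Is1 Ir1; apply: (slope_rintegrable _ _ _ mu (fun k x _ => uM k x)) => //.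
      by move=> k' l; exact: Qi.
    by move=> l; exact: (weighted_lint ab nn H l hf).
  have suf : cut_solution lam I Jri Qr Wr u (comp f) by rewrite fE.
  have [uc [huc ucE]] := solution_of_cut ab nn H Junit hf suf iu.
  have ucu : comp uc = u.
    apply/funext => k; apply/funext => x; have [Ix|nI] := pselect (I x).
      by rewrite componentsE// ucE.
    by rewrite /components patchE memNset// p0 u0//; exact: out.
  have muc := bv_vmeasurable ab huc.1.
  have hu : L2fun w uc.
    split => //; apply: sqnorm_fin => //; rewrite ucu.
    have i1 : rintegrable lam `[s, r] (wpair Wr u u).
      by apply: (wpair_bounded_rintegrable _ mu (fun k x _ => uM k x)) => // k l; exact: Wi.
    have := @supported_rintegrable _ _ s r _ _ i1; move=> h.
    by apply: rintegrableS (h _) => //; exact: (wpair_supported Wr u0 u0).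
  have hT : Tmin J q w (mkL2 hu, mkL2 hf).
    exists uc, f; split; [exact: mkL2_mem|exact: mkL2_mem|exact: huc|].
    exists `[s, r]%classic; split; [exact: segment_compact|exact: stI|].
    move=> x Ix hx; apply: coordinates_inj => k; rewrite ucE// u0//.
    by rewrite /coordinates !mxE; case: k.2.
  have := adj _ hT; rewrite /= (L2_innerE Gg (mkL2_mem hu)) (L2_innerE Vv (mkL2_mem hf)).
  rewrite (innerE ab nn H hg.1 muc) (innerE ab nn H hv.1 mf) ucu fE => -[+ _].
  have E (h c : K -> R -> R) : supported s r c ->
      \int[lam]_(x in I) wpair Wr h c x = \int[lam]_x wpair Wr h c x.
    move=> c0; rewrite Rintegral_mkcond; apply: eq_Rintegral => x _; rewrite patchE.
    case: ifPn => // /negP; rewrite inE => /out nI; rewrite p0 wpairC//.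
    by rewrite /wpair big1// => k _; rewrite c0// mul0r.
  by rewrite !E.
have [vt [svt mvt ivt aevt]] := solution_of_orthogonal (@oint_conv _ a b) (@oint_open _ a b)
  Qm mW Qi Wi Ws Wp (Qr_sym H) Js JJ1 JJ2
  (fun k => components_measurable k hv.1) (fun k => components_measurable k hg.1)
  (iloc v hv) (iloc g hg) orth I0.
have [u [hu uE]] := solution_of_cut ab nn H Junit hg svt (fun k s r Is Ir => ivt s r Is Ir k).
have mu := bv_vmeasurable ab hu.1.
have weq : weighted_ae_eq v u.
  have [p [q' [Ipq pq mono exh]]] := oint_exhaustion ab.
  have := ae_foralln (fun m => aevt (p m) (q' m) (Ipq m).1 (Ipq m).2).
  apply: filterS => x hx Ix k; have [m /andP[h1 h2]] := exh x Ix.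
  have xpq : `[p m, q' m]%classic x by rewrite /= in_itv /= !ltW.
  have := hx m xpq k; rewrite weightedB => /eqP; rewrite subr_eq0 => /eqP <-.
  by apply: eq_bigr => l _; rewrite componentsE// uE.
have hu2 : L2fun w u.
  split => //; rewrite (sqnormE ab nn H mu) -(wpair_ae_eq hv.1 mu hv.1 mu weq weq).
  by rewrite -(sqnormE ab nn H hv.1); exact: hv.2.
by exists u, g; split => //; apply/L2_memP.
Qed.

End Relations.

Theorem theorem3p1 (R : realType) (a b : \bar R) (n : nat)
    (J : 'M[R[i]]_n) (q w : 'M[dist0 a b]_n) :
  (a < b)%E ->
  J \in unitmx -> J^t* = - J ->
  dist0_hermitian q -> dist0_nonneg w ->
  adjoint (Tmin J q w) = Tmax J q w.
Proof.
move=> ab Ju Ja hq nn; have [lam [t [Q [W H]]]] := common_densities_exist ab hq nn.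
apply/seteqP; split; first exact: (adjoint_sub_Tmax ab nn H Ju Ja).
exact: (Tmax_sub_adjoint ab nn H Ju Ja).
Qed.
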